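(* Let $f\in\mathbb{R}[x]$ and $g=(g_1,\dots,g_m)$ with $g_j\in\mathbb{R}[x]$, $x=(x_1,\dots,x_n)$, and let $f^\star:=\inf_{x\in S(g)}f(x)$. Assume that this optimization problem has an optimal solution $x^\star$ (i.e. $x^\star\in S(g)$ and $f(x^\star)=f^\star$) and that one of the following conditions holds: 1. the image $f(S(g)\cap C(g))$ is finite; 2. the image $f(S(g)\cap C^+(g))$ is finite; 3. the Karush--Kuhn--Tucker conditions hold for the problem at $x^\star$. Then $f^\star$ can be computed by the algorithm OPT described in the context. Precisely, the output of OPT equals $f^\star$ for the following inputs (where $f$ and $g_1,\dots,g_m$ are regarded as polynomials in the enlarged set of variables): $(f,g,h_{\mathrm{FJ}})$ under condition 1; $(f,g,h_{\mathrm{FJ}}^+)$ under condition 2; each of $(f,g,h_{\mathrm{KKT}})$ and $(f,g,h_{\mathrm{KKT}}^+)$ under condition 3.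
   Context: $S(g):=\{x\in\mathbb{R}^n: g_j(x)\ge 0,\ j=1,\dots,m\}$. For polynomials $h=(h_1,\dots,h_l)$ in $N$ variables, $V(h)\subset\mathbb{R}^N$ is the set of common real zeros and $I(h)$ is the ideal generated by $h$. A set is finite if its cardinality is a non-negative integer. Critical sets: let $\varphi^g(x)\in\mathbb{R}^{(n+m)\times m}$ be the matrix whose $j$-th column is $(\nabla g_j(x),\,g_j(x)e_j)$, with $e_j$ the $j$-th standard basis vector of $\mathbb{R}^m$. Set $C(g):=\{x\in\mathbb{R}^n:\operatorname{rank}(\varphi^g(x))<m\}$. For a real matrix $A$, $\operatorname{rank}^+(A)$ is the largest number of columns of $A$ whose convex hull does not contain $0$; set $C^+(g):=\{x\in\mathbb{R}^n:\operatorname{rank}^+(\varphi^g(x))<m\}$. KKT: the Karush--Kuhn--Tucker conditions hold at $u\in S(g)$ if there exist $\lambda_1,\dots,\lambda_m\ge 0$ with $\nabla f(u)=\sum_{j=1}^m\lambda_j\nabla g_j(u)$ and $\lambda_jg_j(u)=0$ for all $j$. With $\bar\lambda=(\lambda_0,\dots,\lambda_m)$ and $\lambda=(\lambda_1,\dots,\lambda_m)$ new variables, define the following tuples of polynomials (vector entries meaning all their coordinates), the first two in $\mathbb{R}[x,\bar\lambda]$ and the last two in $\mathbb{R}[x,\lambda]$: $h_{\mathrm{FJ}}:=(\lambda_0\nabla f-\sum_{j=1}^m\lambda_j\nabla g_j,\ \lambda_1g_1,\dots,\lambda_mg_m,\ 1-\sum_{j=0}^m\lambda_j^2)$, $h_{\mathrm{FJ}}^+:=(\lambda_0^2\nabla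 f-\sum_{j=1}^m\lambda_j^2\nabla g_j,\ \lambda_1^2g_1,\dots,\lambda_m^2g_m,\ 1-\sum_{j=0}^m\lambda_j^2)$, $h_{\mathrm{KKT}}:=(\nabla f-\sum_{j=1}^m\lambda_j\nabla g_j,\ \lambda_1g_1,\dots,\lambda_mg_m)$, $h_{\mathrm{KKT}}^+:=(\nabla f-\sum_{j=1}^m\lambda_j^2\nabla g_j,\ \lambda_1^2g_1,\dots,\lambda_m^2g_m)$. Real radical: for an ideal $I$ of a real polynomial ring $R$, $\sqrt[\mathbb{R}]{I}=\{p\in R:\exists k\in\mathbb{N},\ -p^{2k}\in\Sigma^2+I\}$, $\Sigma^2$ being the set of sums of squares in $R$; equivalently (real Nullstellensatz), it is the set of all polynomials vanishing on the real zero set of $I$. Algorithm OPT. Input: variables $z=(z_1,\dots,z_N)$, $f\in\mathbb{R}[z]$, and tuples $g=(g_1,\dots,g_m)$, $h=(h_1,\dots,h_l)$ of polynomials in $\mathbb{R}[z]$. Let $y=(y_1,\dots,y_m)$ and $t$ be new variables. (a) Set $\tilde h:=(g_1-y_1^2,\dots,g_m-y_m^2,h)$. (b) Compute a finite set of generators $\check h\subset\mathbb{R}[z,y,t]$ of $\sqrt[\mathbb{R}]{I(\tilde h,\,t-f)}$. (c) Compute a Gröbner basis $h^G$ of $I(\check h)$ with respect to the lexicographic order $z_1\succ\dots\succ z_N\succ y_1\succ\dots\succ y_m\succ t$. (d) Set $\hat h:=h^G\cap\mathbb{R}[t]$ and output $\inf V(\hat h)$, where $V(\hat h)\subset\mathbb{R}$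 is the set of common real zeros ($V(\emptyset)=\mathbb{R}$, $\inf\emptyset=+\infty$). Generators of real radicals and Gröbner bases are assumed to be computed exactly; any choice of them is allowed. *)

(* Defs.v *)
(* Multinomials has to be imported before MathComp-Analysis: the opposite order
   makes their notations incompatible. *)
From HB Require Import structures.
From mathcomp Require Import all_boot all_order all_algebra.
From mathcomp Require Import mpoly.
From mathcomp Require Import boolp classical_sets cardinality reals.
From mathcomp Require Import constructive_ereal ereal.

Set Implicit Arguments.
Unset Strict Implicit.
Unset Printing Implicit Defensive.

Import Order.TTheory GRing.Theory Num.Theory.

Local Open Scope classical_set_scope.
Local Open Scope ring_scope.

Section Ideals.
Variables (R : realType) (k : nat).
Local Notation P := {mpoly R[k]}.
Implicit Types (A I : set P) (p q : P) (h G : seq P).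

Definition ideal_gen A : set P :=
  [set p | exists s : seq (P * P),
      (forall ca, ca \in s -> A ca.2) /\ p = \sum_(ca <- s) ca.1 * ca.2].

Definition ideal h : set P := ideal_gen [set` h].

Definition sum_of_squares : set P :=
  [set p | exists s : seq P, p = \sum_(q <- s) q ^+ 2].

Definition real_radical I : set P :=
  [set p | exists e : nat, exists s q,
      [/\ sum_of_squares s, I q & - p ^+ (2 * e) = s + q]].

(* The first variable 'X_0 is the largest one. The order of the library on
   'X_{1..k} compares total degrees first, hence is not used here. *)
Definition lex_le (a b : 'X_{1..k}) : bool :=
  ((a : seq nat) <= b :> seqlexi nat)%O.

Definition lex_max (a b : 'X_{1..k}) := if lex_le a b then b else a.

(* The monomial 1, i.e. 0%MM, is the least one for lex_le. *)
Definition lex_lm p : 'X_{1..k} := \big[lex_max/0%MM]_(a <- msupp p) a.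

(* lex_lterm 0 = 0, so that zero polynomials are harmless below. *)
Definition lex_lterm p : P := p@_(lex_lm p) *: 'X_[lex_lm p].

Definition lex_groebner_basis I G : Prop :=
  [set` G] `<=` I /\
  ideal_gen (lex_lterm @` [set` G]) = ideal_gen (lex_lterm @` I).

End Ideals.

(* p viewed as a polynomial in k variables, 'X_i being renamed into 'X_(s i) *)
Definition mrename (R : realType) (n k : nat) (s : 'I_n -> 'I_k)
    (p : {mpoly R[n]}) : {mpoly R[k]} :=
  p \mPo [tuple 'X_(s i) | i < n].

Section Opt.
Variables (R : realType) (N m : nat).

(* The variables of R[z, y, t] are z_i = 'X_(optz i), y_j = 'X_(opty j) and
   t = 'X_optt, in this order. *)
Definition optz (i : 'I_N) : 'I_(N + m + 1) := lshift 1 (lshift m i).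
Definition opty (j : 'I_m) : 'I_(N + m + 1) := lshift 1 (rshift N j).
Definition optt : 'I_(N + m + 1) := rshift (N + m) ord0.

Definition opt_system (f : {mpoly R[N]}) (g : 'I_m -> {mpoly R[N]})
    (h : seq {mpoly R[N]}) : seq {mpoly R[N + m + 1]} :=
  [seq mrename optz (g j) - 'X_(opty j) ^+ 2 | j <- enum 'I_m]
  ++ [seq mrename optz p | p <- h]
  ++ [:: 'X_optt - mrename optz f].

Definition poly_in_t (q : {poly R}) : {mpoly R[N + m + 1]} :=
  horner_alg 'X_optt q.

(* hG `&` R[t], as univariate polynomials: poly_in_t is injective *)
Definition opt_elim (hG : seq {mpoly R[N + m + 1]}) : set {poly R} :=
  [set q | poly_in_t q \in hG].

Definition opt_values (hG : seq {mpoly R[N + m + 1]}) : set R :=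
  [set c | forall q, opt_elim hG q -> root q c].

(* v is the output of some run of OPT on input (f, g, h); a run is given by
   the choice of generators hc of the real radical and of a Groebner basis hG *)
Definition opt_output (f : {mpoly R[N]}) (g : 'I_m -> {mpoly R[N]})
    (h : seq {mpoly R[N]}) (v : \bar R) : Prop :=
  exists hc hG : seq {mpoly R[N + m + 1]},
    [/\ ideal hc = real_radical (ideal (opt_system f g h)),
        lex_groebner_basis (ideal hc) hG
      & v = ereal_inf (EFin @` opt_values hG)].

(* OPT has at least one run on (f, g, h), and all its runs output v. *)
Definition opt_computes (f : {mpoly R[N]}) (g : 'I_m -> {mpoly R[N]})
    (h : seq {mpoly R[N]}) (v : \bar R) : Prop :=
  forall w : \bar R, opt_output f g h w <-> w = v.

End Opt.

Section Problem.
Variables (R : realType) (n m : nat).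
Variables (f : {mpoly R[n]}) (g : 'I_m -> {mpoly R[n]}).
Implicit Types x u : 'I_n -> R.

Definition feasible : set ('I_n -> R) := [set x | forall j, 0 <= (g j).@[x]].

Definition opt_value : \bar R :=
  ereal_inf [set (f.@[x])%:E | x in feasible].

Definition optimal_solution x : Prop :=
  feasible x /\ (f.@[x])%:E = opt_value.

Definition phi x : 'M[R]_(n + m, m) :=
  col_mx (\matrix_(i < n, j < m) ((g j)^`M(i)).@[x])
         (diag_mx (\row_(j < m) (g j).@[x])).

Definition crit : set ('I_n -> R) := [set x | (\rank (phi x) < m)%N].

Definition in_hull p q (A : 'M[R]_(p, q)) (J : {set 'I_q}) (v : 'cV[R]_p) :=
  exists w : 'I_q -> R,
    [/\ forall j, 0 <= w j, \sum_(j in J) w j = 1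
      & \sum_(j in J) w j *: col j A = v].

(* Columns are counted with multiplicity. *)
Definition rank_plus p q (A : 'M[R]_(p, q)) : nat :=
  \max_(J : {set 'I_q} | `[< ~ in_hull A J 0 >]) #|J|.

Definition crit_plus : set ('I_n -> R) := [set x | (rank_plus (phi x) < m)%N].

Definition KKT u : Prop :=
  exists lam : 'I_m -> R,
    [/\ forall j, 0 <= lam j,
        forall i, (f^`M(i)).@[u] = \sum_(j < m) lam j * ((g j)^`M(i)).@[u]
      & forall j, lam j * (g j).@[u] = 0].

End Problem.

(* k is the number of multipliers: R[x, lambda] is {mpoly R[n + k]}, with
   the x variables first. *)
Definition inx (R : realType) (n k : nat) (p : {mpoly R[n]}) :
  {mpoly R[n + k]} := mrename (lshift k) p.

Section Systems.
Variables (R : realType) (n m : nat).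
Variables (f : {mpoly R[n]}) (g : 'I_m -> {mpoly R[n]}).

Definition lam0 : {mpoly R[n + m.+1]} := 'X_(rshift n ord0).
Definition lamFJ (j : 'I_m) : {mpoly R[n + m.+1]} :=
  'X_(rshift n (lift ord0 j)).
Definition lamKKT (j : 'I_m) : {mpoly R[n + m]} := 'X_(rshift n j).

Definition h_FJ : seq {mpoly R[n + m.+1]} :=
  [seq lam0 * inx m.+1 f^`M(i)
       - \sum_(j < m) lamFJ j * inx m.+1 (g j)^`M(i) | i <- enum 'I_n]
  ++ [seq lamFJ j * inx m.+1 (g j) | j <- enum 'I_m]
  ++ [:: 1 - (lam0 ^+ 2 + \sum_(j < m) lamFJ j ^+ 2)].

Definition h_FJ_plus : seq {mpoly R[n + m.+1]} :=
  [seq lam0 ^+ 2 * inx m.+1 f^`M(i)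
       - \sum_(j < m) lamFJ j ^+ 2 * inx m.+1 (g j)^`M(i) | i <- enum 'I_n]
  ++ [seq lamFJ j ^+ 2 * inx m.+1 (g j) | j <- enum 'I_m]
  ++ [:: 1 - (lam0 ^+ 2 + \sum_(j < m) lamFJ j ^+ 2)].

Definition h_KKT : seq {mpoly R[n + m]} :=
  [seq inx m f^`M(i)
       - \sum_(j < m) lamKKT j * inx m (g j)^`M(i) | i <- enum 'I_n]
  ++ [seq lamKKT j * inx m (g j) | j <- enum 'I_m].

Definition h_KKT_plus : seq {mpoly R[n + m]} :=
  [seq inx m f^`M(i)
       - \sum_(j < m) lamKKT j ^+ 2 * inx m (g j)^`M(i) | i <- enum 'I_n]
  ++ [seq lamKKT j ^+ 2 * inx m (g j) | j <- enum 'I_m].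

End Systems.

(* Main.v *)
Require Import Defs.
From HB Require Import structures.
From mathcomp Require Import all_boot all_order all_algebra.
From mathcomp Require Import ring_quotient generic_quotient fraction closed_field polyrcf.
From mathcomp Require Import mpoly.
From mathcomp Require Import boolp classical_sets cardinality reals.
From mathcomp Require Import constructive_ereal ereal.
From mathcomp Require Import ring lra zify.

(* OPT eliminates all variables but t from the real radical of the system, which
   by the real Nullstellensatz is the vanishing ideal of the zero set. So V(h^)
   is the set of common zeros of the q such that q(f) vanishes on the zero set,
   and it equals the set of values of f there as soon as this set is finite. It
   remains to see that these values are finitely many and that f* is one of them.

   Real Nullstellensatz: if p is not in the real radical, Zorn's lemma yields a
   prime cone containing the ideal and making p nonzero. It orders a residue
   field, which embeds in a real closed field (a maximal cone of an algebraic
   closure); the Cohen-Hormander algorithm then carries the sign conditions of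
   this point over to the reals.

   Finiteness: if f took infinitely many values on a set W, then the polynomial
   ring would have a residue field in which all polynomials vanishing on W vanish
   and f is transcendental, hence a derivation d with d f = 1. At KKT points the
   equations df = sum lambda_j dg_j and lambda_j g_j = 0 force d f = 0. The
   remaining Fritz John points, with lambda_0 = 0, lie in C(g) or C+(g).

   Existence: the Fritz John conditions hold at x*, by Gordan's alternative. *)

Set Implicit Arguments.
Unset Strict Implicit.
Unset Printing Implicit Defensive.

Import Order.TTheory GRing.Theory Num.Theory.

Local Open Scope classical_set_scope.
Local Open Scope ring_scope.

(** * Prime cones *)

(** Finiteness of critical values is usually drawn from the finitely many connected components of a
    semialgebraic set, [f] being constant on each. Derivations replace this topology: in a residue
    field each relation [lambda_j g_j = 0] splits into [lambda_j = 0] or [g_j = 0], and a derivation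
    that factors through the field kills [g_j] in the second case, so every term [lambda_j dg_j]
    disappears. Both prime cones come from one construction, which keeps a multiplicative set [S] of
    squares away from the support: the even powers of [p] for the Nullstellensatz, the squares of
    all nonzero polynomials in [f] for finiteness. Of Tarski's principle only one direction is
    needed: a point over a real closed field is replaced by a real one with the same signs on
    finitely many polynomials. It costs finitely many sign tests on the coefficients, and these
    agree because a prime cone of [R[x]] induces the usual order on the constants. That OPT has a
    run at all is part of the claim; it rests on Dickson's lemma, both for generators of the radical
    and for the Groebner basis. *)

Lemma Zorn_above (T : Type) (Q : set (set T)) (T0 : set T) :
    Q T0 ->
    (forall F : set (set T), F !=set0 -> F `<=` Q -> total_on F subset ->
      Q (\bigcup_(X in F) X)) ->
  exists M, [/\ Q M, T0 `<=` M & forall B, Q B -> M `<=` B -> B `<=` M].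
Proof.
move=> QT0 chainQ.
(* Zorn's lemma ranges over the sets whose union with [T0] satisfies [Q], so that the empty chain is
   covered by [Q T0]. *)
have [F FQ totF|A [QA maxA]] := @Zorn_bigcup T [set X | Q (T0 `|` X)].
  have [->|/set0P [X0 FX0]] := eqVneq F set0.
    by rewrite /= bigcup_set0 setU0.
  rewrite /=.
  have -> : T0 `|` \bigcup_(X in F) X = \bigcup_(Y in [set T0 `|` X | X in F]) Y.
    apply/seteqP; split=> [x [T0x|[X FX Xx]]|x [_ [X FX <-]] [T0x|Xx]].
    - by exists (T0 `|` X0); [exists X0|left].
    - by exists (T0 `|` X); [exists X|right].
    - by left.
    - by right; exists X.
  apply: chainQ => [|_ [X FX <-]|_ _ [X FX <-] [Y FY <-]].
  - by exists (T0 `|` X0), X0.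
  - exact: FQ.
  - by have [XY|YX] := totF _ _ FX FY; [left|right]; apply: setUS.
exists (T0 `|` A); split=> [//|x|B QB AB]; first by left.
have T0B : T0 `|` B = B by apply/setUidPr => x T0x; apply: AB; left.
have [AeB|] := pselect (A = B); first by rewrite AeB; right.
move=> nAB x Bx; have [|nx] := pselect ((T0 `|` A) x) => //.
exfalso; apply: (maxA B); last by rewrite /= T0B.
split; first by move=> y Ay; apply: AB; right.
by move=> BA; apply: nx; right; apply: BA.
Qed.

Section PrimeCones.
Variable A : comNzRingType.
Implicit Types (T S : set A) (a b s t : A).

Definition preordering T : Prop :=
  [/\ forall a b, T a -> T b -> T (a + b),
      forall a b, T a -> T b -> T (a * b) & forall a, T (a ^+ 2)].

(** A point of the real spectrum of [A]: by the last clause the support, where [a] and [- a] both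
    lie in [T], is a prime ideal, and [T] orders its residue field. *)
Definition prime_cone T : Prop :=
  [/\ preordering T, forall a, T a \/ T (- a), ~ T (- 1)
    & forall a b, T (a * b) -> T (- (a * b)) ->
        (T a /\ T (- a)) \/ (T b /\ T (- b))].

Lemma preordering_adjoin T a : preordering T ->
  preordering [set x | exists s t, [/\ T s, T t & x = s + a * t]].
Proof.
move=> [TD TM T2]; split=> [_ _ [s [t [Ts Tt ->]]] [s' [t' [Ts' Tt' ->]]]|
  _ _ [s [t [Ts Tt ->]]] [s' [t' [Ts' Tt' ->]]]|x].
- by exists (s + s'), (t + t'); split; [exact: TD|exact: TD|ring].
- exists (s * s' + a ^+ 2 * (t * t')), (s * t' + t * s'); split; last by ring.
    by apply: (TD); [exact: TM|apply: (TM) => //; exact: TM].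
  by apply: (TD); apply: (TM).
- exists (x ^+ 2), (0 ^+ 2); split=> //; ring.
Qed.

(** Take [T] maximal among the preorderings above [T0] that avoid the opposites of [S]. Adjoining a
    new element must produce the opposite of an element of [S]; two such identities multiply to one
    inside [T], because [S] is multiplicative. The set [S] prescribes what must not vanish at the
    point. *)
Lemma exists_prime_cone T0 S : preordering T0 -> S `<=` T0 -> S 1 ->
    (forall s t, S s -> S t -> S (s * t)) -> (forall s, S s -> ~ T0 (- s)) ->
  exists T, [/\ prime_cone T, T0 `<=` T & forall s, S s -> ~ T (- s)].
Proof.
move=> pT0 ST0 S1 SM ST0N.
pose Q T := [/\ preordering T, T0 `<=` T & forall s, S s -> ~ T (- s)].
have [||T [[pT T0T STN] _ maxT]] := @Zorn_above A Q T0.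
- by split.
- move=> F [X0 FX0] FQ totF.
  have FD x y X Y : F X -> F Y -> X x -> Y y -> exists Z, [/\ F Z, Z x & Z y].
    move=> FX FY Xx Yy; have [XY|YX] := totF _ _ FX FY.
      by exists Y; split=> //; apply: XY.
    by exists X; split=> //; apply: YX.
  split; first split.
  - move=> x y [X FX Xx] [Y FY Yy].
    have [Z [FZ Zx Zy]] := FD _ _ _ _ FX FY Xx Yy; exists Z => //.
    by have [[ZD _ _] _ _] := FQ _ FZ; apply: ZD.
  - move=> x y [X FX Xx] [Y FY Yy].
    have [Z [FZ Zx Zy]] := FD _ _ _ _ FX FY Xx Yy; exists Z => //.
    by have [[_ ZM _] _ _] := FQ _ FZ; apply: ZM.
  - by move=> x; exists X0 => //; have [[_ _ Z2] _ _] := FQ _ FX0.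
  - by move=> x T0x; exists X0 => //; have [_ + _] := FQ _ FX0; apply.
  - by move=> s Ss [X FX]; have [_ _ +] := FQ _ FX; apply.
have [TD TM T2] := pT.
have T0' : T 0 by have := T2 0; rewrite expr0n.
have T1 : T 1 by have := T2 1; rewrite expr1n.
have adj a : ~ T a -> exists s t t', [/\ S s, T t, T t' & - s = t + a * t'].
  move=> nTa; apply: contrapT => nex; apply: nTa.
  apply: (maxT _ _ _ a (_ : [set x | exists s t, [/\ T s, T t & x = s + a * t]] a)).
  - split; first exact: preordering_adjoin.
      by move=> x /T0T Tx; exists x, 0; split=> //; ring.
    move=> s Ss [t [t' [Tt Tt' E]]]; apply: nex; exists s, t, t'; split=> //.
  - by move=> x Tx; exists x, 0; split=> //; ring.
  - by exists 0, 1; split=> //; ring.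
have tot a : T a \/ T (- a).
  apply: contrapT => /not_orP [/adj [s [t [t' [Ss Tt Tt' E]]]]].
  move=> /adj [u [v [v' [Su Tv Tv' E']]]].
  apply: (STN _ (SM _ _ Ss Su)).
  (* This is the product of [a * t' = - (s + t)] and [a * v' = u + v], solved for [- (s * u)]. *)
  have -> : - (s * u) = s * v + t * u + t * v + a ^+ 2 * (t' * v').
    have E1 : a * t' = - (s + t) by rewrite opprD E addrAC subrr add0r.
    have E2 : a * v' = u + v by apply: oppr_inj; rewrite opprD E' mulNr addrAC subrr add0r.
    have -> : a ^+ 2 * (t' * v') = (a * t') * (a * v') by ring.
    rewrite E1 E2; ring.
  have Ts := T0T _ (ST0 _ Ss); have Tu := T0T _ (ST0 _ Su).
  apply: (TD); last by apply: (TM) => //; exact: TM.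
  by apply: (TD); [apply: TD|]; apply: TM.
exists T; split=> //; split=> //; first exact: STN.
move=> a b.
(* An element outside the support becomes strictly positive after a change of sign. This is harmless
   for the product, since [a * b] and its opposite both lie in [T]. *)
have pos x : ~ (T x /\ T (- x)) -> exists y, [/\ ~ T (- y) & y = x \/ y = - x].
  case: (pselect (T (- x))) => Tx; last by exists x; split=> //; left.
  case: (pselect (T x)) => Tx' H; first by case: H.
  by exists (- x); rewrite opprK; split=> //; right.
move=> Tab TabN; apply: contrapT => /not_orP [/pos [x [nx ex]] /pos [y [ny ey]]].
have TxyN : T (- (x * y)).
  by case: ex ey => [] -> [] ->; rewrite ?mulrN ?mulNr ?opprK.
have [s [t [t' [Ss Tt Tt' E]]]] := adj _ nx.
have [u [v [v' [Su Tv Tv' E']]]] := adj _ ny.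
apply: (STN _ (SM _ _ Ss Su)).
have -> : - (s * u) = s * v + t * u + t * v + - (x * y) * (t' * v').
  have E1 : x * t' = s + t by apply: oppr_inj; rewrite opprD E mulNr addrAC subrr add0r.
  have E2 : y * v' = u + v by apply: oppr_inj; rewrite opprD E' mulNr addrAC subrr add0r.
  have -> : - (x * y) * (t' * v') = - ((x * t') * (y * v')) by ring.
  rewrite E1 E2; ring.
have Ts := T0T _ (ST0 _ Ss); have Tu := T0T _ (ST0 _ Su).
apply: (TD); last by apply: (TM) => //; exact: TM.
by apply: (TD); [apply: TD|]; apply: TM.
Qed.

End PrimeCones.

(** * Residue fields of prime ideals *)

Lemma fraction_numden (D : idomainType) (z : {fraction D}) :
  exists x y : D, y != 0 /\ z = FracField.tofrac x / FracField.tofrac y.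
Proof.
elim/quotW: z => r; exists (frac r).1, (frac r).2.
have dN0 := denom_ratioP r; split=> //.
have dF0 : FracField.tofrac (frac r).2 != 0 :> {fraction D} by rewrite tofrac_eq0.
apply: (mulIf dF0); rewrite divfK //; unlock FracField.tofrac.
rewrite -[LHS]FracField.pi_mul /FracField.mulf.
apply/eqmodP; rewrite /= FracField.equivfE !numden_Ratio ?mulf_neq0 ?oner_neq0 //.
by rewrite !mulr1 mulrC.
Qed.

(** An integral domain carries an inverse operation, which a quotient ring does not provide. It is
    chosen classically on the units and is the identity elsewhere; the carrier does not change. *)
Lemma integral_ring_to_idomain (D : comNzRingType) :
    (forall x y : D, x * y = 0 -> (x == 0) || (y == 0)) ->
  exists (E : idomainType) (iota : {rmorphism D -> E}), bijective iota.
Proof.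
move=> Dint.
pose unitD : {pred D} := fun y => `[< exists x, x * y = 1 >].
pose invD (y : D) : D :=
  if pselect (exists x, x * y = 1) is left ex then sval (cid ex) else y.
have mulVD : {in unitD, left_inverse 1 invD *%R}.
  move=> y /asboolP Uy; rewrite /invD; case: pselect => // ex.
  exact: svalP (cid ex).
have unitDP x y : y * x = 1 -> unitD x by move=> yx1; apply/asboolP; exists y.
have invD_out : {in [predC unitD], invD =1 id}.
  move=> y /negP nUy; rewrite /invD; case: pselect => // ex.
  by case: nUy; apply/asboolP.
pose unitMixin := GRing.ComNzRing_hasMulInverse.Build D mulVD unitDP invD_out.
pose Dunit : comUnitRingType := HB.pack D unitMixin.
pose idomMixin := GRing.ComUnitRing_isIntegral.Build Dunit Dint.
pose E : idomainType := HB.pack D Dunit idomMixin.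
pose f : D -> E := id.
pose fZ := GRing.isZmodMorphism.Build D E f (fun _ _ => erefl).
pose fM := GRing.isMonoidMorphism.Build D E f (conj erefl (fun _ _ => erefl)).
pose iota : {rmorphism D -> E} := HB.pack f fZ fM.
by exists E, iota; exists id.
Qed.

(** The field is the fraction field of the quotient by [P]. The description of its elements as
    fractions over [A] later makes it countable when [A] is. *)
Lemma prime_ideal_residue_field (A : comNzRingType) (P : set A) :
    P 0 -> ~ P 1 -> (forall a u v, P u -> P v -> P (a * u + v)) ->
    (forall a b, P (a * b) -> P a \/ P b) ->
  exists (K : fieldType) (ev : {rmorphism A -> K}),
    (forall a, ev a = 0 <-> P a) /\
    forall z, exists a b, ev b != 0 /\ z = ev a / ev b.
Proof.
move=> P0 P1 PD PM.
pose I : {pred A} := fun a => `[< P a >].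
have IP a : reflect (P a) (a \in I) by apply: asboolP.
have Iideal : idealr_closed I.
  split; [exact/IP|by apply/IP|].
  by move=> a u v /IP Pu /IP Pv; apply/IP; apply: PD.
have Iprime : prime_idealr_closed I.
  by move=> a b /IP /PM [] ?; apply/orP; [left|right]; apply/IP.
pose IaM := GRing.isZmodClosed.Build _ I (idealr_closedB Iideal).
pose IpM := isProperIdeal.Build _ I (idealr_closed_nontrivial Iideal).
pose IqM := isPrimeIdealrClosed.Build _ I Iprime.
pose Iid : prime_idealr A := HB.pack I IaM IpM IqM.
pose pi : {rmorphism A -> {ideal_quot Iid}} := \pi_{ideal_quot Iid}%qT.
have [E [iota [jota iotaK jotaK]]] :=
  integral_ring_to_idomain (@Quotient.rquot_IdomainAxiom A Iid).
pose ev : {rmorphism A -> {fraction E}} := @FracField.tofrac E \o (iota \o pi).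
exists {fraction E}, ev; split=> [a|z].
  have -> : (ev a = 0) <-> (pi a = 0).
    split=> [/eqP|pa0]; last by rewrite /= pa0 !rmorph0.
    by rewrite tofrac_eq0 -(rmorph0 iota) => /eqP /(can_inj iotaK).
  have -> : (pi a = 0) <-> (a \in Iid).
    split=> [/eqP|aI]; last apply/eqP; rewrite piE Quotient.equivE subr0 //.
  by split => /IP.
have [x [y [y0 ->]]] := fraction_numden z.
have E' w : exists a, w = iota (pi a) by exists (repr (jota w)); rewrite /= reprK jotaK.
have [a ->] := E' x; have [b bE] := E' y; exists a, b; split; last by rewrite bE.
by rewrite /= tofrac_eq0 -bE.
Qed.

(** * Real closures *)

(* For such a cone [T], the set [T - T] is only a field once [T] is maximal,
   see [subset_total]. *)
Definition field_cone (Om : fieldType) (T : set Om) : Prop :=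
  [/\ T 1, forall x y, T x -> T y -> T (x + y),
      forall x y, T x -> T y -> T (x * y) /\ T ((x - y) ^+ 2),
      forall x, T x -> T x^-1 & ~ T (- 1)].

Lemma exists_maximal_field_cone (Om : fieldType) (T0 : set Om) :
  field_cone T0 ->
  exists T, [/\ field_cone T, T0 `<=` T
    & forall B, field_cone B -> T `<=` B -> B `<=` T].
Proof.
move=> T0c; apply: Zorn_above => // F [X0 FX0] FQ totF.
have FD x y X Y : F X -> F Y -> X x -> Y y -> exists Z, [/\ F Z, Z x & Z y].
  move=> FX FY Xx Yy; have [XY|YX] := totF _ _ FX FY.
    by exists Y; split=> //; apply: XY.
  by exists X; split=> //; apply: YX.
split.
- by exists X0 => //; have [] := FQ _ FX0.
- move=> x y [X FX Xx] [Y FY Yy].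
  have [Z [FZ Zx Zy]] := FD _ _ _ _ FX FY Xx Yy; exists Z => //.
  by have [_ + _ _ _] := FQ _ FZ; apply.
- move=> x y [X FX Xx] [Y FY Yy].
  have [Z [FZ Zx Zy]] := FD _ _ _ _ FX FY Xx Yy.
  by have [_ _ /(_ _ _ Zx Zy) [? ?] _ _] := FQ _ FZ; split; exists Z.
- by move=> x [X FX Xx]; exists X => //; have [_ _ _ + _] := FQ _ FX; apply.
- by move=> [X FX]; have [] := FQ _ FX.
Qed.

Section MaximalFieldCone.
Variables (Om : closedFieldType) (T : set Om).
Hypothesis Tcone : field_cone T.
Hypothesis Tmax : forall B, field_cone B -> T `<=` B -> B `<=` T.

Let T1 : T 1. Proof. by case: Tcone. Qed.
Let TD x y : T x -> T y -> T (x + y).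
Proof. by case: Tcone => _ + _ _ _; apply. Qed.
Let TM x y : T x -> T y -> T (x * y).
Proof. by move=> Tx Ty; case: Tcone => _ _ /(_ _ _ Tx Ty) []. Qed.
Let TB2 x y : T x -> T y -> T ((x - y) ^+ 2).
Proof. by move=> Tx Ty; case: Tcone => _ _ /(_ _ _ Tx Ty) []. Qed.
Let TV x : T x -> T x^-1. Proof. by case: Tcone => _ _ _ + _; apply. Qed.
Let TN1 : ~ T (- 1). Proof. by case: Tcone. Qed.
Let T0 : T 0. Proof. by have := TB2 T1 T1; rewrite subrr expr0n. Qed.

Let TN_eq0 x : T x -> T (- x) -> x = 0.
Proof.
move=> Tx TNx; apply/eqP; apply: contra_notT TN1 => x0.
by rewrite -(mulVf x0) -mulrN; apply: TM => //; apply: TV.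
Qed.

(** If [x - y] is not in [T], maximality says that adjoining it does not give a cone, which can only
    be because [- 1] appears. The same for [y - x]; multiplying the two expressions of [- 1] would
    then put [- 1] in [T]. *)
Let subset_total x y : T x -> T y -> T (x - y) \/ T (- (x - y)).
Proof.
move=> Tx Ty; apply: contrapT => /not_orP [nxy nyx].
pose T' a := [set z | exists s t, [/\ T s, T t & z = s + a * t]].
have adj x' y' : T x' -> T y' -> ~ T (x' - y') ->
    exists s t, [/\ T s, T t & - 1 = s + (x' - y') * t].
  move=> Tx' Ty' nx'y'; apply: contrapT => nex; apply: nx'y'.
  set a := x' - y'; apply: (Tmax (_ : field_cone (T' a))); last first.
  - by exists 0, 1; split=> //; rewrite mulr1 add0r.
  - by move=> z Tz; exists z, 0; split=> //; rewrite mulr0 addr0.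
  have a2 : T (a ^+ 2) by apply: TB2.
  (* Because [a] is [x' - y'], the difference regroups into a difference of two elements of [T], and
     squares of those are in [T]. *)
  have T'2 s t u v : T s -> T t -> T u -> T v -> T ((s + a * t - (u + a * v)) ^+ 2).
    move=> Ts Tt Tu Tv.
    have -> : s + a * t - (u + a * v) = (s + x' * t + (u * 0 + y' * v))
      - (u + x' * v + (s * 0 + y' * t)) by rewrite /a; ring.
    by apply: TB2; do 2?apply: (TD) => //; do ?apply: (TM) => //.
  split.
  - by exists 1, 0; split=> //; rewrite mulr0 addr0.
  - move=> _ _ [s [t [Ts Tt ->]]] [u [v [Tu Tv ->]]].
    by exists (s + u), (t + v); split; [exact: TD|exact: TD|ring].
  - move=> _ _ [s [t [Ts Tt ->]]] [u [v [Tu Tv ->]]]; split.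
      exists (s * u + a ^+ 2 * (t * v)), (s * v + t * u).
      split; last by ring.
        by apply: (TD); [exact: (TM)|apply: (TM); last exact: (TM)].
      by apply: (TD); exact: (TM).
    exists ((s + a * t - (u + a * v)) ^+ 2), 0; split=> //; last by ring.
    exact: T'2.
  (* The inverse of [z] is [z] divided by [z ^+ 2], and the latter lies in [T]. *)
  - move=> _ [s [t [Ts Tt ->]]]; set z := s + a * t.
    have z2 : T (z ^+ 2) by have := T'2 s t 0 0 Ts Tt T0 T0; rewrite mulr0 addr0 subr0.
    have [z0|z0] := eqVneq z 0; first by rewrite z0 invr0; exists 0, 0; split=> //; ring.
    exists (s * (z ^+ 2)^-1), (t * (z ^+ 2)^-1); split; try by apply: TM => //; apply: TV.
    by rewrite mulrA -mulrDl -/z expr2 invfM mulrA divff // mul1r.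
  - by move=> [s [t [Ts Tt E]]]; apply: nex; exists s, t.
have [s [t [Ts Tt E]]] := adj _ _ Tx Ty nxy.
have [|u [v [Tu Tv E']]] := adj _ _ Ty Tx; first by rewrite -opprB.
apply: TN1.
have -> : - 1 = s + u + s * u + (x - y) ^+ 2 * (t * v).
  have E1 : (x - y) * t = - 1 - s by rewrite E addrAC subrr add0r.
  have E2 : (x - y) * v = 1 + u.
    have E3 : (y - x) * v = - 1 - u by rewrite E' addrAC subrr add0r.
    by rewrite -opprB mulNr E3 opprB opprK addrC.
  have -> : (x - y) ^+ 2 * (t * v) = ((x - y) * t) * ((x - y) * v) by ring.
  rewrite E1 E2; ring.
apply: (TD); last by apply: (TM); [exact: TB2|exact: (TM)].
by apply: (TD); [exact: (TD)|exact: (TM)].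
Qed.

Let F : {pred Om} := fun x => `[< T x \/ T (- x) >].
Let FP x : reflect (T x \/ T (- x)) (x \in F). Proof. exact: asboolP. Qed.

Let Fdiv : divring_closed F.
Proof.
split; first by apply/FP; left.
- move=> x y /FP [] Tx /FP [] Ty; apply/FP.
  + exact: subset_total.
  + by left; apply: TD.
  + by right; rewrite opprB addrC; apply: TD.
  + have := subset_total Ty Tx; rewrite opprK.
    by have -> : - y + x = x - y by rewrite addrC.
- move=> x y /FP [] Tx /FP [] Ty; apply/FP.
  + by left; apply: TM => //; apply: TV.
  + by right; rewrite -mulrN -invrN; apply: TM => //; apply: TV.
  + by right; rewrite -mulNr; apply: TM => //; apply: TV.
  + by left; rewrite -mulrNN -invrN; apply: TM => //; apply: TV.
Qed.

Record cone_field := ConeField {cone_val : Om; _ : cone_val \in F}.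
Local Notation K := cone_field.
Local Notation v := cone_val.

HB.instance Definition _ := [isSub for cone_val].
HB.instance Definition _ := [Choice of cone_field by <:].
HB.instance Definition _ := GRing.isDivringClosed.Build Om F Fdiv.
HB.instance Definition _ := [SubChoice_isSubIntegralDomain of cone_field by <:].
HB.instance Definition _ := [SubIntegralDomain_isSubField of cone_field by <:].

Let leK (x y : K) : bool := `[< T (v (y - x)) >].
Let normK (x : K) : K := if leK 0 x then x else - x.
Let le0P x : reflect (T (v x)) (leK 0 x).
Proof. by rewrite /leK subr0; apply: asboolP. Qed.
Let vN (x : K) : v (- x) = - v x. Proof. exact: (raddfN val). Qed.
Let vD (x y : K) : v (x + y) = v x + v y. Proof. exact: (raddfD val). Qed.
Let vM (x y : K) : v (x * y) = v x * v y. Proof. exact: (rmorphM val). Qed.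

Let le0_add x y : leK 0 x -> leK 0 y -> leK 0 (x + y).
Proof. by move=> /le0P Tx /le0P Ty; apply/le0P; rewrite vD; apply: TD. Qed.
Let le0_mul x y : leK 0 x -> leK 0 y -> leK 0 (x * y).
Proof. by move=> /le0P Tx /le0P Ty; apply/le0P; rewrite vM; apply: TM. Qed.
Let le0_anti x : leK 0 x -> leK x 0 -> x = 0.
Proof.
move=> /le0P Tx /asboolP; rewrite sub0r vN => TNx.
by apply: val_inj; rewrite (raddf0 val); apply: TN_eq0.
Qed.
Let sub_ge0 x y : leK 0 (y - x) = leK x y. Proof. by rewrite /leK subr0. Qed.
Let le0_total x : leK 0 x || leK x 0.
Proof.
by have /FP [Tx|Tx] := valP x; apply/orP; [left; apply/le0P|right; apply/asboolP; rewrite sub0r vN].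
Qed.
Let normN (x : K) : normK (- x) = normK x.
Proof.
rewrite /normK; case: (le0P x) => Tx; case: (le0P (- x)) => TNx //.
- by rewrite vN in TNx; apply: val_inj; rewrite [LHS]vN /= (TN_eq0 Tx TNx) oppr0.
- by rewrite opprK.
- by have /FP [] := valP x => // Tx'; case: TNx; rewrite vN.
Qed.
Let ge0_norm x : leK 0 x -> normK x = x. Proof. by rewrite /normK => ->. Qed.

HB.instance Definition _ := Num.IntegralDomain_isLeReal.Build cone_field
  le0_add le0_mul le0_anti sub_ge0 le0_total normN ge0_norm (fun _ _ => erefl).

Let le0v (x : K) : (0 <= x) <-> T (v x).
Proof. by split=> [/le0P //|?]; apply/le0P. Qed.

(* The values of weighted sums of squares at an element of [Om] algebraic over
   [K] are the candidates for extending the cone [T]. *)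
Inductive wsos : {poly K} -> Prop :=
| Wsos0 : wsos 0
| WsosD c f g : 0 <= c -> wsos g -> wsos (c *: f ^+ 2 + g).

Let wsosD f g : wsos f -> wsos g -> wsos (f + g).
Proof.
by move=> wf wg; elim: wf => [|c h h' c0 _ IH]; rewrite ?add0r // -addrA; apply: WsosD.
Qed.

Let wsosZ2 c f g : 0 <= c -> wsos g -> wsos (c *: f ^+ 2 * g).
Proof.
move=> c0; elim=> [|d h h' d0 _ IH]; first by rewrite mulr0; apply: Wsos0.
rewrite mulrDr -scalerAl -scalerAr scalerA -exprMn.
by apply: WsosD => //; apply: mulr_ge0.
Qed.

Let wsosM f g : wsos f -> wsos g -> wsos (f * g).
Proof.
move=> wf wg; elim: wf => [|c h h' c0 _ IH]; first by rewrite mul0r; apply: Wsos0.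
by rewrite mulrDl; apply: wsosD => //; apply: wsosZ2.
Qed.

Let wsos_sqr c f : 0 <= c -> wsos (c *: f ^+ 2).
Proof. by move=> c0; rewrite -[X in wsos X]addr0; apply: WsosD => //; apply: Wsos0. Qed.

Let wsos_ge0 g x : wsos g -> 0 <= g.[x].
Proof.
elim=> [|c h h' c0 _ IH]; first by rewrite horner0.
by rewrite hornerD hornerZ horner_exp addr_ge0 // mulr_ge0 // sqr_ge0.
Qed.

(** Each [f] is replaced by its remainder modulo [p], of size at most [(size p).-1], whose square
    has size at most twice that minus one. The change is divisible by [p], a difference of squares
    having [f - f %% p] as a factor. *)
Let wsos_mod g p : p != 0 -> wsos g ->
  exists g', [/\ wsos g', p %| g - g' & (size g' <= (size p).-1.*2.-1)%N].
Proof.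
move=> p0; elim=> [|c f h c0 _ [h' [wh' ph' sh']]].
  by exists 0; split; [exact: Wsos0|rewrite subrr dvdp0|rewrite size_poly0].
exists (c *: (f %% p) ^+ 2 + h'); split; first exact: WsosD.
  rewrite opprD addrACA; apply: dvdp_add => //.
  rewrite -scalerBr -mul_polyC subr_sqr; apply/dvdp_mull/dvdp_mulr.
  by rewrite {1}(divp_eq f p) addrK dvdp_mulIr.
apply: leq_trans (size_polyD _ _) _; rewrite geq_max sh' andbT.
apply: leq_trans (size_scale_leq _ _) _; rewrite expr2.
apply: leq_trans (size_polyMleq _ _) _.
have := ltn_modpN0 f p0; case: (size p) => [|k] //=; rewrite ltnS => szr.
by rewrite -addnn -!subn1 leq_sub2r // leq_add.
Qed.

Let vr : {rmorphism K -> Om} := val.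

(* A minimal counterexample [p] is irreducible; if [al] is one of its roots in
   [Om], then the weighted sums of squares at [al] form a cone: an identity
   [1 + g = h * p] with [g] such a sum and [deg g < 2 deg p] would make [h] a
   smaller counterexample. By maximality of [T], [al] is in [K]. *)
Let root_of_change (p : {poly K}) (a b : K) :
  p.[a] * p.[b] < 0 -> exists c, root p c.
Proof.
have [n] := ubnP (size p); elim: n p a b => // n IH p a b /ltnSE szp pab.
apply: contrapT => nroot.
have p0 : p != 0 by apply: contraTneq pab => ->; rewrite horner0 mul0r ltxx.
have szp1 : (1 < size p)%N.
  rewrite ltnNge; apply/negP => /size1_polyC E; move: pab.
  by rewrite E !hornerC -expr2 ltNge sqr_ge0.
have split_sign (q r : {poly K}) : (r * q).[a] * (r * q).[b] < 0 ->
    r.[a] * r.[b] < 0 \/ q.[a] * q.[b] < 0.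
  rewrite !hornerM mulrACA; case: (ltrP (r.[a] * r.[b]) 0) => [|rab]; first by left.
  by case: (ltrP (q.[a] * q.[b]) 0) => [|qab]; [right|rewrite ltNge mulr_ge0].
(* A change of sign of a product is one of some factor, so a proper factor would have a root by
   induction. *)
have irr : irreducible_poly p.
  split=> // q sq qp; have /dvdpP [r E] := qp.
  have [r0 q0] : r != 0 /\ q != 0 by apply/andP; rewrite -negb_or -mulf_eq0 -E.
  rewrite -dvdp_size_eqp // eqn_leq dvdp_leq //= leqNgt; apply/negP => ltqp.
  have szE := congr1 (size : {poly K} -> nat) E; rewrite /= size_mul // in szE.
  move: pab; rewrite E => /split_sign [] /IH -[].
  - have sq2 : (1 < size q)%N by rewrite ltn_neqAle eq_sym sq size_poly_gt0.
    apply: leq_trans szp; rewrite szE; move: sq2; case: (size q) => [|[|k]] // _.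
    by rewrite addnS /= addnS ltnS leq_addr.
  - by move=> c rc; apply: nroot; exists c; rewrite E rootM rc.
  - exact: leq_trans ltqp szp.
  - by move=> c rc; apply: nroot; exists c; rewrite E rootM rc orbT.
have [al ral] : exists al, root (map_poly vr p) al.
  by apply/closed_rootP; rewrite size_map_poly; apply: contraTneq szp1 => ->.
pose ev (f : {poly K}) := (map_poly vr f).[al].
have evD f g : ev (f + g) = ev f + ev g by rewrite /ev rmorphD hornerD.
have evB f g : ev (f - g) = ev f - ev g by rewrite /ev rmorphB hornerD hornerN.
have evM f g : ev (f * g) = ev f * ev g by rewrite /ev rmorphM hornerM.
have ev1 : ev 1 = 1 by rewrite /ev rmorph1 hornerC.
have evZ (c : K) f : ev (c *: f) = v c * ev f by rewrite /ev linearZ hornerZ.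
have evp : ev p = 0 by apply/eqP.
have ev_inv f : ~~ (p %| f) -> exists u, ev u * ev f = 1.
  rewrite -(irreducible_poly_coprime _ irr) => /Bezout_eq1_coprimepP [[u1 u2] /= E].
  by exists u2; rewrite -ev1 -E evD !evM evp mulr0 add0r.
have ev_dvd f : ev f = 0 <-> p %| f.
  split=> [f0|/dvdpP [q ->]]; last by rewrite evM evp mulr0.
  apply: contraT => /ev_inv [u]; rewrite f0 mulr0 => /eqP.
  by rewrite eq_sym oner_eq0.
pose T' : set Om := [set z | exists g, wsos g /\ z = ev g].
have T'c : field_cone T'.
  split.
  - exists (1 *: 1 ^+ 2); split; first exact: wsos_sqr.
    by rewrite evZ expr2 mulr1 ev1 mulr1; exact/esym/(rmorph1 vr).
  - move=> _ _ [f [wf ->]] [g [wg ->]]; exists (f + g); split=> //; exact: wsosD.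
  - move=> _ _ [f [wf ->]] [g [wg ->]]; split.
      by exists (f * g); split=> //; exact: wsosM.
    exists (1 *: (f - g) ^+ 2); split; first exact: wsos_sqr.
    by rewrite scale1r expr2 evM evB.
  - move=> _ [g [wg ->]]; have [pg|npg] := boolP (p %| g).
      exists 0; split; first exact: Wsos0.
      by rewrite (iffRL (ev_dvd _) pg) invr0 /ev rmorph0 horner0.
    have [u ug] := ev_inv _ npg; exists ((1 *: u ^+ 2) * g); split.
      by apply: wsosM => //; apply: wsos_sqr.
    have g0 : ev g != 0.
      by apply/eqP => g0; move/eqP: ug; rewrite g0 mulr0 eq_sym oner_eq0.
    by rewrite scale1r expr2 !evM -mulrA ug mulr1; apply: (mulIf g0); rewrite mulVf.
  - move=> [g [wg E]].
    have [g' [wg' /ev_dvd + szg']] := wsos_mod p0 wg.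
    rewrite evB -E => Eg'.
    have /ev_dvd /dvdpP [h hE] : ev (1 + g') = 0.
      by rewrite evD ev1 -[RHS]oppr0 -Eg' opprB opprK addrC.
    have Gpos x : 0 < (1 + g').[x].
      by rewrite hornerD hornerC ltr_wpDr ?ltr01 ?wsos_ge0.
    have h0 : h != 0.
      by apply: contraTneq (Gpos a) => h0; rewrite hE h0 mul0r horner0 ltxx.
    (* [h * p] is positive at [a] and at [b], so [h] changes sign as [p] does; the root of [h] given
       by induction would be a zero of the positive [1 + g']. *)
    have [||c hc] := IH h a b.
    + have arith (sp sg sh k : nat) : (sp <= k)%N -> (1 < sp)%N ->
          (sg <= sp.-1.*2.-1)%N -> (0 < sh)%N -> ((sh + sp).-1 <= maxn 1 sg)%N ->
          (sh < k)%N by lia.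
      apply: (arith _ _ _ _ szp szp1 szg'); first by rewrite size_poly_gt0.
      by have := size_polyD 1 g'; rewrite hE size_mul // size_poly1.
    + have := mulr_gt0 (Gpos a) (Gpos b); rewrite hE !hornerM mulrACA => H.
      rewrite ltNge; apply/negP => hab; move: H; rewrite ltNge.
      by rewrite mulr_ge0_le0 // ltW.
    + by have := Gpos c; rewrite hE hornerM (rootP hc) mul0r ltxx.
have TT' : T `<=` T'.
  move=> x Tx; have xF : x \in F by apply/FP; left.
  exists (ConeField xF *: 1 ^+ 2); split; last by rewrite evZ expr2 mulr1 ev1 mulr1.
  by apply: wsos_sqr; apply/le0v.
have T'T := Tmax T'c TT'.
have sqF (e : K) : T ((al + v e) ^+ 2).
  apply: T'T; exists (1 *: ('X + e%:P) ^+ 2); split; first exact: wsos_sqr.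
  rewrite scale1r expr2 evM evD /ev map_polyX hornerX map_polyC hornerC -expr2.
  by [].
(* [al] is a quarter of the difference of the squares of [al + 1] and [al - 1], both of which lie in
   [T]. *)
have alF : al \in F.
  have v4 : vr 4 != 0 by rewrite fmorph_eq0 pnatr_eq0.
  have -> : al = ((al + vr 1) ^+ 2 - (al + vr (- 1)) ^+ 2) / vr 4.
    by apply: (mulIf v4); rewrite divfK // rmorphN1 rmorph1 rmorph_nat; ring.
  case: Fdiv => _ FB FV; apply: (FV); last exact: (valP (4 : K)).
  by apply: FB; apply/FP; left.
apply: nroot; exists (ConeField alF); apply/eqP/(fmorph_inj vr).
by rewrite -horner_map rmorph0.
Qed.

(** [root_of_change] does not localize its root. A root [c] outside [[a, b]] is divided out:
    ['X - c%:P] has constant sign there, so the quotient still changes sign and is smaller. *)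
Let ivt : Num.real_closed_axiom cone_field.
Proof.
move=> p a b ab /andP [pa pb].
have {pa pb} : p.[a] * p.[b] <= 0 by apply: mulr_le0_ge0.
have [n] := ubnP (size p); elim: n p => // n IH p /ltnSE szp pab.
have [pa0|pa0] := eqVneq p.[a] 0; first by exists a; [rewrite lexx|apply/rootP].
have [pb0|pb0] := eqVneq p.[b] 0; first by exists b; [rewrite lexx andbT|apply/rootP].
have [|c pc] := @root_of_change p a b; first by rewrite lt_neqAle pab mulf_neq0.
have [cab|cNab] := boolP (a <= c <= b); first by exists c.
have [q pE] := factor_theorem _ _ pc.
have q0 : q != 0 by apply: contraNneq pa0 => q0; rewrite pE q0 mul0r horner0.
have cc : 0 < (a - c) * (b - c).
  move: cNab; rewrite negb_and -!ltNge => /orP [ca|bc].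
    by apply: mulr_gt0; rewrite subr_gt0 // (lt_le_trans ca).
  by rewrite nmulr_rgt0 subr_lt0 // (le_lt_trans ab).
have [||x xab qx] := IH q.
- by move: szp; rewrite pE size_Mmonic ?monicXsubC // size_XsubC addn2.
- move: pab; rewrite pE !hornerM mulrACA !hornerXsubC => H.
  by rewrite leNgt; apply/negP => qab; move: H; rewrite leNgt mulr_gt0.
- by exists x => //; rewrite pE rootM qx.
Qed.

HB.instance Definition _ := Num.RealField_isClosed.Build cone_field ivt.

Lemma maximal_field_cone_rcf : exists (L : rcfType) (w : {rmorphism L -> Om}),
  (forall x, T x \/ T (- x) -> exists l, w l = x) /\ forall l, 0 <= l <-> T (w l).
Proof.
exists cone_field, vr; split; last exact: le0v.
by move=> x /FP xF; exists (ConeField xF).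
Qed.

End MaximalFieldCone.

Lemma prime_cone_rcf (A : countComNzRingType) (Q : set A) : prime_cone Q ->
  exists (L : rcfType) (phi : {rmorphism A -> L}), forall a, Q a <-> 0 <= phi a.
Proof.
move=> [[QD QM Q2] Qtot QN1 Qprime].
have Q1 : Q 1 by have := Q2 1; rewrite expr1n.
have Q0 : Q 0 by have := Q2 0; rewrite expr0n.
pose P : set A := [set a | Q a /\ Q (- a)].
have PM a u : P u -> P (a * u).
  by move=> [Qu QNu]; have [Qa|Qa] := Qtot a; split;
    rewrite -?mulrN; first [exact: QM | rewrite -mulrNN ?opprK; exact: QM].
have [K [ev [evP evfrac]]] : exists (K : fieldType) (ev : {rmorphism A -> K}),
    (forall a, ev a = 0 <-> P a) /\ forall z, exists a b, ev b != 0 /\ z = ev a / ev b.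
  apply: prime_ideal_residue_field.
  - by split; rewrite ?oppr0.
  - by move=> [].
  - by move=> a u w /(PM a) [Qu QNu] [Qw QNw]; split; rewrite ?opprD; apply: QD.
  - by move=> a b [Qab QNab]; exact: Qprime.
(* A choice of fractions codes [K] by pairs of elements of the countable [A]; this gives access to
   the algebraic closure [Om]. *)
have [num numP] := choice evfrac.
have [den denP] := choice numP.
pose Kcode z := (num z, den z).
pose Kdecode (ab : A * A) := ev ab.1 / ev ab.2.
have KcodeK : cancel Kcode Kdecode.
  by move=> z; have [_ zE] := denP z; exact/esym.
pose KC : countFieldType := HB.pack (GRing.Field.sort K) K
  (isCountable.Build K (pcan_pickleK (can_pcan KcodeK))).
have [Om [iota _]] := countable_algebraic_closure KC.
pose io : {rmorphism K -> Om} := iota.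
pose T0 : set Om := [set x | exists a b, [/\ Q a, Q b, ev b != 0 & x = io (ev a / ev b)]].
have QevN0 a : Q a -> ~ Q (- a) -> ev a != 0.
  by move=> Qa nQa; apply/eqP => /evP [].
have [|T [Tc T0T Tmax]] := @exists_maximal_field_cone Om T0.
  split.
  - by exists 1, 1; split=> //; rewrite ?rmorph1 ?oner_neq0 // divff ?rmorph1 ?oner_neq0.
  - move=> _ _ [a [b [Qa Qb b0 ->]]] [c [d [Qc Qd d0 ->]]].
    exists (a * d + c * b), (b * d); split; [by apply: QD; apply: QM|exact: QM| |].
      by rewrite rmorphM mulf_neq0.
    by rewrite -rmorphD addf_div // -!rmorphM -rmorphD.
  - move=> _ _ [a [b [Qa Qb b0 ->]]] [c [d [Qc Qd d0 ->]]]; split.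
      exists (a * c), (b * d); split; [exact: QM|exact: QM| |].
        by rewrite rmorphM mulf_neq0.
      by rewrite -rmorphM mulf_div -!rmorphM.
    exists ((a * d - c * b) ^+ 2), ((b * d) ^+ 2); split=> //.
      by rewrite rmorphXn expf_neq0 // rmorphM mulf_neq0.
    rewrite -rmorphB -rmorphXn; congr (io _).
    by rewrite -mulNr addf_div // expr_div_n -!rmorphM -rmorphN -rmorphM -rmorphD -!rmorphXn mulNr.
  - move=> _ [a [b [Qa Qb b0 ->]]]; have [a0|a0] := eqVneq (ev a) 0.
      exists 0, 1; split=> //; first by rewrite rmorph1 oner_neq0.
      by rewrite a0 mul0r rmorph0 invr0 rmorph0 mul0r rmorph0.
    by exists b, a; split=> //; rewrite -fmorphV invf_div.
  - move=> [a [b [Qa Qb b0 E]]].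
    have : ev (a + b) = 0.
      have : ev a / ev b = - 1 by apply: (fmorph_inj io); rewrite -E rmorphN1.
      by move/(canRL (divfK b0)); rewrite rmorphD mulN1r => ->; rewrite addNr.
    move=> /evP [_ QN]; move/eqP: b0; apply; apply/evP; split=> //.
    have -> : - b = a + - (a + b) by rewrite opprD addNKr.
    exact: QD.
have [L [w [wsurj wpos]]] := maximal_field_cone_rcf Tc Tmax.
pose e a := io (ev a).
have Te a : Q a -> T (e a).
  move=> Qa; apply: T0T; exists a, 1; split=> //; first by rewrite rmorph1 oner_neq0.
  by rewrite rmorph1 divr1.
have lift a : exists l, w l = e a.
  apply: wsurj; have [Qa|QNa] := Qtot a; [left|right]; first exact: Te.
  by rewrite -rmorphN -rmorphN; apply: Te.
have [phi phiE] := choice lift.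
have phiB : zmod_morphism phi.
  by move=> a b; apply: (fmorph_inj w); rewrite rmorphB !phiE /e !rmorphB.
have phiM : monoid_morphism phi.
  split=> [|a b]; apply: (fmorph_inj w); first by rewrite phiE /e !rmorph1.
  by rewrite rmorphM !phiE /e !rmorphM.
pose phiZm := GRing.isZmodMorphism.Build A L phi phiB.
pose phiMm := GRing.isMonoidMorphism.Build A L phi phiM.
exists L, (HB.pack phi phiZm phiMm : {rmorphism A -> L}) => a.
have -> : (0 <= phi a) <-> T (e a) by rewrite -phiE.
split=> [/Te //|Ta]; have [//|QNa] := Qtot a.
(* Now [e a] and its opposite both lie in [T], hence [e a] vanishes, as otherwise [- 1] would be in
   [T]. So [a] is in the support of [Q]. *)
have ea0 : e a = 0.
  apply: contrapT => /eqP ea0; case: Tc => _ _ TM TV; apply.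
  have TNa : T (- e a) by rewrite -rmorphN -rmorphN; apply: Te.
  by rewrite -(mulVf ea0) -mulrN; apply TM => //; apply: TV.
suff : ev a = 0 by move/evP => [].
by apply: (fmorph_inj io); rewrite rmorph0.
Qed.

(** * Transfer of sign conditions between real closed fields *)

Lemma deriv_eq0 (F : idomainType) (p : {poly F}) :
  (forall n, n.+1%:R != 0 :> F) -> p^`() = 0 -> p = (p`_0)%:P.
Proof.
move=> F0 dp; apply/polyP=> [[|i]]; rewrite coefC //=.
have /eqP := congr1 (fun q : {poly F} => q`_i) dp.
by rewrite coef_deriv coef0 -mulr_natr mulf_eq0 (negbTE (F0 i)) orbF => /eqP.
Qed.

Section ClosedFamilies.
Variable A : comNzRingType.
Implicit Types (p q : {poly A}) (G : seq {poly A}).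

(** What is left of [p] under a specialization that kills its leading coefficient. *)
Definition trunc_lead p : {poly A} := p - lead_coef p *: 'X^((size p).-1).

Lemma size_trunc_lead p : p != 0 -> (size (trunc_lead p) < size p)%N.
Proof.
rewrite -size_poly_gt0 /trunc_lead => sp.
rewrite -[X in (_ < X)%N](prednK sp) ltnS; apply/leq_sizeP => j lej.
rewrite coefB coefZ coefXn; case: eqVneq => [->|nj].
  by rewrite mulr1 subrr.
rewrite mulr0 subr0 nth_default // -(prednK sp) ltn_neqAle lej andbT eq_sym //.
Qed.

(* [k = 0] is the closure property needed for the Cohen-Hormander algorithm;
   larger [k] only occur in the construction of the closure, by decreasing
   sizes. *)
Definition closed_above (k : nat) G : Prop :=
  [/\ forall p, p \in G -> (k < size p)%N -> p^`() \in G /\ trunc_lead p \in G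
    & forall p q, p \in G -> q \in G -> (k < size q)%N -> (size q <= size p)%N ->
        Pdiv.Ring.rmodp p q \in G].

(** Derivatives, truncations and remainders by a divisor of size [k.+1] have size at most [k].
    Adding those for the current top size thus leaves all larger sizes untouched, and the size
    treated decreases. *)
Lemma exists_closed_family (ps : seq {poly A}) : exists G, {subset ps <= G} /\ closed_above 0 G.
Proof.
suff H k G : closed_above k G -> exists G', {subset G <= G'} /\ closed_above 0 G'.
  have [k szk] : exists k, forall p, p \in ps -> (size p <= k)%N.
    elim: ps => [|p ps [k IH]]; first by exists 0.
    exists (maxn (size p) k) => q; rewrite inE leq_max => /orP [/eqP ->|/IH ->].
      by rewrite leqnn.
    by rewrite orbT.
  by apply: (H k); split=> [p|p q _] inps; rewrite ltnNge szk.
elim: k G => [|k IH] G.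
  by move=> cG; exists G; split=> // p.
move=> [dtG modG].
pose Gk := [seq q : {poly A} <- G | size q == k.+1].
pose N := [seq p^`() | p <- Gk] ++ [seq trunc_lead p | p <- Gk]
  ++ [seq Pdiv.Ring.rmodp p q | p <- G, q <- Gk].
have szN p : p \in N -> (size p <= k)%N.
  rewrite !mem_cat => /orP [/mapP [q]|/orP [/mapP [q]|/allpairsP [[r q] /= [_]]]];
    rewrite mem_filter => /andP [/eqP sq _];
    have q0 : q != 0 by rewrite -size_poly_gt0 sq.
  - by move=> ->; rewrite -ltnS -sq; apply: lt_size_deriv.
  - by move=> ->; rewrite -ltnS -sq; apply: size_trunc_lead.
  - by move=> ->; rewrite -ltnS -sq Pdiv.Ring.ltn_rmodp.
have [|G' [GG' cG']] := IH (G ++ N); last first.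
  by exists G'; split=> // p Gp; apply: GG'; rewrite mem_cat Gp.
have inG p : p \in G ++ N -> (k < size p)%N -> p \in G.
  by rewrite mem_cat => /orP [//|/szN]; rewrite leqNgt => /negP.
split=> [p /inG H kp|p q /inG Hp /inG Hq kq qp].
  have Gp := H kp; rewrite !mem_cat; move: kp; rewrite leq_eqVlt => /orP [/eqP kp|kp].
    split; apply/orP; right; apply/orP; [left|right; apply/orP; left];
      by apply/mapP; exists p; rewrite // mem_filter Gp -kp eqxx.
  by have [-> ->] := dtG _ Gp kp.
have Gp := Hp (leq_trans kq qp); have Gq := Hq kq.
rewrite !mem_cat; move: kq; rewrite leq_eqVlt => /orP [/eqP kq|kq].
  apply/orP; right; apply/orP; right; apply/orP; right.
  by apply/allpairsP; exists (p, q); split=> //=; rewrite mem_filter Gq -kq eqxx.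
by rewrite modG.
Qed.

End ClosedFamilies.

Section RootMatching.
Variable A : comNzRingType.
Variable G : seq {poly A}.
Hypothesis Gclosed : closed_above 0 G.
Implicit Types (p q : {poly A}) (H : seq {poly A}).

Let Gderiv p : p \in G -> p != 0 -> p^`() \in G.
Proof. by move=> Gp; rewrite -size_poly_gt0 => p0; have [/(_ _ Gp p0) []] := Gclosed. Qed.
Let Gtrunc p : p \in G -> p != 0 -> trunc_lead p \in G.
Proof. by move=> Gp; rewrite -size_poly_gt0 => p0; have [/(_ _ Gp p0) []] := Gclosed. Qed.
Let Gmod p q : p \in G -> q \in G -> q != 0 -> (size q <= size p)%N ->
  Pdiv.Ring.rmodp p q \in G.
Proof. by move=> Gp Gq; rewrite -size_poly_gt0 => p0; have [_ /(_ _ _ Gp Gq p0)] := Gclosed. Qed.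

(** All that has to be known of the coefficients: as [G] is stable under truncation, these signs
    determine the degree and the leading sign of every specialized polynomial of [G]. *)
Definition lead_match (L R : rcfType) (phi : A -> L) (psi : A -> R) : Prop :=
  forall p, p \in G -> sgz (phi (lead_coef p)) = sgz (psi (lead_coef p)).

Lemma map_trunc_lead (F : rcfType) (phi : {rmorphism A -> F}) p :
  phi (lead_coef p) = 0 -> map_poly phi p = map_poly phi (trunc_lead p).
Proof. by move=> p0; rewrite rmorphB /= linearZ /= p0 scale0r subr0. Qed.

Lemma lead_match_map (L R : rcfType) (phi : {rmorphism A -> L}) (psi : {rmorphism A -> R}) p :
    lead_match phi psi -> p \in G ->
  size (map_poly phi p) = size (map_poly psi p) /\
  sgz (lead_coef (map_poly phi p)) = sgz (lead_coef (map_poly psi p)).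
Proof.
move=> lm; have [n] := ubnP (size p); elim: n p => // n IH p /ltnSE szp Gp.
have [->|p0] := eqVneq p 0; first by rewrite !rmorph0 !lead_coef0 !sgz0 !size_poly0.
have E := lm _ Gp; have [l0|l0] := eqVneq (phi (lead_coef p)) 0.
  have r0 : psi (lead_coef p) = 0 by apply/eqP; rewrite -sgz_eq0 -E l0 sgz0.
  rewrite (map_trunc_lead l0) (map_trunc_lead r0); apply: IH; last exact: Gtrunc.
  exact: leq_trans (size_trunc_lead p0) szp.
have r0 : psi (lead_coef p) != 0 by rewrite -sgz_eq0 -E sgz_eq0.
by rewrite !size_map_poly_id0 // !lead_coef_map_eq.
Qed.

Lemma lead_match_sym (L R : rcfType) (phi : A -> L) (psi : A -> R) :
  lead_match phi psi -> lead_match psi phi.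
Proof. by move=> lm p Gp; rewrite lm. Qed.

Definition match_at (L R : rcfType) (phi : A -> L) (psi : A -> R) (a : L * R) p : Prop :=
  sgz (map_poly phi p).[a.1] = sgz (map_poly psi p).[a.2].

Definition roots_listed (F : rcfType) (phi : A -> F) H (s : seq F) : Prop :=
  forall p x, p \in H -> map_poly phi p != 0 -> root (map_poly phi p) x -> x \in s.

Definition roots_between (F : rcfType) (phi : A -> F) (a b : F) : Prop :=
  forall p x, p \in G -> map_poly phi p != 0 -> root (map_poly phi p) x -> a < x < b.

(* [s] is an order isomorphism between a finite part of [L] and one of [R]
   which contains all the roots of [H] and respects the signs of [H]; its extreme
   points lie outside the roots of all of [G]. *)
Definition matching (L R : rcfType) (phi : A -> L) (psi : A -> R) H
    (s : seq (L * R)) : Prop :=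
  [/\ forall a b, a \in s -> b \in s -> (a.1 < b.1) = (a.2 < b.2),
      roots_listed phi H (unzip1 s) /\ roots_listed psi H (unzip2 s),
      forall a p, a \in s -> p \in H -> match_at phi psi a p
    & exists m M, [/\ m \in s, M \in s,
        roots_between phi m.1 M.1 /\ roots_between psi m.2 M.2
        & forall p, p \in G -> match_at phi psi m p /\ match_at phi psi M p]].

Definition swap (L R : Type) (a : L * R) := (a.2, a.1).

Lemma matching_sym (L R : rcfType) (phi : A -> L) (psi : A -> R) H s :
  matching phi psi H s -> matching psi phi H [seq swap a | a <- s].
Proof.
move=> [iso [rL rR] mt [m [M [ms Ms [bL bR] mM]]]]; split.
- by move=> _ _ /mapP [a as_ ->] /mapP [b bs ->] /=; rewrite iso.
- by rewrite /unzip1 /unzip2 -!map_comp.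
- by move=> _ p /mapP [a as_ ->] Hp; rewrite /match_at mt.
- exists (swap m), (swap M); split=> //; try exact: map_f.
  by move=> p /mM [H1 H2]; split; rewrite /match_at ?H1 ?H2.
Qed.

Lemma sgz_noroot (F : rcfType) (p : {poly F}) (i : interval F) x y :
  {in i, forall z, ~~ root p z} -> x \in i -> y \in i -> sgz p.[x] = sgz p.[y].
Proof. by move=> nr xi yi; rewrite -[LHS]sgz_sgr (polyrN0_itv nr yi xi) sgz_sgr. Qed.

Lemma seq_max (F : rcfType) (T : eqType) (key : T -> F) (P : T -> Prop) (s : seq T) a0 :
  a0 \in s -> P a0 ->
  exists a, [/\ a \in s, P a & forall c, c \in s -> P c -> key c <= key a].
Proof.
elim: s a0 => // b s IH a0 as_ Pa.
have [[a [sa Pa' amax]]|nex] := pselect (exists a, [/\ a \in s, P a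
    & forall c, c \in s -> P c -> key c <= key a]).
  have [[Pb ba]|nb] := pselect (P b /\ key a <= key b).
    exists b; split=> //; first exact: mem_head.
    move=> c; rewrite inE => /orP [/eqP -> //|cs Pc].
    exact: le_trans (amax _ cs Pc) ba.
  exists a; split=> //; first by rewrite inE sa orbT.
  move=> c; rewrite inE => /orP [/eqP -> Pb|cs Pc]; last exact: amax.
  by rewrite leNgt; apply/negP => /ltW ?; apply: nb.
have nP c : c \in s -> ~ P c by move=> cs Pc; apply: nex; apply: IH cs Pc.
move: as_; rewrite inE => /orP [/eqP E|/nP //].
exists b; rewrite -E; split=> //; first by rewrite inE eqxx.
by move=> c; rewrite inE => /orP [/eqP -> //|/nP].
Qed.

Section Gap.
Variables (L R : rcfType) (phi : {rmorphism A -> L}) (psi : {rmorphism A -> R}).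
Hypothesis lm : lead_match phi psi.
Variables (H : seq {poly A}) (s : seq (L * R)).
Hypothesis ms : matching phi psi H s.
Hypothesis HG : {subset H <= G}.
Variables a b : L * R.
Hypotheses (sa : a \in s) (sb : b \in s) (ab : a.1 < b.1).
Hypothesis gap : forall c, c \in s -> ~~ (a.1 < c.1 < b.1).

Lemma map_eq0 p : p \in G -> (map_poly phi p == 0) = (map_poly psi p == 0).
Proof.
by move=> Gp; have [sz _] := lead_match_map lm Gp; rewrite -!size_poly_eq0 sz.
Qed.

Lemma gap_norootL p x : p \in H -> map_poly phi p != 0 -> a.1 < x < b.1 ->
  ~~ root (map_poly phi p) x.
Proof.
move=> Hp p0 xab; apply/negP => px; have [_ [rL _] _ _] := ms.
by have /mapP [c cs xE] := rL _ _ Hp p0 px; have := gap cs; rewrite -xE xab.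
Qed.

Lemma gap_norootR p x : p \in H -> map_poly psi p != 0 -> a.2 < x < b.2 ->
  ~~ root (map_poly psi p) x.
Proof.
move=> Hp p0 xab; apply/negP => px; have [iso [_ rR] _ _] := ms.
have /mapP [c cs xE] := rR _ _ Hp p0 px; have := gap cs.
by rewrite (iso _ _ sa cs) (iso _ _ cs sb) -xE xab.
Qed.

(** No listed root lies in the gap, so the sign inside is that at an endpoint where [p] does not
    vanish, and endpoints are matched. If [p] vanished at both, Rolle would put a root of the listed
    derivative in the gap. *)
Lemma gap_sgz p x xi : p \in H -> (p != 0 -> p^`() \in H) ->
  a.1 < x < b.1 -> a.2 < xi < b.2 -> match_at phi psi (x, xi) p.
Proof.
move=> Hp Hp' xab xiab; have Gp := HG Hp; rewrite /match_at /=.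
have [iso [rL _] mt _] := ms.
have [p0|p0] := eqVneq (map_poly phi p) 0.
  by move/eqP: (p0); rewrite map_eq0 // => /eqP ->; rewrite p0 !horner0 !sgz0.
have q0 : map_poly psi p != 0 by rewrite -map_eq0.
have ma := mt _ _ sa Hp; have mb := mt _ _ sb Hp; rewrite /match_at in ma mb.
have [pa0|pa0] := eqVneq (map_poly phi p).[a.1] 0; last first.
  have qa0 : (map_poly psi p).[a.2] != 0 by rewrite -sgz_eq0 -ma sgz_eq0.
  rewrite (@sgz_noroot _ (map_poly phi p) `[a.1, b.1[ x a.1).
  - rewrite ma (@sgz_noroot _ (map_poly psi p) `[a.2, b.2[ a.2 xi) //.
    + move=> z; rewrite in_itv /= le_eqVlt => /andP [/orP [/eqP <- _|az zb]].
        by rewrite /root.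
      by rewrite gap_norootR // az.
    + by rewrite in_itv /= lexx -iso.
    + by rewrite in_itv /=; case/andP: xiab => /ltW -> ->.
  - move=> z; rewrite in_itv /= le_eqVlt => /andP [/orP [/eqP <- _|az zb]].
      by rewrite /root.
    by rewrite gap_norootL // az.
  - by rewrite in_itv /=; case/andP: xab => /ltW -> ->.
  - by rewrite in_itv /= lexx.
have [pb0|pb0] := eqVneq (map_poly phi p).[b.1] 0; last first.
  have qb0 : (map_poly psi p).[b.2] != 0 by rewrite -sgz_eq0 -mb sgz_eq0.
  rewrite (@sgz_noroot _ (map_poly phi p) `]a.1, b.1] x b.1).
  - rewrite mb (@sgz_noroot _ (map_poly psi p) `]a.2, b.2] b.2 xi) //.
    + move=> z; rewrite in_itv /= [_ <= b.2]le_eqVlt => /andP [az /orP [/eqP ->|zb]].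
        by rewrite /root.
      by rewrite gap_norootR // az.
    + by rewrite in_itv /= lexx -iso ?ab.
    + by rewrite in_itv /=; case/andP: xiab => -> /ltW ->.
  - move=> z; rewrite in_itv /= [_ <= b.1]le_eqVlt => /andP [az /orP [/eqP ->|zb]].
      by rewrite /root.
    by rewrite gap_norootL // az.
  - by rewrite in_itv /=; case/andP: xab => -> /ltW ->.
  - by rewrite in_itv /= lexx ab.
have [c cab c0] := poly_rolle ab (etrans pa0 (esym pb0)).
have pN0 : p != 0 by apply: contraNneq p0 => ->; rewrite rmorph0.
have [d0|d0] := eqVneq (map_poly phi p^`()) 0; last first.
  have := gap_norootL (Hp' pN0) d0 (_ : a.1 < c < b.1).
  by rewrite -deriv_map /root c0 eqxx; move: cab; rewrite in_itv /= => -> /(_ isT).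
have E : map_poly phi p = ((map_poly phi p)`_0)%:P.
  by apply: deriv_eq0; [move=> n; rewrite pnatr_eq0|rewrite deriv_map d0].
by move: pa0 p0; rewrite E hornerC => ->; rewrite eqxx.
Qed.

End Gap.

Section AddPoly.
Variables (L R : rcfType) (phi : {rmorphism A -> L}) (psi : {rmorphism A -> R}).
Hypothesis lm : lead_match phi psi.
Variables (H : seq {poly A}) (p : {poly A}).
Hypothesis HG : {subset H <= G}.
Hypothesis Hderiv : forall q, q \in H -> q != 0 -> q^`() \in H.
Hypotheses (Gp : p \in G) (Hp' : p^`() \in H) (p0 : map_poly phi p != 0).

Lemma matching_gap s x (ms : matching phi psi H s) : x \notin unzip1 s ->
    root (map_poly phi p) x ->
  exists a b, [/\ a \in s, b \in s, a.1 < x < b.1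
    & forall c, c \in s -> ~~ (a.1 < c.1 < b.1)].
Proof.
move=> xs px; have [_ _ _ [m [M [sm sM [bL _] _]]]] := ms.
have /andP [mx xM] := bL _ _ Gp p0 px.
have [a [sa ax amax]] := @seq_max L _ fst (fun c => c.1 < x) s m sm mx.
have [b [sb bx bmin]] := @seq_max L _ (fun c => - c.1) (fun c => x < c.1) s M sM xM.
exists a, b; split=> //; first by rewrite ax.
move=> c sc; apply/negP => /andP [ac cb].
have [cx|xc|cx] := ltgtP c.1 x.
- by have := amax _ sc cx; rewrite leNgt ac.
- by have := bmin _ sc xc; rewrite lerN2 leNgt cb.
- by move/negP: xs; apply; rewrite -cx; apply: map_f.
Qed.

(** The derivative of [p] has no root in the gap around [x], so by the mean value theorem [p] has
    opposite nonzero signs at the endpoints. These signs are the same over [R], where the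
    intermediate value theorem then gives the partner [xi]. The last clause records that only common
    roots of [p] are added, which keeps the list supported. *)
Lemma add_root s x : matching phi psi H s ->
    (forall a, a \in s -> match_at phi psi a p) -> root (map_poly phi p) x ->
  exists s', [/\ matching phi psi H s', forall a, a \in s' -> match_at phi psi a p,
    {subset s <= s'}, x \in unzip1 s'
    & forall a, a \in s' -> a \in s \/
        (root (map_poly phi p) a.1 /\ root (map_poly psi p) a.2)].
Proof.
move=> ms sp px; have [xs|xs] := boolP (x \in unzip1 s).
  by exists s; split=> // a sa; left.
have [a [b [sa sb /andP [ax xb] gap]]] := matching_gap ms xs px.
have ab := lt_trans ax xb.
have [iso [rL rR] mt [m [M [sm sM bnd mM]]]] := ms.
have [c cxb pcb] := poly_mvt (map_poly phi p) xb.
have [d dax pda] := poly_mvt (map_poly phi p) ax.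
move: cxb dax; rewrite !in_itv /= => /andP [xc cb] /andP [ad dx].
rewrite (rootP px) subr0 in pcb; rewrite (rootP px) sub0r in pda.
have d0 : map_poly phi p^`() != 0.
  apply: contra_eqN (rootP px) => /eqP d0.
  have E : map_poly phi p = ((map_poly phi p)`_0)%:P.
    by apply: deriv_eq0; [move=> n; rewrite pnatr_eq0|rewrite deriv_map d0].
  by rewrite E hornerC -polyC_eq0 -E.
have nr z : a.1 < z < b.1 -> ~~ root (map_poly phi p)^`() z.
  by move=> zab; rewrite deriv_map; apply: (gap_norootL ms gap).
have cd : sgz (map_poly phi p)^`().[c] = sgz (map_poly phi p)^`().[d].
  apply: (@sgz_noroot _ _ `]a.1, b.1[).
  - by move=> z; rewrite in_itv /=; apply: nr.
  - by rewrite in_itv /= cb (lt_trans ax xc).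
  - by rewrite in_itv /= ad (lt_trans dx xb).
have sgN : sgz (map_poly phi p).[a.1] = - sgz (map_poly phi p).[b.1].
  have sga : - sgz (map_poly phi p).[a.1] = sgz (map_poly phi p)^`().[d].
    by rewrite -sgzN pda sgzM [sgz (x - _)]gtr0_sgz ?mulr1 // subr_gt0.
  have sgb : sgz (map_poly phi p).[b.1] = sgz (map_poly phi p)^`().[c].
    by rewrite pcb sgzM [sgz (b.1 - _)]gtr0_sgz ?mulr1 // subr_gt0.
  by rewrite sgb cd -sga opprK.
have sgb0 : sgz (map_poly phi p).[b.1] != 0.
  rewrite sgz_eq0 pcb mulf_neq0 //; last by rewrite subr_eq0 gt_eqF.
  by have := nr c; rewrite /root (lt_trans ax xc) cb => /(_ isT).
have ab2 : a.2 < b.2 by rewrite -iso.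
have [|xi xiab pxi] := @poly_ivtoo _ (map_poly psi p) a.2 b.2 (ltW ab2).
  rewrite -sgz_lt0 sgzM -(sp _ sa) -(sp _ sb) sgN mulNr oppr_lt0 -expr2.
  by rewrite exprn_even_gt0.
move: xiab; rewrite in_itv /= => /andP [axi xib].
exists ((x, xi) :: s); split.
- split.
  + have isox e : e \in s -> (x < e.1) = (xi < e.2) /\ (e.1 < x) = (e.2 < xi).
      move=> se; have [ea|ae] := leP e.1 a.1.
        have ea2 : e.2 <= a.2 by rewrite leNgt -iso // -leNgt.
        rewrite (le_lt_trans ea ax) (le_lt_trans ea2 axi).
        by rewrite !ltNge (ltW (le_lt_trans ea ax)) (ltW (le_lt_trans ea2 axi)).
      have := gap _ se; rewrite ae /= -leNgt => be.
      have be2 : b.2 <= e.2 by rewrite leNgt -iso // -leNgt.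
      rewrite (lt_le_trans xb be) (lt_le_trans xib be2).
      by rewrite !ltNge (ltW (lt_le_trans xb be)) (ltW (lt_le_trans xib be2)).
    move=> e f; rewrite !inE => /orP [/eqP ->|se] /orP [/eqP ->|sf] /=.
    * by rewrite !ltxx.
    * by have [] := isox _ sf.
    * by have [] := isox _ se.
    * exact: iso.
  + split=> q y Hq q0 qy; rewrite /= inE.
      by rewrite (rL _ _ Hq q0 qy) orbT.
    by rewrite (rR _ _ Hq q0 qy) orbT.
  + move=> e q; rewrite inE => /orP [/eqP ->|se] Hq; last exact: mt.
    apply: (gap_sgz lm ms HG sa sb ab gap Hq); rewrite ?ax ?xb ?axi ?xib //.
    exact: Hderiv.
  + by exists m, M; split=> //; rewrite inE ?sm ?sM orbT.
- move=> e; rewrite inE => /orP [/eqP ->|se]; last exact: sp.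
  by rewrite /match_at /= (rootP px) (rootP pxi) !sgz0.
- by move=> e se; rewrite inE se orbT.
- by rewrite /= mem_head.
- by move=> e; rewrite inE => /orP [/eqP ->|se]; [right|left].
Qed.

Lemma add_roots s (xs : seq L) : matching phi psi H s ->
    (forall a, a \in s -> match_at phi psi a p) -> all (root (map_poly phi p)) xs ->
  exists s', [/\ matching phi psi H s', forall a, a \in s' -> match_at phi psi a p,
    {subset s <= s'}, {subset xs <= unzip1 s'}
    & forall a, a \in s' -> a \in s \/
        (root (map_poly phi p) a.1 /\ root (map_poly psi p) a.2)].
Proof.
elim: xs s => [|x xs IH] s ms sp /=; first by exists s; split=> // a; left.
move=> /andP [px pxs].
have [s1 [ms1 sp1 ss1 xs1 old1]] := add_root ms sp px.
have [s2 [ms2 sp2 ss2 xs2 old2]] := IH _ ms1 sp1 pxs.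
exists s2; split=> //.
- by move=> a /ss1 /ss2.
- move=> y; rewrite inE => /orP [/eqP ->|/xs2 //].
  by have /mapP [c cs ->] := xs1; apply/map_f/ss2.
- by move=> a /old2 [/old1|]; [|right].
Qed.

End AddPoly.

Lemma poly_root_list (F : rcfType) (q : {poly F}) : q != 0 ->
  exists xs, all (root q) xs /\ forall x, root q x -> x \in xs.
Proof.
move=> q0; pose c := cauchy_bound q; exists (roots q (- c) c); split.
  by apply/allP => x /root_roots.
by move=> x qx; apply: root_in_roots => //; apply: root_in_cauchy_bound.
Qed.

(* At a common root of some [q] in [H], the sign of a further [p] in [G] is that
   of its remainder by [q], up to a power of the leading coefficient of [q]. *)
Definition supported (L R : rcfType) (phi : A -> L) (psi : A -> R) H (s : seq (L * R)) :=
  forall a, a \in s -> (forall p, p \in G -> match_at phi psi a p) \/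
    exists q, [/\ q \in H, map_poly phi q != 0, root (map_poly phi q) a.1
      & root (map_poly psi q) a.2].

Section AddPolynomial.
Variables (L R : rcfType) (phi : {rmorphism A -> L}) (psi : {rmorphism A -> R}).
Hypothesis lm : lead_match phi psi.
Variables (H : seq {poly A}) (p : {poly A}).
Hypothesis HG : {subset H <= G}.
Hypothesis Gp : p \in G.
Hypothesis Hsmall : forall q, q \in G -> (size q < size p)%N -> q \in H.
Hypothesis Hbig : forall q, q \in H -> (size q <= size p)%N.

Lemma match_at_root s (a : L * R) q : matching phi psi H s -> a \in s ->
    q \in G -> (size q <= size p)%N -> map_poly phi q != 0 ->
    root (map_poly phi q) a.1 -> root (map_poly psi q) a.2 -> match_at phi psi a p.
Proof.
move=> [_ _ mt _] sa; have [n] := ubnP (size q).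
elim: n q => // n IH q /ltnSE szn Gq qp q0 qL qR.
have qN0 : q != 0 by apply: contraNneq q0 => ->; rewrite rmorph0.
have szt := size_trunc_lead qN0.
(* Pseudo-division multiplies by a power of the leading coefficient, which must not vanish; when it
   does, the truncation has the same specialization. *)
have [l0|l0] := eqVneq (phi (lead_coef q)) 0.
  have r0 : psi (lead_coef q) = 0 by apply/eqP; rewrite -sgz_eq0 -lm // l0 sgz0.
  apply: (IH (trunc_lead q)); rewrite -?(map_trunc_lead l0) -?(map_trunc_lead r0) //.
  - exact: leq_trans szt szn.
  - exact: Gtrunc.
  - exact: leq_trans (ltnW szt) qp.
pose r := Pdiv.Ring.rmodp p q; pose k := Pdiv.Ring.rscalp p q.
have Hr : r \in H.
  apply: Hsmall; first exact: Gmod.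
  by apply: leq_trans qp; rewrite Pdiv.Ring.ltn_rmodp.
have E (F : rcfType) (chi : {rmorphism A -> F}) x : root (map_poly chi q) x ->
    sgz (chi (lead_coef q)) ^+ k * sgz (map_poly chi p).[x] = sgz (map_poly chi r).[x].
  move=> qx; have /(congr1 (fun t => (map_poly chi t).[x])) := Pdiv.ComRing.rdivp_eq q p.
  rewrite linearZ hornerZ rmorphD rmorphM hornerD hornerM (rootP qx) mulr0 add0r => <-.
  by rewrite rmorphXn /= sgzM sgzX.
have l0' : sgz (phi (lead_coef q)) ^+ k != 0 by rewrite expf_neq0 // sgz_eq0.
by apply: (mulfI l0'); rewrite E // {1}(lm Gq) E //; apply: mt.
Qed.

(** Support gives the sign of [p] at the points already matched. Then the roots of [p] are inserted,
    those in [L] first and those in [R] by exchanging the two fields. *)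
Lemma add_polynomial s : matching phi psi H s -> supported phi psi H s ->
  exists s', matching phi psi (rcons H p) s' /\ supported phi psi (rcons H p) s'.
Proof.
move=> ms ss.
have suppR s' : supported phi psi H s' -> supported phi psi (rcons H p) s'.
  move=> ss' a /ss' [|[q [Hq q0 qL qR]]]; [by left|right; exists q].
  by rewrite mem_rcons inE Hq orbT.
have [p0|p0] := eqVneq (map_poly phi p) 0.
  have q0 : map_poly psi p = 0 by apply/eqP; rewrite -(map_eq0 lm) // p0.
  have [iso [rL rR] mt ex] := ms; exists s; split; last exact: suppR.
  split=> //; first split=> q x; rewrite ?mem_rcons ?inE.
  - by move=> /orP [/eqP ->|Hq]; [rewrite p0 eqxx|apply: rL].
  - by move=> /orP [/eqP ->|Hq]; [rewrite q0 eqxx|apply: rR].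
  - move=> a q sa; rewrite mem_rcons inE => /orP [/eqP ->|Hq]; last exact: mt.
    by rewrite /match_at p0 q0 !horner0 !sgz0.
have pN0 : p != 0 by apply: contraNneq p0 => ->; rewrite rmorph0.
have q0 : map_poly psi p != 0 by rewrite -(map_eq0 lm).
have Hp' : p^`() \in H by apply: Hsmall; [exact: Gderiv|exact: lt_size_deriv].
have Hderiv q : q \in H -> q != 0 -> q^`() \in H.
  move=> Hq q0'; apply: Hsmall; first by apply: Gderiv => //; apply: HG.
  exact: leq_trans (lt_size_deriv q0') (Hbig Hq).
have sp a : a \in s -> match_at phi psi a p.
  move=> sa; have [mG|[q [Hq qN0 qL qR]]] := ss _ sa; first exact: mG.
  by apply: (match_at_root ms sa _ _ qN0 qL qR); [exact: HG|exact: Hbig].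
have [xs [pxs xsP]] := poly_root_list p0.
have [ys [pys ysP]] := poly_root_list q0.
have [s1 [ms1 sp1 ss1 xs1 old1]] := add_roots lm HG Hderiv Gp Hp' p0 ms sp pxs.
have sp1' a : a \in [seq swap c | c <- s1] -> match_at psi phi a p.
  by move=> /mapP [c cs ->]; rewrite /match_at sp1.
have [s2 [ms2 sp2 ss2 xs2 old2]] := add_roots (lead_match_sym lm) HG Hderiv Gp Hp' q0
  (matching_sym ms1) sp1' pys.
have [iso [rL rR] mt ex] := matching_sym ms2.
exists [seq swap c | c <- s2]; split; first split=> //.
- split=> q x; rewrite mem_rcons inE => /orP [/eqP -> _ px|]; try by [apply: rL|apply: rR].
  + have /mapP [c cs ->] := xs1 _ (xsP _ px).
    by rewrite /unzip1 -map_comp; apply/mapP; exists (swap c) => //; apply/ss2/map_f.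
  + by rewrite /unzip2 -map_comp; apply: xs2; apply: ysP.
- move=> a q sa; rewrite mem_rcons inE => /orP [/eqP ->|Hq]; last exact: mt.
  by move: sa => /mapP [c cs ->]; rewrite /match_at sp2.
move=> _ /mapP [c cs ->].
have new a : root (map_poly phi p) a.1 -> root (map_poly psi p) a.2 ->
    (forall q, q \in G -> match_at phi psi a q) \/
    exists q, [/\ q \in rcons H p, map_poly phi q != 0, root (map_poly phi q) a.1
      & root (map_poly psi q) a.2].
  by move=> aL aR; right; exists p; rewrite mem_rcons mem_head.
have [/mapP [d ds ->]|[cR cL]] := old2 _ cs; last exact: new.
have [/suppR|[dL dR]] := old1 _ ds; last by apply: new.
by move=> /(_ ss); case: d ds.
Qed.

End AddPolynomial.

Lemma exists_roots_between (F : rcfType) (chi : A -> F) :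
  exists2 B, 0 < B & roots_between chi (- B) B.
Proof.
suff [B B0 HB] : exists2 B, 0 < B & forall p x, p \in G -> map_poly chi p != 0 ->
    root (map_poly chi p) x -> - B < x < B by exists B.
elim: (G) => [|p ps [B B0 IH]]; first by exists 1.
exists (Num.max B (cauchy_bound (map_poly chi p))); first by rewrite lt_max B0.
move=> q x; rewrite -ltr_norml lt_max inE => /orP [/eqP ->|qps] q0 qx.
  by rewrite (cauchy_boundP q0 (rootP qx)) orbT.
by rewrite [in X in X || _]ltr_norml (IH q).
Qed.

(** Beyond all roots, the sign of a polynomial can be read off its leading sign and the parity of
    its degree, and both agree on the two sides. *)
Lemma exists_initial_matching (L R : rcfType) (phi : {rmorphism A -> L})
    (psi : {rmorphism A -> R}) : lead_match phi psi ->
  exists s, matching phi psi [::] s /\ supported phi psi [::] s.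
Proof.
move=> lm.
have [B B0 bL] := exists_roots_between phi.
have [C C0 bR] := exists_roots_between psi.
have sgz_inf (F : rcfType) (chi : {rmorphism A -> F}) D p : 0 < D ->
    roots_between chi (- D) D -> p \in G -> map_poly chi p != 0 ->
    sgz (map_poly chi p).[D] = sgz (lead_coef (map_poly chi p)) /\
    sgz (map_poly chi p).[- D] =
      sgz ((- 1) ^+ (size (map_poly chi p)).-1 : int) * sgz (lead_coef (map_poly chi p)).
  move=> D0 bD Gp p0; split.
    rewrite -[LHS]sgz_sgr (@sgp_pinftyP _ D) ?sgz_sgr ?in_itv /= ?lexx //.
    move=> x; rewrite in_itv /= andbT => Dx; apply/negP => /(bD _ _ Gp p0).
    by rewrite [x < D]ltNge Dx andbF.
  rewrite -[LHS]sgz_sgr (@sgp_minftyP _ (- D)) ?in_itv /= ?lexx //; last first.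
    move=> x; rewrite in_itv /= => Dx; apply/negP => /(bD _ _ Gp p0).
    by rewrite ltNge Dx.
  by rewrite /sgp_minfty sgz_sgr sgzM !sgzX !sgzN1.
have mm p : p \in G -> match_at phi psi (- B, - C) p /\ match_at phi psi (B, C) p.
  move=> Gp; rewrite /match_at /=; have [p0|p0] := eqVneq (map_poly phi p) 0.
    move/eqP: (p0); rewrite (map_eq0 lm Gp) => /eqP ->.
    by rewrite p0 !horner0 !sgz0.
  have q0 : map_poly psi p != 0 by rewrite -(map_eq0 lm Gp).
  have [sz lc] := lead_match_map lm Gp.
  have [-> ->] := sgz_inf _ _ _ _ B0 bL Gp p0.
  by have [-> ->] := sgz_inf _ _ _ _ C0 bR Gp q0; rewrite sz lc.
exists [:: (- B, - C); (B, C)]; split; last first.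
  by move=> a; rewrite !inE => /orP [] /eqP ->; left=> p /mm [].
split=> //.
- move=> a b; rewrite !inE => /orP [] /eqP -> /orP [] /eqP -> //=; rewrite ?ltxx //.
    by rewrite !gtrN.
  by rewrite ![_ < - _]ltNge !(ltW (gtrN _)).
- exists (- B, - C), (B, C); split=> //; by rewrite !inE eqxx ?orbT.
Qed.

(** Polynomials enter by increasing size, so the derivative of each one and the remainders that
    decide its signs are already present. *)
Lemma exists_matching (L R : rcfType) (phi : {rmorphism A -> L})
    (psi : {rmorphism A -> R}) : lead_match phi psi -> exists s, matching phi psi G s.
Proof.
move=> lm; pose r := relpre (fun p : {poly A} => size p) leq.
pose Gs := sort r G.
have GsG : Gs =i G by move=> p; rewrite mem_sort.
have rtr : transitive r by move=> p q t; apply: leq_trans.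
have pw : pairwise r Gs.
  by rewrite -sorted_pairwise //; apply: sort_sorted => p q; apply: leq_total.
suff H l H : Gs = H ++ l -> (exists s, matching phi psi H s /\ supported phi psi H s) ->
    exists s, matching phi psi Gs s.
  have [s [iso [rL rR] mt ex]] := H Gs [::] erefl (exists_initial_matching lm).
  exists s; split=> //; first by split=> p x; rewrite -GsG; [apply: rL|apply: rR].
  by move=> a p sa; rewrite -GsG; apply: mt.
elim: l H => [|p l IH] H; first by rewrite cats0 => -> [s [ms _]]; exists s.
move=> E [s [ms ss]]; apply: (IH (rcons H p)); first by rewrite cat_rcons.
move: pw; rewrite E pairwise_cat allrel_consr /= => /and3P [/andP [Hp _] _ /andP [pl _]].
have HG : {subset H <= G} by move=> q Hq; rewrite -GsG E mem_cat Hq.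
apply: (add_polynomial lm HG _ _ _ ms ss).
- by rewrite -GsG E mem_cat mem_head orbT.
- move=> q; rewrite -GsG E mem_cat inE => /orP [//|/orP [/eqP ->|lq]].
    by rewrite ltnn.
  by rewrite ltnNge; have := allP pl _ lq; rewrite /r /= => ->.
- by move=> q Hq; have := allP Hp _ Hq.
Qed.

(** Either [x] is a matched point, or it lies beyond the extreme ones, where signs are those at [m]
    or [M], or it lies in a gap, where any point of the corresponding gap of [R] has the same
    signs. *)
Lemma sgz_transfer_point (L R : rcfType) (phi : {rmorphism A -> L})
    (psi : {rmorphism A -> R}) (x : L) : lead_match phi psi ->
  exists xi, forall p, p \in G -> match_at phi psi (x, xi) p.
Proof.
move=> lm; have [s ms] := exists_matching lm.
have [iso [rL rR] mt [m [M [sm sM [bL bR] mM]]]] := ms.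
have [/mapP [a sa ->]|xs] := boolP (x \in unzip1 s).
  by exists a.2 => p Gp; exact: (mt a p sa Gp).
have out (i : interval L) (a : L * R) p : p \in G -> match_at phi psi a p -> x \in i ->
    a.1 \in i -> (map_poly phi p != 0 -> {in i, forall z, ~~ root (map_poly phi p) z}) ->
    match_at phi psi (x, a.2) p.
  move=> Gp ma xi ai nr; rewrite /match_at /= -ma.
  have [->|p0] := eqVneq (map_poly phi p) 0; first by rewrite !horner0.
  exact: sgz_noroot (nr p0) xi ai.
have mM1 : m.1 \in unzip1 s /\ M.1 \in unzip1 s by split; apply: map_f.
have [xm|mx] := ltP x m.1.
  exists m.2 => p Gp; apply: (out `]-oo, m.1]) => //; rewrite ?in_itv /= ?lexx ?(ltW xm) //.
    by have [] := mM _ Gp.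
  move=> p0 z; rewrite in_itv /= => zm; apply/negP => /(bL _ _ Gp p0).
  by rewrite ltNge zm.
have [Mx|xM] := ltP M.1 x.
  exists M.2 => p Gp; apply: (out `[M.1, +oo[) => //; rewrite ?in_itv /= ?lexx ?(ltW Mx) //.
    by have [] := mM _ Gp.
  move=> p0 z; rewrite in_itv /= andbT => zM; apply/negP => /(bL _ _ Gp p0).
  by rewrite [z < _]ltNge zM andbF.
have {}mx : m.1 < x.
  by rewrite lt_neqAle mx andbT; apply: contraNneq xs => <-; case: mM1.
have {}xM : x < M.1.
  by rewrite lt_neqAle xM andbT; apply: contraNneq xs => ->; case: mM1.
have [a [sa ax amax]] := @seq_max L _ fst (fun c => c.1 < x) s m sm mx.
have [b [sb xb bmin]] := @seq_max L _ (fun c => - c.1) (fun c => x < c.1) s M sM xM.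
have ab := lt_trans ax xb; have ab2 : a.2 < b.2 by rewrite -iso.
have gap c : c \in s -> ~~ (a.1 < c.1 < b.1).
  move=> sc; apply/negP => /andP [ac cb]; have [cx|xc|cx] := ltgtP c.1 x.
  - by have := amax _ sc cx; rewrite leNgt ac.
  - by have := bmin _ sc xc; rewrite lerN2 leNgt cb.
  - by move/negP: xs; apply; rewrite -cx; apply: map_f.
have [y ay yb] : exists2 y, a.2 < y & y < b.2.
  by exists ((a.2 + b.2) / 2); rewrite ?midf_lt.
exists y => p Gp; apply: (gap_sgz lm ms _ sa sb ab gap Gp) => //; rewrite ?ax ?ay //.
exact: Gderiv.
Qed.

End RootMatching.

(* The coefficients of a real system become variables over [int], so that all the
   rings to which [prime_cone_rcf] is applied are countable: algebraic closures
   are available for countable fields only. *)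
Fixpoint itpoly (n : nat) : countComNzRingType :=
  if n is n'.+1 then {poly itpoly n'} : countComNzRingType else int.

Fixpoint itpolyC (n s : nat) : {rmorphism itpoly s -> itpoly (n + s)} :=
  if n is n'.+1 return {rmorphism itpoly s -> itpoly (n + s)}
  then polyC \o itpolyC n' s else idfun.

(** Elimination of [n] variables over [s] parameters; the tests are fixed before the fields. The
    leading coefficients of a closed family go to the induction hypothesis, and [xi] then serves as
    the value of the outermost variable. *)
Lemma sgz_transfer (n s : nat) (ps : seq (itpoly (n + s))) :
  exists as_ : seq (itpoly s),
    forall (L R : rcfType) (phi : {rmorphism itpoly (n + s) -> L})
      (psi : {rmorphism itpoly s -> R}),
    (forall a, a \in as_ -> sgz (phi (itpolyC n s a)) = sgz (psi a)) ->
  exists psi' : {rmorphism itpoly (n + s) -> R},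
    (forall a, psi' (itpolyC n s a) = psi a) /\
    forall p, p \in ps -> sgz (phi p) = sgz (psi' p).
Proof.
elim: n ps => [|n IH] ps; first by exists ps => L R phi psi E; exists psi.
have [G [psG cG]] := exists_closed_family ps.
have [as_ Has] := IH [seq lead_coef p | p <- G]; exists as_ => L R phi psi E.
pose phi0 : {rmorphism itpoly (n + s) -> L} := phi \o polyC.
have [psi0 [psi0C psi0E]] := Has L R phi0 psi E.
have lm : lead_match G phi0 psi0 by move=> p Gp; apply: psi0E; apply: map_f.
have [xi xiP] := sgz_transfer_point cG (phi 'X) lm.
have cxi : commr_rmorph psi0 xi by move=> a; apply: mulrC.
pose psi' : {rmorphism itpoly (n.+1 + s) -> R} := horner_morph cxi.
exists psi'; split=> [a|p psp]; first by rewrite /= horner_morphC psi0C.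
have := xiP p (psG p psp); rewrite /match_at /= => <-; congr sgz.
by rewrite [LHS]poly_initial.
Qed.

(** * The real Nullstellensatz *)

Lemma mderivXU (R : comNzRingType) (k : nat) (i j : 'I_k) :
  ('X_j : {mpoly R[k]})^`M(i) = (i == j)%:R%:MP.
Proof.
rewrite mderivX mnm1E eq_sym; case: eqP => [->|_]; last by rewrite scale0r mpolyC0.
have U0 : (U_(j) - U_(j))%MM = 0%MM :> 'X_{1..k}.
  by apply/mnmP => l; rewrite mnmBE subnn mnm0E.
by rewrite U0 scale1r mpolyX0.
Qed.

Lemma mpoly_ring_ind (R : comNzRingType) (k : nat) (P : {mpoly R[k]} -> Prop) :
    (forall c, P c%:MP) -> (forall i, P 'X_i) ->
    (forall p q, P p -> P q -> P (p + q)) -> (forall p q, P p -> P q -> P (p * q)) ->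
  forall p, P p.
Proof.
move=> PC PX PD PM p; rewrite (mpolyE p).
apply: (big_ind P) => [||m _]; [by rewrite -mpolyC0|exact: PD|].
rewrite -mul_mpolyC; apply: (PM) => //; rewrite mpolyXE_id.
apply: (big_ind P) => [||i _]; [by rewrite -mpolyC1|exact: (PM)|].
elim: (m i) => [|e IH]; first by rewrite expr0 -mpolyC1.
by rewrite exprS; apply: PM.
Qed.

Section IdealGen.
Variables (R : realType) (k : nat).
Local Notation P := {mpoly R[k]}.
Implicit Types (A : set P) (p q : P).

Lemma ideal_gen0 A : ideal_gen A 0.
Proof. by exists [::]; rewrite big_nil. Qed.

Lemma ideal_genD A p q : ideal_gen A p -> ideal_gen A q -> ideal_gen A (p + q).
Proof.
move=> [s [As ->]] [t [At ->]]; exists (s ++ t); rewrite big_cat; split=> // ca.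
by rewrite mem_cat => /orP [/As|/At].
Qed.

Lemma ideal_genM A p q : ideal_gen A q -> ideal_gen A (p * q).
Proof.
move=> [s [As ->]]; exists [seq (p * ca.1, ca.2) | ca <- s]; split.
  by move=> _ /mapP [ca /As ? ->].
by rewrite big_map mulr_sumr; apply: eq_bigr => ca _; rewrite mulrA.
Qed.

Lemma mem_ideal_gen A p : A p -> ideal_gen A p.
Proof.
move=> Ap; exists [:: (1, p)]; split; last by rewrite big_seq1 mul1r.
by move=> ca; rewrite inE => /eqP ->.
Qed.

Lemma ideal_genN A p : ideal_gen A p -> ideal_gen A (- p).
Proof. by rewrite -mulN1r; apply: ideal_genM. Qed.

Lemma ideal_genB A p q : ideal_gen A p -> ideal_gen A q -> ideal_gen A (p - q).
Proof. by move=> Ap Aq; apply/ideal_genD/ideal_genN. Qed.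

Lemma ideal_gen_sub A B : A `<=` ideal_gen B -> ideal_gen A `<=` ideal_gen B.
Proof.
move=> AB _ [s [As ->]]; rewrite big_seq.
apply: (big_ind (ideal_gen B)); [exact: ideal_gen0|exact: ideal_genD|].
by move=> ca /As /AB; apply: ideal_genM.
Qed.

Lemma ideal_vanish (h : seq P) (v : 'I_k -> R) p :
  (forall q, q \in h -> q.@[v] = 0) -> ideal h p -> p.@[v] = 0.
Proof.
move=> hv [s [hs ->]]; rewrite rmorph_sum big_seq big1 // => ca /hs hca.
by rewrite [LHS]mevalM (hv _ hca) mulr0.
Qed.

Lemma sosD p q : sum_of_squares p -> sum_of_squares q -> sum_of_squares (p + q).
Proof. by move=> [s ->] [t ->]; exists (s ++ t); rewrite big_cat. Qed.

Lemma sos_sqr p : sum_of_squares (p ^+ 2).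
Proof. by exists [:: p]; rewrite big_seq1. Qed.

Lemma sosM p q : sum_of_squares p -> sum_of_squares q -> sum_of_squares (p * q).
Proof.
move=> [s ->] [t ->]; rewrite big_distrl /=.
apply: (big_ind (fun r : P => sum_of_squares r)); [by exists [::]; rewrite big_nil|exact: sosD|].
move=> a _; rewrite big_distrr /=.
apply: (big_ind (fun r : P => sum_of_squares r)); [by exists [::]; rewrite big_nil|exact: sosD|].
by move=> b _; rewrite -exprMn; apply: sos_sqr.
Qed.

Lemma sos_ge0 (v : 'I_k -> R) p : sum_of_squares p -> 0 <= p.@[v].
Proof.
by move=> [s ->]; rewrite rmorph_sum; apply: sumr_ge0 => q _; rewrite rmorphXn sqr_ge0.
Qed.

Lemma real_radical_vanish (h : seq P) (v : 'I_k -> R) p :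
  (forall q, q \in h -> q.@[v] = 0) -> real_radical (ideal h) p -> p.@[v] = 0.
Proof.
move=> hv [e [s [q [ss /(ideal_vanish hv) q0 E]]]].
have := congr1 (meval v) E; rewrite rmorphN rmorphXn rmorphD /= q0 addr0 => E'.
have := sos_ge0 v ss; rewrite -E' oppr_ge0 => pe.
apply/eqP; have [//|pv] := eqVneq p.@[v] 0.
by move: pe; rewrite leNgt exprM exprn_gt0 // exprn_even_gt0.
Qed.

End IdealGen.

(** Variables are numbered from the inside, so that adding outer ones does not renumber the others;
    the value [0] out of range is a mere default. *)
Fixpoint itpolyX (n i : nat) : itpoly n :=
  if n is n'.+1 return itpoly n
  then if i == n' then 'X else (itpolyX n' i)%:P else 0.

Lemma itpolyC_X (n s i : nat) : (i < s)%N ->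
  itpolyC n s (itpolyX s i) = itpolyX (n + s) i.
Proof.
move=> lti; elim: n => [//|n IH] /=; rewrite IH ifF //.
by apply: ltn_eqF; apply: leq_trans lti (leq_addl _ _).
Qed.

Lemma exists_itpoly_eval (C : comNzRingType) (n : nat) (z : nat -> C) :
  exists e : {rmorphism itpoly n -> C}, forall i, (i < n)%N -> e (itpolyX n i) = z i.
Proof.
elim: n => [|n [e He]]; first by exists (intmul 1 : {rmorphism int -> C}).
have cz : commr_rmorph e (z n) by move=> a; apply: mulrC.
exists (horner_morph cz : {rmorphism itpoly n.+1 -> C}) => i; rewrite ltnS /=.
case: eqVneq => [-> _|ni lei]; first exact: horner_morphX.
by rewrite horner_morphC He // ltn_neqAle ni.
Qed.

Lemma itpoly_morph_ext (C : comNzRingType) (n : nat) (e e' : {rmorphism itpoly n -> C}) :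
  (forall i, (i < n)%N -> e (itpolyX n i) = e' (itpolyX n i)) -> e =1 e'.
Proof.
elim: n e e' => [|n IH] e e' E a.
  by rewrite -[a]intz !rmorph_int.
have E0 : (e \o polyC : {rmorphism itpoly n -> C}) =1 (e' \o polyC).
  apply: IH => i lti; have := E i (leq_trans lti (leqnSn _)).
  by rewrite /= ltn_eqF.
elim/poly_ind: a => [|p c IHp]; first by rewrite !rmorph0.
rewrite !rmorphD !rmorphM IHp; congr (_ * _ + _); last exact: E0.
by have := E n (ltnSn n); rewrite /= eqxx.
Qed.

Lemma sgz_of_ge0 (F F' : realDomainType) (x : F) (y : F') :
  (0 <= x <-> 0 <= y) -> (0 <= - x <-> 0 <= - y) -> sgz x = sgz y.
Proof.
rewrite !oppr_ge0 => xy yx; case: (sgzP x) => x0; case: (sgzP y) => y0 //.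
- have : y <= 0 by apply/yx; rewrite x0.
  by rewrite leNgt y0.
- have : 0 <= y by apply/xy; rewrite x0.
  by rewrite leNgt y0.
- have : x <= 0 by apply/yx; rewrite y0.
  by rewrite leNgt x0.
- have : 0 <= y by apply/xy; rewrite ltW.
  by rewrite leNgt y0.
- have : 0 <= x by apply/xy; rewrite y0.
  by rewrite leNgt x0.
- have : 0 <= x by apply/xy; rewrite ltW.
  by rewrite leNgt x0.
Qed.

Section RealNullstellensatz.
Variables (R : realType) (k : nat).
Local Notation P := {mpoly R[k]}.
Implicit Types (p q : P) (h : seq P).

(** Nonnegative reals are squares, and a negative constant in [Q] could be scaled to [- 1]. *)
Lemma prime_cone_const (Q : set P) (u : R) : prime_cone Q -> Q u%:MP <-> 0 <= u.
Proof.
move=> [[QD QM Q2] _ QN1 _].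
have Qc (c : R) : 0 <= c -> Q c%:MP.
  by move=> c0; rewrite -(sqr_sqrtr c0) rmorphXn; apply: Q2.
split=> [Qu|/Qc //]; rewrite leNgt; apply/negP => u0; apply: QN1.
have := QM _ _ Qu (Qc (- u^-1) _); rewrite -rmorphM mulrN divff ?lt_eqF //.
by rewrite rmorphN rmorph1; apply; rewrite oppr_ge0 invr_le0 ltW.
Qed.

(** The inner [s] variables stand for the coefficients that occur in [ps], the outer [k] ones for
    the variables of [P]. *)
Lemma exists_itpoly_lift (ps : seq P) :
  exists (s : nat) (c : nat -> R) (sig : {rmorphism itpoly (k + s) -> P}),
    [/\ forall i, (i < s)%N -> sig (itpolyX (k + s) i) = (c i)%:MP,
        forall j : 'I_k, sig (itpolyX (k + s) (s + j)) = 'X_j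
      & forall p, p \in ps -> exists a, sig a = p].
Proof.
pose cs : seq R := flatten [seq [seq p@_m | m <- msupp p] | p : P <- ps].
pose s := size cs; pose c i := nth 0 cs i.
pose z i : P := if (i < s)%N then (c i)%:MP
  else if insub (i - s)%N is Some j then 'X_j else 0.
have [sig sigE] := exists_itpoly_eval (k + s) z; exists s, c, sig.
have sigc i : (i < s)%N -> sig (itpolyX (k + s) i) = (c i)%:MP.
  by move=> lti; rewrite sigE /z ?lti // (leq_trans lti) // leq_addl.
have sigX (j : 'I_k) : sig (itpolyX (k + s) (s + j)) = 'X_j.
  rewrite sigE /z; last by rewrite addnC ltn_add2r.
  by rewrite ltnNge leq_addr /= addKn insubT //= => ltj; congr mpolyX; congr mnm1; apply: val_inj.
split=> // p psp.
pose Im (q : P) := exists a, sig a = q.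
have ImD q r : Im q -> Im r -> Im (q + r).
  by move=> [a <-] [b <-]; exists (a + b); rewrite rmorphD.
have ImM q r : Im q -> Im r -> Im (q * r).
  by move=> [a <-] [b <-]; exists (a * b); rewrite rmorphM.
have Im0 : Im 0 by exists 0; rewrite rmorph0.
have Im1 : Im 1 by exists 1; rewrite rmorph1.
rewrite -/(Im p) (mpolyE p) big_seq; apply: (big_ind Im) => // m mp.
rewrite -mul_mpolyC; apply: (ImM).
  have cm : p@_m \in cs.
    by apply/flattenP; exists [seq p@_m | m <- msupp p]; apply/mapP; [exists p|exists m].
  exists (itpolyX (k + s) (index p@_m cs)); rewrite sigc ?index_mem //.
  by rewrite /c nth_index.
rewrite mpolyXE_id; apply: (big_ind Im) => // j _.
elim: (m j) => [|e IH]; first by rewrite expr0.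
by rewrite exprS; apply: (ImM) => //; exists (itpolyX (k + s) (s + j)).
Qed.

Theorem real_nullstellensatz h p :
  (forall v : 'I_k -> R, (forall q, q \in h -> q.@[v] = 0) -> p.@[v] = 0) ->
  real_radical (ideal h) p.
Proof.
move=> pvan; apply: contrapT => nrad.
(* Sums of squares modulo the ideal, up to an even power of [p]. The opposite of an element of [S]
   lies in [T0] exactly when [p] is in the real radical. *)
pose T0 : set P := [set a | exists e s q,
  [/\ sum_of_squares s, ideal h q & p ^+ (2 * e) * a = s + q]].
pose S : set P := [set s | exists e, s = p ^+ (2 * e)].
have even e : sum_of_squares (p ^+ (2 * e)) by rewrite mulnC exprM; apply: sos_sqr.
have T0sos s : sum_of_squares s -> T0 s.
  move=> ss; exists 0, s, 0; split=> //; first exact: ideal_gen0.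
  by rewrite expr0 mul1r addr0.
have T0id q : ideal h q -> T0 q.
  move=> hq; exists 0, 0, q; split=> //; first by exists [::]; rewrite big_nil.
  by rewrite expr0 mul1r add0r.
have [|||||Q [Qc T0Q QN]] := @exists_prime_cone P T0 S.
- split.
  + move=> a b [e [s [q [ss hq E]]]] [e' [s' [q' [ss' hq' E']]]].
    exists (e + e')%N, (p ^+ (2 * e') * s + p ^+ (2 * e) * s'),
      (p ^+ (2 * e') * q + p ^+ (2 * e) * q'); split.
    * by apply: sosD; apply: sosM.
    * by apply: ideal_genD; apply: ideal_genM.
    * rewrite mulnDr exprD addrACA -!mulrDr -E -E'; ring.
  + move=> a b [e [s [q [ss hq E]]]] [e' [s' [q' [ss' hq' E']]]].
    exists (e + e')%N, (s * s'), (s * q' + s' * q + q * q'); split.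
    * exact: sosM.
    * by do ![apply: ideal_genD]; apply: ideal_genM.
    * rewrite mulnDr exprD mulrACA E E'; ring.
  + by move=> a; apply/T0sos/sos_sqr.
- by move=> _ [e ->]; apply: T0sos.
- by exists 0; rewrite expr0.
- by move=> _ _ [e ->] [e' ->]; exists (e + e')%N; rewrite mulnDr exprD.
- move=> _ [e ->] [e' [s [q [ss hq E]]]]; apply: nrad.
  by exists (e' + e)%N, s, q; split=> //; rewrite mulnDr exprD -mulrN.
have [s [c [sig [sigc sigX sigI]]]] := exists_itpoly_lift (p :: h).
have Q'c : prime_cone [set a | Q (sig a)].
  have [[QD QM Q2] Qtot QN1 Qpr] := Qc; split; first split.
  - by move=> a b Qa Qb; rewrite /= rmorphD; apply: QD.
  - by move=> a b Qa Qb; rewrite /= rmorphM; apply: QM.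
  - by move=> a; rewrite /= rmorphXn.
  - by move=> a; rewrite /= rmorphN.
  - by rewrite /= rmorphN1.
  - by move=> a b; rewrite /= !rmorphN !rmorphM; apply: Qpr.
have [L [phi phiP]] := prime_cone_rcf Q'c.
have [psi psiE] := exists_itpoly_eval s c.
have [a pa] := sigI p (mem_head _ _).
have lifth q : q \in h -> exists b, sig b = q by move=> hq; apply: sigI; rewrite inE hq orbT.
have [bs bsE] : exists bs, [seq sig b | b <- bs] = h.
  elim: (h) lifth => [|q t IH] lt; first by exists [::].
  have [b bE] := lt q (mem_head _ _).
  have [|bs bsE] := IH; first by move=> r tr; apply: lt; rewrite inE tr orbT.
  by exists (b :: bs); rewrite /= bE bsE.
have [as_ asP] := sgz_transfer (a :: bs).
have constE b : sig (itpolyC k s b) = (psi b)%:MP.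
  pose e1 : {rmorphism itpoly s -> P} := sig \o itpolyC k s.
  pose e2 : {rmorphism itpoly s -> P} := @mpolyC k R \o psi.
  suff : e1 =1 e2 by apply.
  by apply: itpoly_morph_ext => i lti; rewrite /= itpolyC_X // sigc // psiE.
(* The tests bear on real constants only, whose signs in [L] and in [R] agree. The real point [xi]
   then has as coordinates the images of the outer variables under [psi']. *)
have [|psi' [psi'C psi'E]] := asP L R phi psi.
  move=> b _; apply: sgz_of_ge0.
    by rewrite -phiP /= constE prime_cone_const.
  by rewrite -!rmorphN -phiP /= constE prime_cone_const.
pose xi (j : 'I_k) := psi' (itpolyX (k + s) (s + j)).
have evE b : psi' b = (sig b).@[xi].
  pose e1 : {rmorphism itpoly (k + s) -> R} := meval xi \o sig.
  suff : psi' =1 e1 by apply.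
  apply: itpoly_morph_ext => i ltik /=; have [ltis|leis] := ltnP i s.
    by rewrite sigc // mevalC -(itpolyC_X k ltis) psi'C psiE.
  have ltj : (i - s < k)%N by rewrite ltn_subLR // addnC.
  have -> : i = (s + Ordinal ltj)%N by rewrite /= subnKC.
  by rewrite sigX mevalXU.
have hxi q : q \in h -> q.@[xi] = 0.
  move=> hq; move: (hq); rewrite -{1}bsE => /mapP [b bsb qE].
  apply/eqP; rewrite qE -evE -sgz_eq0 -psi'E ?inE ?bsb ?orbT // sgz_eq0.
  have [Qq QqN] : Q q /\ Q (- q).
    split; apply/T0Q/T0id; last apply: ideal_genN; exact: mem_ideal_gen.
  rewrite eq_le -[phi b <= 0]oppr_ge0 -rmorphN; apply/andP.
  by split; apply/phiP; rewrite /= ?rmorphN -qE.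
have /eqP := pvan _ hxi; rewrite -pa -evE -sgz_eq0 -psi'E ?mem_head // sgz_eq0 => /eqP phia.
(* If [p] vanished in [L], then [- p ^+ 2] would be in the cone, which [S] was chosen to exclude. *)
apply: (QN (p ^+ (2 * 1))); first by exists 1%N.
suff : Q (sig (- a ^+ 2)) by rewrite rmorphN rmorphXn pa.
by apply/phiP; rewrite rmorphN rmorphXn phia expr0n oppr0.
Qed.

End RealNullstellensatz.

(** * Derivations and finiteness of critical values *)

Section VanishingDerivations.
Variable K : fieldType.
Hypothesis charK : forall n, n.+1%:R != 0 :> K.

(* [d] is a derivation of [B] along [eps] which factors through the image of
   [eps]. *)
Definition vanishing_derivation (B : comNzRingType) (eps : {rmorphism B -> K})
    (d : {additive B -> K}) : Prop :=
  (forall a b, d (a * b) = eps a * d b + eps b * d a) /\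
  (forall a, eps a = 0 -> d a = 0).

Section Extension.
Variables (B : comNzRingType) (eps : {rmorphism B -> K}) (d : {additive B -> K}).
Hypothesis vd : vanishing_derivation eps d.
Variable a : K.

Let d1 : d 1 = 0.
Proof.
have := proj1 vd 1 1; rewrite !mulr1 rmorph1 mul1r => /eqP.
by rewrite -subr_eq0 opprD addNKr oppr_eq0 => /eqP.
Qed.

Let epsa (p : {poly B}) := (map_poly eps p).[a].
Let da (p : {poly B}) := (map_poly d p).[a].

Let epsaM p q : epsa (p * q) = epsa p * epsa q.
Proof. by rewrite /epsa rmorphM hornerM. Qed.
Let epsaD p q : epsa (p + q) = epsa p + epsa q.
Proof. by rewrite /epsa rmorphD hornerD. Qed.
Let epsaN p : epsa (- p) = - epsa p.
Proof. by rewrite /epsa rmorphN hornerN. Qed.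
Let epsaXC p c : epsa (p * 'X + c%:P) = epsa p * a + eps c.
Proof. by rewrite epsaD epsaM /epsa map_polyX hornerX map_polyC hornerC. Qed.
Let epsaZ c p : epsa (c *: p) = eps c * epsa p.
Proof. by rewrite -mul_polyC epsaM {1}/epsa map_polyC hornerC. Qed.

Let daD p q : da (p + q) = da p + da q.
Proof. by rewrite /da raddfD hornerD. Qed.
Let daMX p : da (p * 'X) = da p * a.
Proof.
rewrite /da; have -> : map_poly d (p * 'X) = map_poly d p * 'X.
  by apply/polyP => -[|i]; rewrite coef_map /= !coefMX ?raddf0 //= coef_map.
by rewrite hornerMX.
Qed.
Let daZ c q : da (c *: q) = eps c * da q + epsa q * d c.
Proof.
rewrite /da /epsa [_ * d c]mulrC.
have -> : map_poly d (c *: q) = eps c *: map_poly d q + d c *: map_poly eps q.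
  apply/polyP => i; rewrite coefD !coefZ !coef_map /= coefZ (proj1 vd).
  by rewrite [eps q`_i * _]mulrC.
by rewrite hornerD !hornerZ.
Qed.
Let daC c : da c%:P = d c.
Proof.
have -> : c%:P = c *: 1 by rewrite -mul_polyC mulr1.
rewrite daZ /epsa /da rmorph1 hornerC mul1r.
suff -> : map_poly d 1 = 0 by rewrite horner0 mulr0 add0r.
by apply/polyP => -[|i]; rewrite coef_map /= coef1 coef0 ?d1 ?raddf0.
Qed.
Let daM p q : da (p * q) = epsa p * da q + epsa q * da p.
Proof.
elim/poly_ind: p => [|p c IH].
  by rewrite mul0r /da /epsa !raddf0 !horner0 mulr0 mul0r addr0.
have -> : (p * 'X + c%:P) * q = (p * q) * 'X + c *: q.
  by rewrite mulrDl mul_polyC mulrAC.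
rewrite daD daMX daZ IH epsaXC daD daMX daC; ring.
Qed.

(* [u] is forced by a polynomial [mu] of least degree vanishing at [a]. *)
Lemma derivation_value : exists u, forall p : {poly B},
  (map_poly eps p).[a] = 0 -> (map_poly d p).[a] + (map_poly eps p^`()).[a] * u = 0.
Proof.
have eps0 p : map_poly eps p = 0 -> map_poly d p = 0.
  move=> p0; apply/polyP => i; rewrite coef_map coef0 /=; apply: (proj2 vd).
  by have := congr1 (fun q : {poly K} => q`_i) p0; rewrite coef_map coef0.
have deriv0 p : map_poly eps p = 0 -> map_poly eps p^`() = 0.
  by move=> p0; rewrite -deriv_map p0 deriv0.
(* In the second case [a] is transcendental over the image of [eps]: only polynomials with zero
   image vanish at [a], and any [u] would do. *)
have [[p pa p0]|nex] := pselect (exists2 p, epsa p = 0 & map_poly eps p != 0); last first.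
  exists 0 => p pa; rewrite mulr0 addr0.
  have p0 : map_poly eps p = 0 by apply: contrapT => /eqP p0; apply: nex; exists p.
  by rewrite eps0 // horner0.
pose Pn n := `[< exists p : {poly B}, [/\ size p = n, epsa p = 0 & map_poly eps p != 0] >].
have exn : exists n, Pn n by exists (size p); apply/asboolP; exists p.
case: (ex_minnP exn) => _ /asboolP [mu [<- mua mu0]] mumin.
have small (q : {poly B}) : (size q < size mu)%N -> epsa q = 0 -> map_poly eps q = 0.
  move=> szq qa; apply: contrapT => /eqP q0; move: szq; rewrite ltnNge mumin //.
  by apply/asboolP; exists q.
have muN0 : mu != 0 by apply: contraNneq mu0 => ->; rewrite rmorph0.
have lmu : eps (lead_coef mu) != 0.
  apply/negP => /eqP l0; move/negP: mu0; apply.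
  have E : map_poly eps mu = map_poly eps (trunc_lead mu).
    by rewrite rmorphB /= linearZ /= l0 scale0r subr0.
  by rewrite E small // ?size_trunc_lead // /epsa -E.
(* By minimality of [mu] its derivative would otherwise have zero image, and in characteristic zero
   [mu] would become a constant vanishing at [a]. *)
have dmu : epsa mu^`() != 0.
  apply/negP => /eqP dmua.
  have E : map_poly eps mu = ((map_poly eps mu)`_0)%:P.
    by apply: deriv_eq0 => //; rewrite deriv_map small // lt_size_deriv.
  by move: mua mu0; rewrite /epsa E hornerC => ->; rewrite eqxx.
pose u := - da mu / epsa mu^`(); exists u => q qa.
pose k := Pdiv.Ring.rscalp q mu; pose r := Pdiv.Ring.rmodp q mu.
have qE := Pdiv.ComRing.rdivp_eq mu q; rewrite -/k -/r in qE.
have ra : epsa r = 0.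
  have := congr1 epsa qE; rewrite epsaZ epsaD epsaM [epsa q]qa mua !mulr0 add0r.
  by move=> <-.
have r0 : map_poly eps r = 0 by apply: small => //; rewrite Pdiv.Ring.ltn_rmodp.
pose D p := da p + epsa p^`() * u.
have DD p1 p2 : D (p1 + p2) = D p1 + D p2.
  by rewrite /D daD derivD epsaD mulrDl addrACA.
have DM p1 p2 : D (p1 * p2) = epsa p1 * D p2 + epsa p2 * D p1.
  rewrite /D daM derivM epsaD !epsaM; ring.
have Dmu : D mu = 0 by rewrite /D /u mulrC divfK // subrr.
have Dr : D r = 0.
  by rewrite /D /da /epsa eps0 // deriv0 // !horner0 mul0r addr0.
have := congr1 D qE; rewrite DD DM Dmu mua Dr -mul_polyC DM [epsa q]qa.
rewrite !(mulr0, mul0r, addr0) => /eqP; rewrite mulf_eq0 => /orP [|/eqP //].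
by rewrite /epsa map_polyC hornerC /= rmorphXn expf_eq0 (negbTE lmu) andbF.
Qed.

(** The extension applies [d] to the coefficients of [p], evaluates at [a], and adds [u] times the
    value of the formal derivative. The hypothesis says precisely that it factors through the image
    of the extended [eps]. *)
Lemma derivation_extension u :
    (forall p : {poly B}, (map_poly eps p).[a] = 0 ->
      (map_poly d p).[a] + (map_poly eps p^`()).[a] * u = 0) ->
  exists (eps' : {rmorphism {poly B} -> K}) (d' : {additive {poly B} -> K}),
    [/\ vanishing_derivation eps' d', forall b, eps' b%:P = eps b,
        forall b, d' b%:P = d b, eps' 'X = a & d' 'X = u].
Proof.
move=> Hu; have ca : commr_rmorph eps a by move=> b; apply: mulrC.
pose eps' : {rmorphism {poly B} -> K} := horner_morph ca.
pose D p := da p + epsa p^`() * u.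
have DB : zmod_morphism D.
  move=> p q; rewrite /D derivB epsaD epsaN daD mulrBl opprD addrACA.
  by congr (_ + _ + _); rewrite /da raddfN hornerN.
pose D' : {additive {poly B} -> K} :=
  HB.pack D (GRing.isZmodMorphism.Build {poly B} K D DB).
exists eps', D'; split.
- split=> [p q|p pa]; last exact: Hu.
  rewrite /= /D daM derivM epsaD !epsaM -/(epsa p) -/(epsa q).
  have eps'E r : horner_morph ca r = epsa r by [].
  rewrite !eps'E; ring.
- by move=> b; rewrite /= horner_morphC.
- by move=> b; rewrite /= /D daC derivC /epsa rmorph0 horner0 mul0r addr0.
- by rewrite /= horner_morphX.
- rewrite /= /D derivX /epsa rmorph1 hornerC mul1r.
  have -> : 'X = 1 * 'X + 0%:P :> {poly B} by rewrite mul1r addr0.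
  by rewrite daD daMX !daC raddf0 addr0 d1 mul0r add0r.
Qed.

End Extension.

Lemma derivation_extension_seq (B : comNzRingType) (eps : {rmorphism B -> K})
    (d : {additive B -> K}) (k : nat) (a : nat -> K) : vanishing_derivation eps d ->
  exists (B' : comNzRingType) (iota : {rmorphism B -> B'}) (eps' : {rmorphism B' -> K})
      (d' : {additive B' -> K}) (y : nat -> B'),
    [/\ vanishing_derivation eps' d', forall b, eps' (iota b) = eps b,
        forall b, d' (iota b) = d b & forall i, (i < k)%N -> eps' (y i) = a i].
Proof.
move=> vd; elim: k => [|k [B' [iota [eps' [d' [y [vd' iE iD yE]]]]]]].
  by exists B, idfun, eps, d, (fun=> 0).
have [u Hu] := derivation_value vd' (a k).
have [eps2 [d2 [vd2 cE cD xE xD]]] := derivation_extension vd' Hu.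
pose iota2 : {rmorphism B -> {poly B'}} := polyC \o iota.
exists {poly B'}, iota2, eps2, d2, (fun i => if i == k then 'X else (y i)%:P).
split=> // [b|b|i]; rewrite /= ?cE ?cD ?iE ?iD // ltnS.
by case: eqVneq => [->|ni] // lei; rewrite cE yE // ltn_neqAle ni.
Qed.

End VanishingDerivations.

(** A tower over [F] with zero derivation: first [ev f] is adjoined with value [1], a free choice by
    transcendence, then the images of the variables one by one. Every stage factors through [K], so
    the chain rule turns the values at the variables into the required [v]. *)
Lemma exists_transcendental_derivation (F : fieldType) (k : nat) (f : {mpoly F[k]})
    (K : fieldType) (ev : {rmorphism {mpoly F[k]} -> K}) :
    (forall n, n.+1%:R != 0 :> F) ->
    (forall q : {poly F}, q != 0 -> ev (map_poly (@mpolyC k F) q).[f] != 0) ->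
  exists v : 'I_k -> K,
    (forall p, ev p = 0 -> \sum_i ev p^`M(i) * v i = 0) /\
    \sum_i ev f^`M(i) * v i = 1.
Proof.
move=> charF ftr.
pose eps0 : {rmorphism F -> K} := ev \o @mpolyC k F.
have charK n : n.+1%:R != 0 :> K by rewrite -(rmorph_nat eps0) fmorph_eq0.
pose d0 : {additive F -> K} := \0.
have vd0 : vanishing_derivation eps0 d0.
  by split=> [a b|a _] //=; rewrite !mulr0 addr0.
have d00 (q : {poly F}) x : (map_poly d0 q).[x] = 0.
  suff -> : map_poly d0 q = 0 by rewrite horner0.
  by apply/polyP => i; rewrite coef_map coef0.
have [|eps1 [d1 [vd1 e1C d1C e1X d1X]]] := @derivation_extension K F eps0 d0 vd0 (ev f) 1.
  move=> q qf; suff -> : q = 0 by rewrite derivC !rmorph0 !horner0 mul0r addr0 d00.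
  apply: contrapT => /eqP /ftr; apply/negP; rewrite negbK -horner_map /=.
  by rewrite -map_poly_comp; apply/eqP.
pose a i := if insub i is Some j then ev 'X_(j : 'I_k) else 0.
have [B [iota [eps [d [y [[dM d0'] iE iD yE]]]]]] :=
  derivation_extension_seq charK k a vd1.
pose y' (i : 'I_k) := y i.
have yE' i : eps (y' i) = ev 'X_i by rewrite yE // /a valK.
pose iotaC : {rmorphism F -> B} := iota \o polyC.
pose th : {rmorphism {mpoly F[k]} -> B} := mmap iotaC y'.
have thC c : th c%:MP = iota c%:P by exact: mmapC.
have thX i : th 'X_i = y' i by rewrite /= mmapX mmap1U.
have thE p : eps (th p) = ev p.
  elim/mpoly_ring_ind: p => [c|i|p q IHp IHq|p q IHp IHq].
  - by rewrite thC iE e1C.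
  - by rewrite thX yE'.
  - by rewrite !rmorphD IHp IHq.
  - by rewrite !rmorphM IHp IHq.
have dchain p : d (th p) = \sum_i ev p^`M(i) * d (y' i).
  elim/mpoly_ring_ind: p => [c|i|p q IHp IHq|p q IHp IHq].
  - rewrite thC iD d1C big1 // => i _; by rewrite mderivC rmorph0 mul0r.
  - rewrite thX (bigD1 i) //= big1 ?addr0 => [|j ji].
      by rewrite mderivXU eqxx mpolyC1 rmorph1 mul1r.
    by rewrite mderivXU (negbTE ji) mpolyC0 rmorph0 mul0r.
  - rewrite rmorphD raddfD IHp IHq -big_split; apply: eq_bigr => i _.
    by rewrite mderivD rmorphD mulrDl.
  - rewrite rmorphM dM IHp IHq !thE !mulr_sumr -big_split; apply: eq_bigr => i _.
    rewrite mderivM rmorphD !rmorphM /=; ring.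
exists (d \o y'); split=> [p p0|]; first by rewrite -dchain d0' // thE.
(* The image of [f] under [th] and the element adjoined first both map to [ev f], so the derivation
   agrees on them. *)
rewrite -dchain; apply/eqP; rewrite -subr_eq0 -d1X -iD -raddfB.
by apply/eqP/d0'; rewrite rmorphB thE iE e1X subrr.
Qed.

(* Otherwise the values of [f] make [f] transcendental in a residue field where
   everything vanishing on [W] vanishes, and this field has a derivation [v] with
   [v f = 1]. *)
Lemma finite_values (R : realType) (k : nat) (f : {mpoly R[k]}) (W : set ('I_k -> R)) :
    (forall (K : fieldType) (ev : {rmorphism {mpoly R[k]} -> K}) (v : 'I_k -> K),
      (forall p, (forall x, W x -> p.@[x] = 0) -> ev p = 0) ->
      (forall p, ev p = 0 -> \sum_i ev p^`M(i) * v i = 0) ->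
      \sum_i ev f^`M(i) * v i = 0) ->
  finite_set [set f.@[x] | x in W].
Proof.
move=> Wcrit; apply: contrapT => infW.
pose T0 : set {mpoly R[k]} := [set p | forall x, W x -> 0 <= p.@[x]].
pose sub (q : {poly R}) : {mpoly R[k]} := (map_poly (@mpolyC k R) q).[f].
have subE q x : (sub q).@[x] = q.[f.@[x]].
  rewrite /sub -horner_map /= -map_poly_comp map_poly_id // => c _ /=.
  exact: mevalC.
pose S : set {mpoly R[k]} := [set s | exists q, q != 0 /\ s = sub q ^+ 2].
have sqr_ge0' p x : 0 <= (p ^+ 2 : {mpoly R[k]}).@[x] by rewrite rmorphXn sqr_ge0.
have [|||||Q [[[QD QM Q2] Qtot QN1 Qpr] T0Q QN]] := @exists_prime_cone _ T0 S.
- split=> [p q Tp Tq x Wx|p q Tp Tq x Wx|p x _] //.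
    by rewrite mevalD addr_ge0 ?Tp ?Tq.
  by rewrite mevalM mulr_ge0 ?Tp ?Tq.
- by move=> _ [q [_ ->]] x _.
- by exists 1; split; [exact: oner_neq0|rewrite /sub rmorph1 hornerC expr1n].
- move=> _ _ [q [q0 ->]] [r [r0 ->]]; exists (q * r); split; first exact: mulf_neq0.
  by rewrite /sub rmorphM hornerM exprMn.
(* If the opposite of the square of [q(f)] were nonnegative on [W], all values of [f] there would be
   roots of the nonzero [q]. *)
- move=> _ [q [q0 ->]] TN; apply: infW.
  have [xs [_ xsP]] := poly_root_list q0.
  apply: (sub_finite_set _ (finite_seq xs)) => _ [x Wx <-]; apply: xsP.
  have := TN x Wx; rewrite mevalN rmorphXn /= subE oppr_ge0 => H.
  by apply/eqP; have := sqr_ge0 q.[f.@[x]]; rewrite le_eqVlt ltNge H orbF eq_sym expf_eq0 => /eqP.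
pose I : set {mpoly R[k]} := [set p | Q p /\ Q (- p)].
have [||||K [ev [evP _]]] := @prime_ideal_residue_field _ I.
- have Q0 : Q 0 by have := Q2 0; rewrite expr0n.
  by split; rewrite ?oppr0.
- by case.
- move=> a u w [Qu QNu] [Qw QNw].
  have [Qau QaNu] : Q (a * u) /\ Q (- (a * u)).
    by have [Qa|Qa] := Qtot a; split; rewrite -?mulrN; first
      [exact: QM | rewrite -mulrNN ?opprK; exact: QM].
  by split; rewrite ?opprD; apply: QD.
- by move=> a b [Qab QNab]; apply: Qpr.
have [||v [vI vf]] := @exists_transcendental_derivation R k f K ev.
- by move=> n; rewrite pnatr_eq0.
- move=> q q0; apply/eqP => /evP [Qq QNq].
  have s2 : S (sub q ^+ 2) by exists q.
  by apply: (QN _ s2); rewrite expr2 -mulNr; apply: QM.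
have evW p : (forall x, W x -> p.@[x] = 0) -> ev p = 0.
  by move=> p0; apply/evP; split; apply: T0Q => x Wx; rewrite ?mevalN p0 // oppr0.
by have /eqP := Wcrit K ev v evW vI; rewrite vf oner_eq0.
Qed.

(** * Groebner bases and elimination *)

(** Induction on the number [j] of coordinates compared. A finite set good for the first [j] also
    handles the monomials whose next coordinate is at least its maximum [M]; each of the [M]
    remaining slices has its own finite set. *)
Lemma dickson (k : nat) (S : set 'X_{1..k}) :
  exists s : seq 'X_{1..k}, (forall m, m \in s -> S m) /\
    forall m, S m -> exists2 m', m' \in s & (m' <= m)%MM.
Proof.
suff H (j : nat) (S' : set 'X_{1..k}) : exists s : seq 'X_{1..k},
    (forall m, m \in s -> S' m) /\ forall m, S' m ->
      exists2 m' : 'X_{1..k}, m' \in s & forall i : 'I_k, (i < j)%N -> (m' i <= m i)%N.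
  have [s [sS sP]] := H k S; exists s; split=> // m /sP [m' sm' le]; exists m' => //.
  by apply/mnm_lepP => i; apply: le.
elim: j S' => [|j IH] S'.
  have [[m Sm]|nS] := pselect (exists m, S' m); last first.
    by exists [::]; split=> // m Sm; case: nS; exists m.
  exists [:: m]; split=> [m'|m' _]; first by rewrite inE => /eqP ->.
  by exists m; rewrite ?mem_head.
have [s [sS sP]] := IH S'.
have [ltj|lej] := ltnP j k; last first.
  exists s; split=> // m /sP [m' sm' le]; exists m' => // i _.
  by apply: le; apply: leq_trans (ltn_ord i) lej.
pose o := Ordinal ltj.
have [sv svP] := choice (fun c => IH [set m | S' m /\ m o = c]).
pose M := \max_(m <- s) (m o).
exists (s ++ flatten [seq sv c | c <- iota 0 M]); split=> [m|m Sm].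
  rewrite mem_cat => /orP [/sS //|/flattenP [_ /mapP [c _ ->] cm]].
  by have [/(_ _ cm) []] := svP c.
have splitj (m' : 'X_{1..k}) : (forall i : 'I_k, (i < j)%N -> (m' i <= m i)%N) ->
    (m' o <= m o)%N -> forall i : 'I_k, (i < j.+1)%N -> (m' i <= m i)%N.
  move=> le leo i; rewrite ltnS leq_eqVlt => /orP [/eqP ij|]; last exact: le.
  by have -> : i = o by apply: val_inj.
have [ltM|leM] := ltnP (m o) M.
  have [_ /(_ m (conj Sm erefl)) [m' sm' le]] := svP (m o).
  have [/(_ _ sm') [_ mo] _] := svP (m o).
  exists m'; last by apply: splitj; rewrite // mo.
  rewrite mem_cat; apply/orP; right; apply/flattenP; exists (sv (m o)) => //.
  by apply: map_f; rewrite mem_iota.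
have [m' sm' le] := sP _ Sm; exists m'; first by rewrite mem_cat sm'.
apply: splitj => //; apply: leq_trans leM.
exact: (@leq_bigmax_seq _ s xpredT (fun m1 : 'X_{1..k} => m1 o) m' sm' isT).
Qed.

Lemma mcoeff_mulX_neq0 (R : comNzRingType) (k : nat) (p : {mpoly R[k]}) (l m : 'X_{1..k}) :
  (p * 'X_[l])@_m != 0 -> (l <= m)%MM.
Proof.
rewrite -mcoeff_msupp (perm_mem (msuppMX _ _)) => /mapP [m' _ ->].
by rewrite lem_addr.
Qed.

Section LexOrder.
Variable k : nat.
Implicit Types a b c : 'X_{1..k}.

Lemma lex_le_refl a : lex_le a a. Proof. exact: lexx. Qed.
Lemma lex_le_trans b a c : lex_le a b -> lex_le b c -> lex_le a c.
Proof. exact: le_trans. Qed.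
Lemma lex_le_total a b : lex_le a b || lex_le b a. Proof. exact: le_total. Qed.

Lemma lex_max_l a b : lex_le a (lex_max a b).
Proof. by rewrite /lex_max; case: ifP => // _; apply: lex_le_refl. Qed.

Lemma lex_max_r a b : lex_le b (lex_max a b).
Proof.
rewrite /lex_max; case: ifP => [_|/negbT nab]; first exact: lex_le_refl.
by have := lex_le_total a b; rewrite (negbTE nab).
Qed.

Lemma lex_le_first_diff a b : lex_le a b -> a = b \/
  exists i : 'I_k, (forall j : 'I_k, (j < i)%N -> a j = b j) /\ (a i < b i)%N.
Proof.
have H (s t : seq nat) : (s <= t :> seqlexi nat)%O -> size s = size t -> s = t \/
    exists i, [/\ (i < size s)%N, forall j, (j < i)%N -> nth 0%N s j = nth 0%N t j
      & (nth 0%N s i < nth 0%N t i)%N].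
  elim: s t => [|x s IH] [|y t] //=; first by left.
  rewrite lexi_cons => /andP [xy /implyP st] [] sz.
  have [lt|yx] := ltnP x y; first by right; exists 0%N; split.
  have [->|[i [lti eqj lt]]] := IH _ (st yx) sz.
    by left; congr cons; apply/eqP; rewrite eqn_leq yx andbT.
  right; exists i.+1; split=> // -[_|j] /=; last by apply: eqj.
  by apply/eqP; rewrite eqn_leq yx andbT.
move=> ab; have [E|[i [lti eqj lt]]] := H _ _ ab (etrans (size_tuple a) (esym (size_tuple b))).
  by left; apply/val_inj/val_inj.
rewrite size_tuple in lti; right; exists (Ordinal lti); split=> [j ji|].
  by rewrite !(mnm_nth 0%N); apply: eqj.
by rewrite !(mnm_nth 0%N).
Qed.

Lemma lex_max0 a : lex_max a 0%MM = a.
Proof.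
rewrite /lex_max; case: ifP => // /lex_le_first_diff [-> //|[i [_]]].
by rewrite mnm0E.
Qed.

End LexOrder.

Section Groebner.
Variables (R : realType) (k : nat).
Local Notation P := {mpoly R[k]}.
Implicit Types (p q g : P) (J : set P) (a b m : 'X_{1..k}).

(** Stated for any [lm] because it serves twice: with the graded leading monomial for ideal
    generators, with the lexicographic one for Groebner bases. *)
Lemma exists_leading_subset J (lm : P -> 'X_{1..k}) :
  exists G : seq P, (forall g, g \in G -> J g /\ g != 0) /\
    forall p, J p -> p != 0 -> exists2 g, g \in G & (lm g <= lm p)%MM.
Proof.
have [s [sS sP]] := dickson [set m | exists p, [/\ J p, p != 0 & lm p = m]].
have [G GP] : exists G : seq P, (forall g, g \in G -> J g /\ g != 0) /\ map lm G = s.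
  elim: s sS {sP} => [|m s IH] sS; first by exists [::].
  have [p [Jp p0 pm]] := sS m (mem_head _ _).
  have [|G [GJ Gs]] := IH; first by move=> m' sm'; apply: sS; rewrite inE sm' orbT.
  exists (p :: G); rewrite /= pm Gs; split=> // g; rewrite inE => /orP [/eqP ->|/GJ] //.
case: GP => GJ Gs; exists G; split=> // p Jp p0.
have [|m' + le] := sP (lm p); first by exists p.
by rewrite -Gs => /mapP [g Gg E]; exists g => //; rewrite -E.
Qed.

(* The graded order of the library is a well-order, hence division terminates;
   this is why it is preferred to [lex_le] here. *)
Lemma hilbert_basis J :
    (forall p q, J p -> J q -> J (p + q)) -> (forall p q, J q -> J (p * q)) -> J 0 ->
  exists G : seq P, ideal G = J.
Proof.
move=> JD JM J0; have [G [GJ GP]] := exists_leading_subset J (@mlead k R).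
exists G; apply/seteqP; split=> [_ [s [sG ->]]|].
  rewrite big_seq; apply: (big_ind (fun p => J p)) => // ca /sG caG.
  by apply: JM; have [] := GJ _ caG.
elim/mleadrect => p IH Jp.
have [->|p0] := eqVneq p 0; first exact: ideal_gen0.
have [g Gg le] := GP p Jp p0; have [Jg g0] := GJ g Gg.
pose c := p@_(mlead p) / g@_(mlead g); pose d := (mlead p - mlead g)%MM.
have dE : (d + mlead g)%MM = mlead p by rewrite submK.
pose t := (c *: 'X_[d]) * g.
have tE : t = c *: (g * 'X_[d]) by rewrite /t -scalerAl mulrC.
have tI A : (forall p q, A q -> A (p * q)) -> A g -> A t by move=> AM Ag; apply: AM.
have IG : ideal G t by apply: ideal_genM; apply: mem_ideal_gen.
have -> : p = (p - t) + t by rewrite subrK.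
apply: ideal_genD => //.
have [->|r0] := eqVneq (p - t) 0; first exact: ideal_gen0.
apply: IH; last by apply: JD => //; rewrite -mulN1r; apply/JM/JM.
rewrite lt_neqAle; apply/andP; split.
  apply/eqP => E; have : (p - t)@_(mlead (p - t)) != 0 by rewrite mleadc_eq0.
  rewrite E mcoeffB tE mcoeffZ -{2}dE mcoeffMX /c divfK ?subrr ?eqxx //.
  by rewrite mleadc_eq0.
apply: le_trans (mleadB_le _ _) _; rewrite leUx lexx /= tE.
apply: le_trans (mleadZ_le _ _) _; apply: le_trans (mleadM_le _ _) _.
by rewrite mleadXm addmC dE.
Qed.

Lemma lex_lm_max p m : m \in msupp p -> lex_le m (lex_lm p).
Proof.
rewrite /lex_lm; elim: (msupp p : seq _) => // a s IH; rewrite inE big_cons.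
move=> /orP [/eqP ->|/IH H]; first exact: lex_max_l.
exact: lex_le_trans H (lex_max_r _ _).
Qed.

Lemma lex_lm_supp p : p != 0 -> lex_lm p \in msupp p.
Proof.
rewrite -msupp_eq0 /lex_lm; elim: (msupp p : seq _) => // a [|b s] IH _.
  by rewrite big_cons big_nil lex_max0 mem_head.
rewrite big_cons; move: (IH isT); move: (\big[_/_]_(j <- _) _) => c cs.
by rewrite /lex_max; case: ifP => _; rewrite ?mem_head // inE cs orbT.
Qed.

Lemma lex_lterm0 : lex_lterm (0 : P) = 0.
Proof. by rewrite /lex_lterm mcoeff0 scale0r. Qed.

(** A Groebner basis is defined by its leading terms alone, so no lexicographic division occurs. *)
Lemma exists_lex_groebner_basis J : exists G, lex_groebner_basis J G.
Proof.
have [G [GJ GP]] := exists_leading_subset J (@lex_lm R k).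
have GsubJ : [set` G] `<=` J by move=> g Gg; have [] := GJ g Gg.
exists G; split=> //; apply/seteqP; split; apply: ideal_gen_sub.
  by move=> _ [g Gg <-]; apply: mem_ideal_gen; exists g => //; apply: GsubJ.
move=> _ [p Jp <-]; have [->|p0] := eqVneq p 0.
  by rewrite lex_lterm0; apply: ideal_gen0.
have [g Gg le] := GP p Jp p0; have [_ g0] := GJ g Gg.
have gc : g@_(lex_lm g) != 0 by rewrite -mcoeff_msupp lex_lm_supp.
have -> : lex_lterm p =
    (p@_(lex_lm p) / g@_(lex_lm g)) *: 'X_[lex_lm p - lex_lm g] * lex_lterm g.
  rewrite /lex_lterm -scalerAl -scalerAr scalerA divfK // -mpolyXD submK //.
by apply: ideal_genM; apply: mem_ideal_gen; exists g.
Qed.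

Lemma ideal_gen_lterm_supp (G : seq P) p m : ideal_gen (@lex_lterm R k @` [set` G]) p ->
  p@_m != 0 -> exists g, [/\ g \in G, g != 0 & (lex_lm g <= m)%MM].
Proof.
move=> [s [sG ->]] sm; apply: contrapT => nex; move/negP: sm; apply; apply/eqP.
rewrite raddf_sum big_seq big1 // => ca /sG [g Gg E]; apply/eqP.
apply: contraT => cm; case: nex; exists g.
have [g0|g0] := eqVneq g 0.
  by move: cm; rewrite -E g0 lex_lterm0 mulr0 raddf0 eqxx.
split=> //; have {cm} : (ca.1 * lex_lterm g)@_m != 0 by rewrite E.
rewrite /lex_lterm -scalerAr mcoeffZ mulf_eq0 negb_or.
by case/andP => _; apply: mcoeff_mulX_neq0.
Qed.

End Groebner.

Section Elimination.
Variables (R : realType) (N m : nat).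
Local Notation K := (N + m + 1)%N.
Local Notation t := (optt N m).
Implicit Types (q : {poly R}) (hG : seq {mpoly R[K]}).

Let T (i : nat) : 'X_{1..K} := (U_(t) *+ i)%MM.

Let TE i j : T i j = if j == t then i else 0%N.
Proof. by rewrite /T mulmnE mnm1E eq_sym; case: eqP; rewrite ?mul1n ?mul0n. Qed.

Let T_inj i j : T i = T j -> i = j.
Proof. by move/(congr1 (fun u : 'X_{1..K} => u t)); rewrite !TE eqxx. Qed.

Lemma poly_in_tE q : poly_in_t N m q = \sum_(i < size q) q`_i *: 'X_[T i].
Proof.
rewrite /poly_in_t /horner_alg /horner_morph horner_coef size_map_poly.
apply: eq_bigr => i _; by rewrite coef_map /= -scalerAl mul1r /T mpolyXn.
Qed.

Lemma mcoeff_poly_in_t q i : (poly_in_t N m q)@_(T i) = q`_i.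
Proof.
rewrite poly_in_tE raddf_sum /=.
have [ltiq|leqi] := ltnP i (size q).
  rewrite (bigD1 (Ordinal ltiq)) //= mcoeffZ mcoeffX eqxx mulr1 big1 ?addr0 // => j ji.
  rewrite mcoeffZ mcoeffX; case: eqP => [/T_inj E|_]; last by rewrite mulr0.
  by move/eqP: ji; case; apply: val_inj.
rewrite nth_default // big1 // => j _; rewrite mcoeffZ mcoeffX.
case: eqP => [/T_inj E|_]; last by rewrite mulr0.
by move: (ltn_ord j); rewrite E ltnNge leqi.
Qed.

Lemma msupp_poly_in_t q u : u \in msupp (poly_in_t N m q) -> u = T (u t).
Proof.
rewrite mcoeff_msupp poly_in_tE raddf_sum /= => nz.
apply: contrapT => uT; move/negP: nz; apply; apply/eqP; apply: big1 => i _.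
rewrite mcoeffZ mcoeffX; case: eqP => [E|_]; last by rewrite mulr0.
by case: uT; rewrite -E {2}/T TE eqxx.
Qed.

Lemma meval_poly_in_t q (w : 'I_K -> R) : (poly_in_t N m q).@[w] = q.[w t].
Proof.
rewrite poly_in_tE raddf_sum /= horner_coef; apply: eq_bigr => i _.
rewrite mevalZ; congr (_ * _); rewrite /T -mpolyXn rmorphXn /=.
by rewrite mevalXU.
Qed.

(** At the first difference the power of [t] has the larger exponent, hence a positive one; this
    position is [t] itself, the last variable. It is what makes the order eliminate. *)
Lemma lex_le_T (u : 'X_{1..K}) e : lex_le u (T e) -> u = T (u t) /\ (u t <= e)%N.
Proof.
move=> /lex_le_first_diff [->|[i [eqj lt]]]; first by rewrite TE eqxx.
have it : i = t by apply/eqP; move: lt; rewrite TE; case: eqP.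
move: lt; rewrite it TE eqxx => lt; split; last exact: ltnW.
apply/mnmP => j; rewrite TE; case: eqVneq => [-> //|jt].
have jle : (j <= N + m)%N by have := ltn_ord j; rewrite [X in (_ < X)%N]addn1 ltnS.
rewrite eqj ?TE ?(negbTE jt) // it /= addn0 ltn_neqAle jle andbT.
by apply: contra jt => /eqP jE; apply/eqP/val_inj; rewrite /= addn0.
Qed.

Lemma lex_lm_poly_in_t q : q != 0 -> lex_lm (poly_in_t N m q) = T (size q).-1.
Proof.
move=> q0; set p := poly_in_t N m q.
have sT : T (size q).-1 \in msupp p.
  by rewrite mcoeff_msupp mcoeff_poly_in_t -lead_coefE lead_coef_eq0.
have p0 : p != 0 by rewrite -msupp_eq0; apply: contraTneq sT => ->.
have lE := msupp_poly_in_t (lex_lm_supp p0).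
have /lex_lm_max := sT; rewrite lE => /lex_le_T [_]; rewrite TE eqxx => le.
congr T; apply/eqP; rewrite eqn_leq le andbT -ltnS prednK ?size_poly_gt0 //.
rewrite ltnNge; apply/negP => leq.
by have := lex_lm_supp p0; rewrite lE mcoeff_msupp mcoeff_poly_in_t nth_default ?eqxx.
Qed.

(** Elimination theorem, at the level of zeros. Some [g] in the basis has a leading monomial
    dividing that of [q]; it is a power of [t], so [g] is itself a polynomial in [t] and has the
    root [c]. Subtracting a multiple of it makes [q] smaller. *)
Lemma opt_values_elim (hc hG : seq {mpoly R[K]}) : lex_groebner_basis (ideal hc) hG ->
  opt_values hG = [set c | forall q, ideal hc (poly_in_t N m q) -> root q c].
Proof.
move=> [GJ Glt]; apply/seteqP; split=> c; last first.
  by move=> cr q; rewrite /opt_elim /= => qG; apply: cr; apply: GJ.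
move=> cv q; have [n] := ubnP (size q); elim: n q => // n IH q /ltnSE szq Jq.
have [->|q0] := eqVneq q 0; first by rewrite root0.
have lq : lead_coef q != 0 by rewrite lead_coef_eq0.
pose d := (size q).-1; have sq : size q = d.+1 by rewrite prednK ?size_poly_gt0.
have : ideal_gen (@lex_lterm R K @` [set` hG]) (lex_lterm (poly_in_t N m q)).
  by rewrite Glt; apply: mem_ideal_gen; exists (poly_in_t N m q).
rewrite /lex_lterm lex_lm_poly_in_t // mcoeff_poly_in_t -lead_coefE -/d => Hq.
have [|g [Gg g0 le]] := ideal_gen_lterm_supp (m := T d) Hq.
  by rewrite mcoeffZ mcoeffX eqxx mulr1.
pose e := lex_lm g t.
have lg : lex_lm g = T e.
  apply/mnmP => j; rewrite TE; case: eqP => [-> //|/eqP jt].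
  by have /mnm_lepP /(_ j) := le; rewrite TE (negbTE jt) leqn0 => /eqP.
have led : (e <= d)%N by have /mnm_lepP /(_ t) := le; rewrite TE eqxx.
pose r := \poly_(i < e.+1) g@_(T i).
have gr : g = poly_in_t N m r.
  apply/mpolyP => u; have [uT|uT] := eqVneq u (T (u t)).
    rewrite uT mcoeff_poly_in_t coef_poly ltnS; case: leqP => // ltu.
    apply/eqP; rewrite mcoeff_eq0; apply/negP => /lex_lm_max.
    by rewrite lg => /lex_le_T [_]; rewrite TE eqxx leqNgt ltu.
  rewrite [LHS]memN_msupp_eq0; last first.
    by apply/negP => /lex_lm_max; rewrite lg => /lex_le_T [/eqP]; rewrite (negbTE uT).
  by rewrite memN_msupp_eq0 //; apply/negP => /msupp_poly_in_t /eqP; rewrite (negbTE uT).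
have re : r`_e != 0.
  by rewrite coef_poly ltnS leqnn -lg -mcoeff_msupp lex_lm_supp.
have rc : root r c by apply: cv; rewrite /opt_elim /= -gr.
pose b := lead_coef q / r`_e; pose q' := q - b *: 'X^(d - e) * r.
have szq' : (size q' < size q)%N.
  rewrite sq ltnS; apply/leq_sizeP => i; rewrite leq_eqVlt => /orP [/eqP <-|ltdi].
    rewrite coefB -scalerAl coefZ coefXnM ltnNge leq_subr /= subKn // divfK //.
    by rewrite lead_coefE subrr.
  rewrite coefB -scalerAl coefZ coefXnM nth_default ?sq // sub0r.
  rewrite ifF; last by apply/negbTE; rewrite -leqNgt (leq_trans (leq_subr _ _)) // ltnW.
  rewrite [r`_ _]coef_poly ifF ?mulr0 ?oppr0 //; apply/negbTE; rewrite -leqNgt.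
  by rewrite ltn_subRL subnK.
have Jq' : ideal hc (poly_in_t N m q').
  rewrite /q' /poly_in_t rmorphB rmorphM; apply: ideal_genB => //.
  have Jr : ideal hc (poly_in_t N m r) by rewrite -gr; apply: GJ.
  by apply: ideal_genM; apply: Jr.
have q'c : root q' c by apply: IH => //; apply: leq_trans szq' szq.
have -> : q = q' + b *: 'X^(d - e) * r by rewrite subrK.
by rewrite rootE hornerD hornerM (rootP q'c) (rootP rc) mulr0 addr0.
Qed.

End Elimination.

(** * The output of OPT *)

Lemma meval_mrename (R : realType) (n k : nat) (s : 'I_n -> 'I_k) (p : {mpoly R[n]})
    (w : 'I_k -> R) : (mrename s p).@[w] = p.@[w \o s].
Proof.
rewrite comp_mpoly_meval; apply: meval_eq => i.
by rewrite tnth_mktuple mevalXU.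
Qed.

Definition join (T : Type) (a b : nat) (x : 'I_a -> T) (y : 'I_b -> T) (i : 'I_(a + b)) : T :=
  match fintype.split i with inl j => x j | inr j => y j end.

Lemma join_lshift (T : Type) (a b : nat) (x : 'I_a -> T) (y : 'I_b -> T) i :
  join x y (lshift b i) = x i.
Proof. by rewrite /join (unsplitK (inl i)). Qed.

Lemma join_rshift (T : Type) (a b : nat) (x : 'I_a -> T) (y : 'I_b -> T) i :
  join x y (rshift a i) = y i.
Proof. by rewrite /join (unsplitK (inr i)). Qed.

Section OptOutput.
Variables (R : realType) (N m : nat).
Variables (f : {mpoly R[N]}) (g : 'I_m -> {mpoly R[N]}) (h : seq {mpoly R[N]}).

Definition attained : set R :=
  [set f.@[z] | z in [set z | (forall p, p \in h -> p.@[z] = 0) /\ forall j, 0 <= (g j).@[z]]].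

Lemma opt_system_zeroP (w : 'I_(N + m + 1) -> R) :
  (forall p, p \in opt_system f g h -> p.@[w] = 0) <->
  [/\ forall j, (g j).@[w \o @optz N m] = w (opty N j) ^+ 2,
      forall p, p \in h -> p.@[w \o @optz N m] = 0
    & w (optt N m) = f.@[w \o @optz N m]].
Proof.
split=> [w0|[w1 w2 w3] p].
  split=> [j|p hp|].
  - apply/eqP; rewrite -subr_eq0 -(w0 (mrename (@optz N m) (g j) - 'X_(opty N j) ^+ 2)).
      by rewrite mevalB meval_mrename rmorphXn /= mevalXU.
    by rewrite mem_cat; apply/orP; left; apply/mapP; exists j; rewrite // mem_enum.
  - rewrite -meval_mrename; apply: w0.
    by rewrite !mem_cat (map_f (mrename (@optz N m)) hp) orbT.
  - apply/eqP; rewrite -subr_eq0 -(w0 ('X_(optt N m) - mrename (@optz N m) f)).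
      by rewrite mevalB meval_mrename mevalXU.
    by rewrite !mem_cat mem_head !orbT.
rewrite !mem_cat => /orP [/mapP [j _ ->]|/orP [/mapP [q hq ->]|]].
- by rewrite mevalB meval_mrename rmorphXn /= mevalXU w1 subrr.
- by rewrite meval_mrename w2.
- by rewrite inE => /eqP ->; rewrite mevalB meval_mrename mevalXU w3 subrr.
Qed.

(** The equations in [y] are solvable over the reals exactly where all [g j] are nonnegative, by
    square roots. *)
Lemma attainedP (c : R) : attained c <->
  exists w, (forall p, p \in opt_system f g h -> p.@[w] = 0) /\ w (optt N m) = c.
Proof.
split=> [[z [hz gz] <-]|[w [/opt_system_zeroP [w1 w2 w3] <-]]]; last first.
  exists (w \o @optz N m); last by rewrite w3.
  by split=> // j; rewrite w1 sqr_ge0.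
pose w : 'I_(N + m + 1) -> R :=
  join (join z (fun j => Num.sqrt (g j).@[z])) (fun _ : 'I_1 => f.@[z]).
have wz p : p.@[w \o @optz N m] = p.@[z].
  by apply: meval_eq => i; rewrite /= /optz /w !join_lshift.
exists w; split; last by rewrite /optt /w join_rshift.
apply/opt_system_zeroP; split=> [j|p hp|]; rewrite wz.
- by rewrite /opty /w join_lshift join_rshift sqr_sqrtr.
- exact: hz.
- by rewrite /optt /w join_rshift.
Qed.

Lemma opt_computes_min (v : R) : finite_set attained -> attained v ->
  (forall c, attained c -> v <= c) -> opt_computes f g h v%:E.
Proof.
move=> fin av vmin.
pose J := real_radical (ideal (opt_system f g h)).
have JP p : J p <-> forall w, (forall q, q \in opt_system f g h -> q.@[w] = 0) -> p.@[w] = 0.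
  split=> [Jp w w0|]; [exact: real_radical_vanish w0 Jp|exact: real_nullstellensatz].
have /finite_seqP [s sE] := fin.
have valuesE hc hG : ideal hc = J -> lex_groebner_basis (ideal hc) hG -> opt_values hG = attained.
  move=> hcJ gb; rewrite (opt_values_elim gb) hcJ; apply/seteqP; split=> c /=.
    (* Finiteness enters here: this product, taken at [t], vanishes on all zeros of the system, so
       it is in the real radical and excludes every other value. *)
    pose q := \prod_(a <- s) ('X - a%:P) => cr.
    have : root q c.
      apply/cr/JP => w w0; rewrite meval_poly_in_t; apply/rootP.
      rewrite root_prod_XsubC.
      have : attained (w (optt N m)) by apply/attainedP; exists w.
      by rewrite sE.
    by rewrite root_prod_XsubC sE.
  move=> /attainedP [w [w0 <-]] q /JP /(_ w w0); rewrite meval_poly_in_t => q0.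
  exact/rootP.
have infE : ereal_inf (EFin @` attained) = v%:E.
  apply/le_anti/andP; split; first by apply: ereal_inf_lbound; exists v.
  by apply: le_ereal_inf_tmp => _ [c ac <-]; rewrite lee_fin; apply: vmin.
move=> u; split=> [[hc [hG [hcJ gb ->]]]|->]; first by rewrite (valuesE hc hG hcJ gb).
(* Existence of a run: as a vanishing ideal, the real radical is an ideal, hence finitely
   generated. *)
have [hc hcJ] : exists hc, ideal hc = J.
  apply: hilbert_basis => [p q /JP Jp /JP Jq|p q /JP Jq|]; apply/JP => w w0.
  - by rewrite mevalD Jp // Jq // addr0.
  - by rewrite mevalM Jq // mulr0.
  - exact: meval0.
have [hG gb] := exists_lex_groebner_basis (ideal hc).
by exists hc, hG; split=> //; rewrite (valuesE hc hG).
Qed.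

End OptOutput.

(** * The Fritz John conditions *)

Section Gordan.
Variables (R : realFieldType) (n : nat) (I : eqType).
Implicit Types (s : seq I) (a : I -> 'I_n -> R) (d e : 'I_n -> R).

Definition dot d e : R := \sum_(k < n) d k * e k.

Lemma dotDr x d e : dot x (fun k => d k + e k) = dot x d + dot x e.
Proof. by rewrite /dot -big_split; apply: eq_bigr => k _; rewrite mulrDr. Qed.
Lemma dotZr x c d : dot x (fun k => c * d k) = c * dot x d.
Proof. by rewrite /dot mulr_sumr; apply: eq_bigr => k _; rewrite mulrCA. Qed.
Lemma dotC d e : dot d e = dot e d.
Proof. by apply: eq_bigr => k _; rewrite mulrC. Qed.
Lemma dot_gt0 d : (exists k, d k != 0) -> 0 < dot d d.
Proof.
move=> [k dk]; rewrite /dot (bigD1 k) //= ltr_wpDr //.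
  by apply: sumr_ge0 => i _; rewrite -expr2 sqr_ge0.
by rewrite -expr2 exprn_even_gt0.
Qed.

Lemma small_perturbation s (x y : I -> R) : (forall i, i \in s -> 0 < x i) ->
  exists2 del, 0 < del & forall i, i \in s -> 0 < x i + del * y i.
Proof.
elim: s => [|b s IH] xs; first by exists 1.
have [|del del0 H] := IH; first by move=> i si; apply: xs; rewrite inE si orbT.
have xb : 0 < x b by apply: xs; rewrite mem_head.
have den : 0 < x b + `|del * y b| by rewrite ltr_wpDr.
(* With this factor [th * |del * y b|] is [x b - th * x b], so at least [th * x b > 0] is left; as
   [th <= 1], the other indices are not harmed. *)
pose th := x b / (x b + `|del * y b|).
have th0 : 0 < th by apply: divr_gt0.
have th1 : th <= 1 by rewrite ler_pdivrMr // mul1r lerDl.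
exists (th * del); first exact: mulr_gt0.
move=> i; rewrite inE => /orP [/eqP ->|si].
  have E : th * (x b + `|del * y b|) = x b by rewrite divfK // gt_eqF.
  have : - (th * `|del * y b|) <= th * del * y b.
    by rewrite -mulrA -mulrN ler_wpM2l ?(ltW th0) // lerNnormlW.
  have : 0 < th * x b by apply: mulr_gt0.
  by move: E; rewrite mulrDr; lra.
have xi : 0 < x i by apply: xs; rewrite inE si orbT.
have := H i si; have [yi|yi] := lerP 0 (y i).
  by move=> _; rewrite ltr_wpDr // mulr_ge0 // mulr_ge0 // ltW.
have : del * y i <= th * del * y i.
  rewrite -mulrA -subr_ge0 -[X in _ - X]mul1r -mulrBl mulr_le0 ?subr_le0 //.
  by rewrite pmulr_rle0 // ltW.
lra.
Qed.

(** Induction on [s] for all families at once: the hypothesis is used for [a], and again for the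
    vectors [c] when the direction [d] found for [s] is negative on [a b]. *)
Lemma gordan s a : uniq s ->
  (exists d, forall i, i \in s -> 0 < dot (a i) d) \/
  exists lam : I -> R, [/\ forall i, i \in s -> 0 <= lam i, 0 < \sum_(i <- s) lam i
    & forall k, \sum_(i <- s) lam i * a i k = 0].
Proof.
elim: s a => [|b s IH] a; first by left; exists (fun=> 0).
move=> /andP [bs us].
have ib i : i \in s -> (i == b) = false.
  by move=> si; apply/negbTE; apply: contraNneq bs => <-.
have sumE (F F' : I -> R) x : (forall i, i \in s -> F' i = F i) -> F' b = x ->
    \sum_(i <- b :: s) F' i = x + \sum_(i <- s) F i.
  move=> FF Fb; rewrite big_cons Fb; congr (_ + _).
  by rewrite big_seq [RHS]big_seq; apply: eq_bigr.
have perturb e : (exists k, a b k != 0) -> (forall i, i \in s -> 0 < dot (a i) e) ->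
    0 <= dot (a b) e -> exists d, forall i, i \in b :: s -> 0 < dot (a i) d.
  move=> bN0 epos eb.
  have [del del0 H] := small_perturbation (fun i => dot (a i) (a b)) epos.
  exists (fun k => e k + del * a b k) => i; rewrite dotDr dotZr inE => /orP [/eqP ->|/H //].
  by rewrite ltr_wpDl // mulr_gt0 // dot_gt0.
have [[d dpos]|[lam [lam0 lamS lamE]]] := IH a us; last first.
  right; exists (fun i => if i == b then 0 else lam i); split=> [i||k].
  - by rewrite inE; case: eqP => //= _; apply: lam0.
  - by rewrite (sumE lam _ 0) ?add0r ?eqxx // => i si; rewrite ib.
  - rewrite (sumE (fun i => lam i * a i k) _ 0) ?lamE ?addr0 ?eqxx ?mul0r // => i si.
    by rewrite ib.
have [bN0|b0] := pselect (exists k, a b k != 0); last first.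
  right; exists (fun i => if i == b then 1 else 0); split=> [i _||k].
  - by case: ifP.
  - rewrite (sumE (fun=> 0) _ 1) ?big1 ?addr0 ?eqxx // => i si; by rewrite ib.
  - rewrite (sumE (fun=> 0) _ 0) ?big1 ?addr0 ?eqxx //.
      by move=> i si; rewrite ib // mul0r.
    by rewrite mul1r; apply: contrapT => /eqP bk; apply: b0; exists k.
have [bd|bd] := ltrP 0 (dot (a b) d).
  by left; exists d => i; rewrite inE => /orP [/eqP ->|/dpos].
have [bd0|bd0] := eqVneq (dot (a b) d) 0.
  by left; apply: (perturb d) => //; rewrite bd0.
have {bd0}bd : 0 < - dot (a b) d by rewrite oppr_gt0 lt_neqAle bd0.
set be := - dot (a b) d in bd.
(* [c i] is the positive combination of [a i] and [a b] orthogonal to [d]. *)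
pose c i k := dot (a i) d * a b k + be * a i k.
have dotc i e : dot (c i) e = dot (a i) d * dot (a b) e + be * dot (a i) e.
  by rewrite dotC dotDr !dotZr !(dotC e).
have [[e epos]|[mu [mu0 muS muE]]] := IH c us.
  (* The multiple of [d] is chosen to make the direction orthogonal to [a b]; on [a i] it takes the
     value of [e] on [c i], divided by [be]. A small step along [a b] then makes all values
     positive. *)
  left; apply: (perturb (fun k => e k + dot (a b) e / be * d k)) => // [i si|].
    have := epos i si; rewrite dotc dotDr dotZr => H.
    have -> : dot (a i) e + dot (a b) e / be * dot (a i) d =
        (dot (a i) d * dot (a b) e + be * dot (a i) e) / be.
      by field; rewrite gt_eqF.
    exact: divr_gt0.
  rewrite dotDr dotZr.
  have -> : dot (a b) e / be * dot (a b) d = - dot (a b) e.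
    by rewrite -[dot (a b) d]opprK -/be mulrN divfK // gt_eqF.
  by rewrite subrr.
right; exists (fun i => if i == b then \sum_(j <- s) mu j * dot (a j) d else be * mu i).
have S0 : 0 < \sum_(j <- s) mu j * dot (a j) d.
  have Sge : 0 <= \sum_(j <- s) mu j * dot (a j) d.
    by rewrite big_seq sumr_ge0 // => j sj; rewrite mulr_ge0 ?mu0 // ltW ?dpos.
  rewrite lt_neqAle Sge andbT eq_sym; apply/negP => /eqP S0.
  move: muS; rewrite big_seq big1 ?ltxx // => j sj.
  move: S0; rewrite big_seq => /eqP; rewrite psumr_eq0; last first.
    by move=> i si; rewrite mulr_ge0 ?mu0 // ltW ?dpos.
  move=> /allP /(_ j sj); rewrite sj mulf_eq0 => /orP [/eqP //|].
  by rewrite gt_eqF ?dpos.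
split=> [i||k].
- rewrite inE; case: eqP => [_ _|_ /= si]; first exact: ltW.
  by rewrite mulr_ge0 ?mu0 // ltW.
- rewrite (sumE (fun i => be * mu i) _ (\sum_(j <- s) mu j * dot (a j) d)) ?eqxx //.
    rewrite ltr_wpDr // big_seq sumr_ge0 // => i si.
    by rewrite mulr_ge0 ?mu0 // ltW.
  by move=> i si; rewrite ib.
- rewrite (sumE (fun i => be * mu i * a i k) _
    ((\sum_(j <- s) mu j * dot (a j) d) * a b k)) ?eqxx //; last first.
    by move=> i si; rewrite ib.
  rewrite -[RHS](muE k) mulr_suml -big_split; apply: eq_bigr => i _.
  rewrite /c /=; ring.
Qed.

End Gordan.

Section FritzJohn.
Variables (R : realType) (n m : nat).
Implicit Types (p : {mpoly R[n]}) (x d : 'I_n -> R).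

Let line x d p : {poly R} := mmap polyC (fun i => (x i)%:P + d i *: 'X) p.

Lemma horner_line x d p eps : (line x d p).[eps] = p.@[fun i => x i + eps * d i].
Proof.
elim/mpoly_ring_ind: p => [c|i|p q IHp IHq|p q IHp IHq].
- by rewrite /line mmapC hornerC mevalC.
- by rewrite /line mmapX mmap1U mevalXU hornerD hornerC hornerZ hornerX mulrC.
- by rewrite /line rmorphD hornerD -/(line x d p) -/(line x d q) IHp IHq mevalD.
- by rewrite /line rmorphM hornerM -/(line x d p) -/(line x d q) IHp IHq mevalM.
Qed.

Lemma meval_line0 x d p : p.@[fun i => x i + 0 * d i] = p.@[x].
Proof. by apply: meval_eq => i; rewrite mul0r addr0. Qed.

Lemma deriv_line x d p : (line x d p)^`().[0] = \sum_i (p^`M(i)).@[x] * d i.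
Proof.
elim/mpoly_ring_ind: p => [c|i|p q IHp IHq|p q IHp IHq].
- rewrite /line mmapC derivC horner0 big1 // => i _.
  by rewrite mderivC meval0 mul0r.
- rewrite /line mmapX mmap1U derivD derivC derivZ derivX add0r hornerZ hornerC mulr1.
  rewrite (bigD1 i) //= big1 ?addr0 => [|j ji].
    by rewrite mderivXU eqxx mevalC mul1r.
  by rewrite mderivXU (negbTE ji) mevalC mul0r.
- rewrite /line rmorphD derivD hornerD -/(line x d p) -/(line x d q) IHp IHq -big_split.
  by apply: eq_bigr => i _; rewrite mderivD mevalD mulrDl.
- rewrite /line rmorphM derivM hornerD !hornerM -/(line x d p) -/(line x d q) IHp IHq.
  rewrite !horner_line !meval_line0 mulr_suml mulr_sumr -big_split; apply: eq_bigr => i _.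
  rewrite mderivM mevalD !mevalM /=; ring.
Qed.

(** Along the line [p] is a univariate polynomial; its derivative stays positive near [0], and the
    mean value theorem applies. *)
Lemma increasing_step x d p : 0 < \sum_i (p^`M(i)).@[x] * d i ->
  exists2 del, 0 < del & forall eps, 0 < eps < del -> p.@[x] < p.@[fun i => x i + eps * d i].
Proof.
rewrite -deriv_line => d0.
have [del del0 H] := @poly_cont R 0 (line x d p)^`() _ d0.
exists del => // eps /andP [eps0 epsdel].
have [c] := poly_mvt (line x d p) eps0; rewrite in_itv /= => /andP [c0 ceps].
rewrite subr0 !horner_line meval_line0 => E; rewrite -subr_gt0 E mulr_gt0 //.
have := H c; rewrite subr0 gtr0_norm // => /(_ (lt_trans ceps epsdel)).
by rewrite ltr_norml => /andP [+ _]; rewrite ltrBrDl subrr.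
Qed.

Lemma positive_step x d p : 0 < p.@[x] ->
  exists2 del, 0 < del & forall eps, 0 < eps < del -> 0 < p.@[fun i => x i + eps * d i].
Proof.
rewrite -(meval_line0 x d) -horner_line => p0.
have [del del0 H] := @poly_cont R 0 (line x d p) _ p0.
exists del => // eps /andP [eps0 epsdel]; rewrite -horner_line.
have := H eps; rewrite subr0 gtr0_norm // => /(_ epsdel).
by rewrite ltr_norml => /andP [+ _]; rewrite ltrBrDl subrr.
Qed.

Lemma common_step (I : eqType) (s : seq I) (P : I -> R -> Prop) :
  (forall i, i \in s -> exists2 del, 0 < del & forall eps, 0 < eps < del -> P i eps) ->
  exists2 eps, 0 < eps & forall i, i \in s -> P i eps.
Proof.
move=> H; suff [del del0 Hdel] : exists2 del, 0 < del &
    forall i, i \in s -> forall eps, 0 < eps < del -> P i eps.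
  exists (del / 2) => [|i si]; first exact: divr_gt0.
  by apply: Hdel; rewrite // divr_gt0 //= ltr_pdivrMr // ltr_pMr // ltr1n.
elim: s H => [|b s IH] H; first by exists 1.
have [|del del0 Hdel] := IH; first by move=> i si; apply: H; rewrite inE si orbT.
have [del' del'0 Hdel'] := H b (mem_head _ _).
exists (Num.min del del'); first by rewrite lt_min del0.
move=> i + eps; rewrite inE lt_min => /orP [/eqP ->|si] /and3P [e0 ed ed'].
  by apply: Hdel'; rewrite e0.
by apply: Hdel => //; rewrite e0.
Qed.

(** Gordan's alternative for the gradients of the active constraints and the opposite of the
    gradient of [f], indexed by [None]. A common ascent direction would lead to feasible points with
    smaller [f], as inactive constraints stay positive for a short step. *)
Lemma fritz_john (f : {mpoly R[n]}) (g : 'I_m -> {mpoly R[n]}) x :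
    feasible g x -> (forall y, feasible g y -> f.@[x] <= f.@[y]) ->
  exists (mu0 : R) (mu : 'I_m -> R), [/\ 0 <= mu0, forall j, 0 <= mu j,
    0 < mu0 + \sum_j mu j,
    forall i, mu0 * (f^`M(i)).@[x] = \sum_j mu j * ((g j)^`M(i)).@[x]
    & forall j, mu j * (g j).@[x] = 0].
Proof.
move=> feas xmin.
pose active := [pred j | (g j).@[x] == 0].
pose s := None :: [seq Some j | j <- enum 'I_m & active j].
pose a o (i : 'I_n) : R :=
  if o is Some j then ((g j)^`M(i)).@[x] else - (f^`M(i)).@[x].
have us : uniq s.
  rewrite cons_uniq; apply/andP; split; first by apply/mapP => -[].
  rewrite map_inj_uniq; last by move=> ? ? [].
  exact: filter_uniq (enum_uniq _).
have sums (F : option 'I_m -> R) : \sum_(o <- s) F o =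
    F None + \sum_j (if active j then F (Some j) else 0).
  by rewrite big_cons big_map big_filter big_mkcond big_enum.
have [[d dpos]|[lam [lam0 lamS lamE]]] := gordan a us.
  pose P o eps := if o is Some j then 0 <= (g j).@[fun i => x i + eps * d i]
    else f.@[fun i => x i + eps * d i] < f.@[x].
  have [o _|eps eps0 HP] := @common_step _ (None :: [seq Some j | j <- enum 'I_m]) P.
    case: o => [j|] /=.
      have [gj|gj] := eqVneq (g j).@[x] 0.
        have [|del del0 H] := @increasing_step x d (g j).
          by apply: (dpos (Some j)); rewrite inE /= map_f // mem_filter /= gj eqxx mem_enum.
        by exists del => // eps /H; rewrite gj => /ltW.
      have [|del del0 H] := @positive_step x d (g j); first by rewrite lt_neqAle eq_sym gj feas.
      by exists del => // eps /H /ltW.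
    have [|del del0 H] := @increasing_step x d (- f).
      have := dpos None (mem_head _ _); congr (_ < _); apply: eq_bigr => i _.
      by rewrite mderivN mevalN.
    by exists del => // eps /H; rewrite !mevalN ltrN2.
  have := HP None (mem_head _ _); rewrite /= ltNge xmin // => j.
  by apply: (HP (Some j)); rewrite inE /= map_f ?mem_enum.
exists (lam None), (fun j => if active j then lam (Some j) else 0).
have lamj j : active j -> 0 <= lam (Some j).
  by move=> aj; apply: lam0; rewrite inE /= map_f // mem_filter mem_enum andbT.
split=> [|j||i|j].
- by apply: lam0; rewrite mem_head.
- by case: ifP => // /lamj.
- by rewrite -(sums lam).
- have /eqP := lamE i; rewrite sums mulrN addrC subr_eq0 => /eqP <-.
  by apply: eq_bigr => j _; case: ifP; rewrite ?mul0r.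
- by case: ifP => [/eqP ->|_]; rewrite ?mulr0 ?mul0r.
Qed.

End FritzJohn.

(** * Values at points with multipliers *)

Section MultiplierValues.
Variables (R : realType) (n m : nat).
Variables (f : {mpoly R[n]}) (g : 'I_m -> {mpoly R[n]}).
Implicit Types (x : 'I_n -> R).

Lemma meval_inx (k : nat) (p : {mpoly R[n]}) x (lam : 'I_k -> R) :
  (inx k p).@[join x lam] = p.@[x].
Proof. by rewrite meval_mrename; apply: meval_eq => i; rewrite /= join_lshift. Qed.

Lemma inxC (k : nat) c : inx k (c%:MP : {mpoly R[n]}) = c%:MP.
Proof. exact: comp_mpolyC. Qed.
Lemma inxX (k : nat) (i : 'I_n) : inx k ('X_i : {mpoly R[n]}) = 'X_(lshift k i).
Proof. by rewrite /inx /mrename comp_mpolyXU -tnth_nth tnth_mktuple. Qed.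
Lemma inxD (k : nat) (p q : {mpoly R[n]}) : inx k (p + q) = inx k p + inx k q.
Proof. exact: comp_mpolyD. Qed.
Lemma inxM (k : nat) (p q : {mpoly R[n]}) : inx k (p * q) = inx k p * inx k q.
Proof. exact: rmorphM. Qed.

Lemma mderiv_inx (k : nat) (p : {mpoly R[n]}) (i : 'I_n) :
  (inx k p)^`M(lshift k i) = inx k p^`M(i).
Proof.
elim/mpoly_ring_ind: p => [c|j|p q IHp IHq|p q IHp IHq].
- by rewrite inxC !mderivC -[0]mpolyC0 inxC.
- by rewrite inxX !mderivXU inxC (inj_eq (@lshift_inj _ _)).
- by rewrite inxD !mderivD inxD IHp IHq.
- by rewrite inxM !mderivM inxD !inxM IHp IHq.
Qed.

Lemma mderiv_inx_lam (k : nat) (p : {mpoly R[n]}) (i : 'I_k) :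
  (inx k p)^`M(rshift n i) = 0.
Proof.
elim/mpoly_ring_ind: p => [c|j|p q IHp IHq|p q IHp IHq].
- by rewrite inxC mderivC.
- by rewrite inxX mderivXU eq_rlshift mpolyC0.
- by rewrite inxD mderivD IHp IHq addr0.
- by rewrite inxM mderivM IHp IHq mulr0 mul0r addr0.
Qed.

Definition multiplier_point x (lam : 'I_m -> R) : Prop :=
  (forall i, (f^`M(i)).@[x] = \sum_(j < m) lam j * ((g j)^`M(i)).@[x]) /\
  forall j, lam j * (g j).@[x] = 0.

(** Neither feasibility nor signs of multipliers are imposed, so that one statement serves all four
    systems, with squared multipliers and with multipliers divided by a nonzero [lambda_0]. *)
Lemma finite_multiplier_values :
  finite_set [set f.@[x] | x in [set x | exists lam, multiplier_point x lam]].
Proof.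
pose W : set ('I_(n + m) -> R) :=
  [set w | exists x lam, multiplier_point x lam /\ w = join x lam].
suff /(sub_finite_set _) : finite_set [set (inx m f).@[w] | w in W].
  apply => _ [x [lam xlam] <-]; exists (join x lam); last exact: meval_inx.
  by exists x, lam.
apply: finite_values => K ev v evW evD.
have evf i : ev (inx m f^`M(i)) = \sum_j ev (lamKKT R n j) * ev (inx m (g j)^`M(i)).
  have : ev (inx m f^`M(i) - \sum_j lamKKT R n j * inx m (g j)^`M(i)) = 0.
    apply: evW => _ [x [lam [[E _] ->]]]; rewrite mevalB meval_inx E.
    rewrite (raddf_sum (meval (join x lam))) /=.
    apply/eqP; rewrite subr_eq0; apply/eqP/eq_bigr => j _.
    by rewrite mevalM mevalXU join_rshift meval_inx.
  rewrite rmorphB => /eqP; rewrite subr_eq0 => /eqP ->.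
  by rewrite rmorph_sum; apply: eq_bigr => j _; apply: rmorphM.
have evg j : ev (lamKKT R n j) = 0 \/ ev (inx m (g j)) = 0.
  have /eqP : ev (lamKKT R n j * inx m (g j)) = 0.
    apply: evW => _ [x [lam [[_ E] ->]]].
    by rewrite mevalM mevalXU join_rshift meval_inx.
  by rewrite rmorphM mulf_eq0 => /orP [] /eqP; [left|right].
have chain p : \sum_i ev (inx m p)^`M(i) * v i =
    \sum_(i < n) ev (inx m p^`M(i)) * v (lshift m i).
  rewrite big_split_ord /= [X in _ + X]big1 ?addr0 => [|i _].
    by apply: eq_bigr => i _; rewrite mderiv_inx.
  by rewrite mderiv_inx_lam rmorph0 mul0r.
rewrite chain; under eq_bigr => i _ do rewrite evf mulr_suml.
rewrite exchange_big big1 // => j _.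
(* Complementarity splits in the field [K]: the multiplier vanishes, or [g j] does and then so does
   its derivation. *)
have [l0|g0] := evg j; first by rewrite big1 // => i _; rewrite l0 !mul0r.
under eq_bigr => i _ do rewrite -mulrA.
by rewrite -mulr_sumr -chain evD // mulr0.
Qed.

End MultiplierValues.

(** * The four systems *)

Lemma forall_in_cat_map (T : eqType) (n : nat) (F : 'I_n -> T) (s : seq T) (Q : T -> Prop) :
  (forall p, p \in [seq F i | i <- enum 'I_n] ++ s -> Q p) <->
  (forall i, Q (F i)) /\ forall p, p \in s -> Q p.
Proof.
split=> [H|[HF Hs] p].
  by split=> [i|p sp]; apply: H; rewrite mem_cat ?sp ?orbT // map_f ?mem_enum.
by rewrite mem_cat => /orP [/mapP [i _ ->]|/Hs].
Qed.

Lemma forall_in_seq1 (T : eqType) (x : T) (Q : T -> Prop) :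
  (forall p, p \in [:: x] -> Q p) <-> Q x.
Proof. by split=> [|Qx p]; [apply; rewrite mem_head|rewrite inE => /eqP ->]. Qed.

Section Assembly.
Variables (R : realType) (n m : nat).
Variables (f : {mpoly R[n]}) (g : 'I_m -> {mpoly R[n]}).
Implicit Types (x : 'I_n -> R).

Lemma meval_sum (k : nat) (w : 'I_k -> R) (F : 'I_m -> {mpoly R[k]}) :
  (\sum_(j < m) F j).@[w] = \sum_(j < m) (F j).@[w].
Proof. exact: (raddf_sum (meval w)). Qed.

Lemma mevalXn (k e : nat) (w : 'I_k -> R) (p : {mpoly R[k]}) : (p ^+ e).@[w] = p.@[w] ^+ e.
Proof. exact: (rmorphXn (meval w)). Qed.

Lemma meval_rshift (k : nat) x (lam : 'I_k -> R) j :
  ('X_(rshift n j) : {mpoly R[n + k]}).@[join x lam] = lam j.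
Proof. by rewrite mevalXU join_rshift. Qed.

Lemma subr_eq0P (a b : R) : a - b = 0 <-> a = b.
Proof. by split=> [/eqP|->]; rewrite ?subrr // subr_eq0 => /eqP. Qed.

Lemma h_KKT_zeroP x lam :
  (forall p, p \in h_KKT f g -> p.@[join x lam] = 0) <-> multiplier_point f g x lam.
Proof.
have E1 i : (inx m f^`M(i) - \sum_(j < m) lamKKT R n j * inx m (g j)^`M(i)).@[join x lam]
    = (f^`M(i)).@[x] - \sum_(j < m) lam j * ((g j)^`M(i)).@[x].
  rewrite mevalB meval_inx meval_sum; congr (_ - _); apply: eq_bigr => j _.
  by rewrite mevalM meval_rshift meval_inx.
have E2 j : (lamKKT R n j * inx m (g j)).@[join x lam] = lam j * (g j).@[x].
  by rewrite mevalM meval_rshift meval_inx.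
rewrite /h_KKT -[X in _ ++ X]cats0 !forall_in_cat_map.
split=> [[H1 [H2 _]]|[H1 H2]]; split.
- by move=> i; apply/subr_eq0P; rewrite -E1.
- by move=> j; rewrite -E2.
- by move=> i; rewrite E1; apply/subr_eq0P.
- by split=> // j; rewrite E2.
Qed.

Lemma h_KKT_plus_zeroP x lam :
  (forall p, p \in h_KKT_plus f g -> p.@[join x lam] = 0) <->
  multiplier_point f g x (fun j => lam j ^+ 2).
Proof.
have E1 i : (inx m f^`M(i) - \sum_(j < m) lamKKT R n j ^+ 2 * inx m (g j)^`M(i)).@[join x lam]
    = (f^`M(i)).@[x] - \sum_(j < m) lam j ^+ 2 * ((g j)^`M(i)).@[x].
  rewrite mevalB meval_inx meval_sum; congr (_ - _); apply: eq_bigr => j _.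
  by rewrite mevalM mevalXn meval_rshift meval_inx.
have E2 j : (lamKKT R n j ^+ 2 * inx m (g j)).@[join x lam] = lam j ^+ 2 * (g j).@[x].
  by rewrite mevalM mevalXn meval_rshift meval_inx.
rewrite /h_KKT_plus -[X in _ ++ X]cats0 !forall_in_cat_map.
split=> [[H1 [H2 _]]|[H1 H2]]; split.
- by move=> i; apply/subr_eq0P; rewrite -E1.
- by move=> j; rewrite -E2.
- by move=> i; rewrite E1; apply/subr_eq0P.
- by split=> // j; rewrite E2.
Qed.

Definition fj_point x (mu0 : R) (mu : 'I_m -> R) : Prop :=
  (forall i, mu0 * (f^`M(i)).@[x] = \sum_(j < m) mu j * ((g j)^`M(i)).@[x]) /\
  forall j, mu j * (g j).@[x] = 0.

Lemma meval_sum_sqr x (lam : 'I_m.+1 -> R) :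
  (1 - (lam0 R n m ^+ 2 + \sum_(j < m) lamFJ R n j ^+ 2)).@[join x lam]
  = 1 - (lam ord0 ^+ 2 + \sum_(j < m) lam (lift ord0 j) ^+ 2).
Proof.
rewrite mevalB meval1 mevalD mevalXn meval_rshift meval_sum; congr (_ - (_ + _)).
by apply: eq_bigr => j _; rewrite mevalXn meval_rshift.
Qed.

Lemma h_FJ_zeroP x lam :
  (forall p, p \in h_FJ f g -> p.@[join x lam] = 0) <->
  fj_point x (lam ord0) (fun j => lam (lift ord0 j)) /\
  lam ord0 ^+ 2 + \sum_(j < m) lam (lift ord0 j) ^+ 2 = 1.
Proof.
have E1 i : (lam0 R n m * inx m.+1 f^`M(i)
      - \sum_(j < m) lamFJ R n j * inx m.+1 (g j)^`M(i)).@[join x lam]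
    = lam ord0 * (f^`M(i)).@[x] - \sum_(j < m) lam (lift ord0 j) * ((g j)^`M(i)).@[x].
  rewrite mevalB mevalM meval_rshift meval_inx meval_sum; congr (_ - _).
  by apply: eq_bigr => j _; rewrite mevalM meval_rshift meval_inx.
have E2 j : (lamFJ R n j * inx m.+1 (g j)).@[join x lam] = lam (lift ord0 j) * (g j).@[x].
  by rewrite mevalM meval_rshift meval_inx.
rewrite /h_FJ !forall_in_cat_map forall_in_seq1 meval_sum_sqr.
split=> [[H1 [H2 H3]]|[[H1 H2] H3]]; split.
- by split=> [i|j]; [apply/subr_eq0P; rewrite -E1|rewrite -E2].
- by apply/esym/subr_eq0P.
- by move=> i; rewrite E1; apply/subr_eq0P.
- by split=> [j|]; [rewrite E2|apply/subr_eq0P].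
Qed.

Lemma h_FJ_plus_zeroP x lam :
  (forall p, p \in h_FJ_plus f g -> p.@[join x lam] = 0) <->
  fj_point x (lam ord0 ^+ 2) (fun j => lam (lift ord0 j) ^+ 2) /\
  lam ord0 ^+ 2 + \sum_(j < m) lam (lift ord0 j) ^+ 2 = 1.
Proof.
have E1 i : (lam0 R n m ^+ 2 * inx m.+1 f^`M(i)
      - \sum_(j < m) lamFJ R n j ^+ 2 * inx m.+1 (g j)^`M(i)).@[join x lam]
    = lam ord0 ^+ 2 * (f^`M(i)).@[x]
      - \sum_(j < m) lam (lift ord0 j) ^+ 2 * ((g j)^`M(i)).@[x].
  rewrite mevalB mevalM mevalXn meval_rshift meval_inx meval_sum; congr (_ - _).
  by apply: eq_bigr => j _; rewrite mevalM mevalXn meval_rshift meval_inx.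
have E2 j : (lamFJ R n j ^+ 2 * inx m.+1 (g j)).@[join x lam]
    = lam (lift ord0 j) ^+ 2 * (g j).@[x].
  by rewrite mevalM mevalXn meval_rshift meval_inx.
rewrite /h_FJ_plus !forall_in_cat_map forall_in_seq1 meval_sum_sqr.
split=> [[H1 [H2 H3]]|[[H1 H2] H3]]; split.
- by split=> [i|j]; [apply/subr_eq0P; rewrite -E1|rewrite -E2].
- by apply/esym/subr_eq0P.
- by move=> i; rewrite E1; apply/subr_eq0P.
- by split=> [j|]; [rewrite E2|apply/subr_eq0P].
Qed.

Lemma fj_point_scale x c mu0 mu : fj_point x mu0 mu ->
  fj_point x (mu0 * c) (fun j => mu j * c).
Proof.
move=> [H1 H2]; split=> [i|j]; last by rewrite mulrAC H2 mul0r.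
by rewrite mulrAC H1 mulr_suml; apply: eq_bigr => j _; rewrite mulrAC.
Qed.

Lemma fj_point_multiplier x mu0 mu : mu0 != 0 -> fj_point x mu0 mu ->
  exists lam, multiplier_point f g x lam.
Proof.
move=> mu00 /(fj_point_scale mu0^-1) [H1 H2]; exists (fun j => mu j / mu0); split=> // i.
by rewrite -H1 divff // mul1r.
Qed.

(** The upper block of [phi] expresses the gradient relation with [lambda_0 = 0], the diagonal lower
    block complementarity. *)
Lemma phi_mul_eq0 x mu : fj_point x 0 mu ->
  forall k, \sum_(j < m) mu j * phi g x k j = 0.
Proof.
move=> [H1 H2] k; rewrite /phi -(splitK k); case: (fintype.split k) => [i|l] /=.
  under eq_bigr => j _ do rewrite col_mxEu mxE.
  by rewrite -H1 mul0r.
under eq_bigr => j _ do rewrite col_mxEd !mxE.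
rewrite (bigD1 l) //= eqxx mulr1n H2 add0r big1 // => j jl.
by rewrite eq_sym (negbTE jl) mulr0n mulr0.
Qed.

Lemma fj_point_crit x mu : fj_point x 0 mu -> (exists j, mu j != 0) -> crit g x.
Proof.
move=> /phi_mul_eq0 H [j muj]; rewrite /crit /= ltn_neqAle rank_leq_col andbT.
apply/negP => full; have /row_fullP [B BA] : row_full (phi g x) by [].
pose u : 'cV[R]_m := \col_l mu l.
have u0 : phi g x *m u = 0.
  apply/matrixP => k l; rewrite !mxE -[RHS](H k); apply: eq_bigr => i _.
  by rewrite !mxE mulrC.
have : u j ord0 = 0 by rewrite -[u]mul1mx -BA -mulmxA u0 mulmx0 mxE.
by rewrite mxE; apply/eqP.
Qed.

(** The weights [mu] put zero in the hull of all columns, so [rank_plus] counts proper index sets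
    only. The sum [1] also forces [m] to be positive, without which no strict inequality could
    hold. *)
Lemma fj_point_crit_plus x mu : fj_point x 0 mu -> (forall j, 0 <= mu j) ->
  \sum_(j < m) mu j = 1 -> crit_plus g x.
Proof.
move=> /phi_mul_eq0 H mu0 muS; rewrite /crit_plus /=.
have m0 : (0 < m)%N.
  case: (posnP m) => // m0; move: muS; rewrite big1 => [/eqP|j]; first by rewrite eq_sym oner_eq0.
  by have := ltn_ord j; rewrite {2}m0.
rewrite -[X in (_ < X)%N](prednK m0) ltnS /rank_plus; apply/bigmax_leqP => J /asboolP nJ.
rewrite -ltnS prednK // -[X in (_ < X)%N]card_ord.
suff JT : J \proper [set: 'I_m]%SET by have := proper_card JT; rewrite cardsT.
rewrite properT; apply/negP => /eqP JT; apply: nJ; rewrite JT.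
exists mu; split=> //; first by rewrite -muS; apply: eq_bigl => j; rewrite inE.
apply/matrixP => k l; rewrite summxE mxE -[RHS](H k).
under eq_bigl => j do rewrite inE.
by apply: eq_bigr => j _; rewrite !mxE.
Qed.

Variable xstar : 'I_n -> R.
Hypothesis hopt : optimal_solution f g xstar.

Lemma optimal_minimum x : feasible g x -> f.@[xstar] <= f.@[x].
Proof.
by case: hopt => _ E gx; rewrite -lee_fin E; apply: ereal_inf_lbound; exists x.
Qed.

Lemma opt_computes_multipliers (k : nat) (h : seq {mpoly R[n + k]}) :
    finite_set [set f.@[x] | x in
      [set x | feasible g x /\ exists lam, forall p, p \in h -> p.@[join x lam] = 0]] ->
    (exists lam, forall p, p \in h -> p.@[join xstar lam] = 0) ->
  opt_computes (inx k f) (fun j => inx k (g j)) h (opt_value f g).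
Proof.
move=> fin [lam hlam]; have [gx <-] := hopt.
have attE c : attained (inx k f) (fun j => inx k (g j)) h c <->
    exists x, [/\ feasible g x, exists lam, forall p, p \in h -> p.@[join x lam] = 0
      & f.@[x] = c].
  split=> [[z [hz gz] <-]|[x [gx' [l hl] <-]]].
    have zE : z = join (fun i => z (lshift k i)) (fun i => z (rshift n i)).
      by apply: funext => i; rewrite /join -{1}(splitK i); case: (fintype.split i).
    move: (fun i => z (lshift k i)) (fun i => z (rshift n i)) zE => x l zE.
    rewrite {}zE in hz gz *; exists x; split; last by rewrite meval_inx.
      by move=> j; have := gz j; rewrite meval_inx.
    by exists l.
  exists (join x l); last exact: meval_inx.
  by split=> // j; rewrite meval_inx.
apply: opt_computes_min.
- apply: sub_finite_set fin => c /attE [x [gx' lx <-]]; by exists x.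
- by apply/attE; exists xstar; split=> //; exists lam.
- by move=> c /attE [x [gx' _ <-]]; apply: optimal_minimum.
Qed.

Definition cons_ord (mu0 : R) (mu : 'I_m -> R) (i : 'I_m.+1) : R :=
  if unlift ord0 i is Some j then mu j else mu0.

Lemma cons_ord0 mu0 mu : cons_ord mu0 mu ord0 = mu0.
Proof. by rewrite /cons_ord unlift_none. Qed.

Lemma cons_ord_lift mu0 mu j : cons_ord mu0 mu (lift ord0 j) = mu j.
Proof. by rewrite /cons_ord liftK. Qed.

Lemma fritz_john_optimal : exists mu0 mu, [/\ 0 <= mu0, forall j, 0 <= mu j,
  0 < mu0 + \sum_j mu j & fj_point xstar mu0 mu].
Proof.
have [gx _] := hopt; have [mu0 [mu [? ? ? ? ?]]] := fritz_john gx optimal_minimum.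
by exists mu0, mu.
Qed.

Lemma opt_computes_FJ : finite_set [set f.@[x] | x in feasible g `&` crit g] ->
  opt_computes (inx m.+1 f) (fun j => inx m.+1 (g j)) (h_FJ f g) (opt_value f g).
Proof.
move=> fin; apply: opt_computes_multipliers.
  have fin2 := finite_multiplier_values f g.
  have fin12 : finite_set ([set f.@[x] | x in feasible g `&` crit g] `|`
      [set f.@[x] | x in [set x | exists lam, multiplier_point f g x lam]]).
    by rewrite finite_setU.
  apply: sub_finite_set fin12.
  move=> _ [x [gx [lam /h_FJ_zeroP [fj S1]]] <-].
  (* Either [lambda_0] can be divided out, or the normalization leaves a nonzero multiplier among
     the others and the point is critical. *)
  have [l0|l0] := eqVneq (lam ord0) 0; last first.
    by right; exists x => //; apply: fj_point_multiplier l0 fj.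
  left; exists x => //; split=> //; rewrite l0 in fj S1; apply: (fj_point_crit fj).
  apply: contrapT => nex; have /eqP := S1; rewrite expr0n add0r big1 => [|j _].
    by rewrite eq_sym oner_eq0.
  have [->|lj] := eqVneq (lam (lift ord0 j)) 0; first by rewrite expr0n.
  by case: nex; exists j.
have [mu0 [mu [m0 mj mS fj]]] := fritz_john_optimal.
pose S := mu0 ^+ 2 + \sum_j mu j ^+ 2.
have S0 : 0 < S.
  have S'0 : 0 <= \sum_j mu j ^+ 2 by apply: sumr_ge0 => j _; apply: sqr_ge0.
  rewrite lt_neqAle eq_sym addr_ge0 ?sqr_ge0 // andbT.
  apply: contraTneq mS => /eqP; rewrite paddr_eq0 ?sqr_ge0 // sqrf_eq0.
  move=> /andP [/eqP -> /eqP Sz]; rewrite add0r big1 ?ltxx // => j _.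
  apply/eqP; rewrite -sqrf_eq0; apply/eqP.
  by apply: (psumr_eq0P _ Sz) => // i _; apply: sqr_ge0.
exists (cons_ord (mu0 / Num.sqrt S) (fun j => mu j / Num.sqrt S)).
apply/h_FJ_zeroP; rewrite cons_ord0.
have -> : (fun j => cons_ord (mu0 / Num.sqrt S) (fun j => mu j / Num.sqrt S) (lift ord0 j))
    = (fun j => mu j / Num.sqrt S) by apply: funext => j; rewrite cons_ord_lift.
split; first exact: fj_point_scale.
under eq_bigr => j _ do rewrite cons_ord_lift expr_div_n.
by rewrite -mulr_suml expr_div_n -mulrDl sqr_sqrtr ?ltW // divff // gt_eqF.
Qed.

Lemma opt_computes_FJ_plus : finite_set [set f.@[x] | x in feasible g `&` crit_plus g] ->
  opt_computes (inx m.+1 f) (fun j => inx m.+1 (g j)) (h_FJ_plus f g) (opt_value f g).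
Proof.
move=> fin; apply: opt_computes_multipliers.
  have fin2 := finite_multiplier_values f g.
  have fin12 : finite_set ([set f.@[x] | x in feasible g `&` crit_plus g] `|`
      [set f.@[x] | x in [set x | exists lam, multiplier_point f g x lam]]).
    by rewrite finite_setU.
  apply: sub_finite_set fin12.
  move=> _ [x [gx [lam /h_FJ_plus_zeroP [fj S1]]] <-].
  have [l0|l0] := eqVneq (lam ord0 ^+ 2) 0; last first.
    by right; exists x => //; apply: fj_point_multiplier l0 fj.
  left; exists x => //; split=> //; rewrite l0 in fj S1; apply: (fj_point_crit_plus fj).
    by move=> j; apply: sqr_ge0.
  by rewrite -S1 add0r.
have [mu0 [mu [m0 mj mS fj]]] := fritz_john_optimal.
(* Squares of the variables act as multipliers here, so the sphere equation asks that the
   multipliers sum to [1]; they are divided by their sum instead of their Euclidean norm. *)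
pose S := mu0 + \sum_j mu j.
exists (cons_ord (Num.sqrt (mu0 / S)) (fun j => Num.sqrt (mu j / S))).
have sq a : 0 <= a -> Num.sqrt (a / S) ^+ 2 = a / S.
  by move=> a0; rewrite sqr_sqrtr // divr_ge0 // ltW.
apply/h_FJ_plus_zeroP; rewrite cons_ord0 sq //.
have -> : (fun j => cons_ord (Num.sqrt (mu0 / S)) (fun j => Num.sqrt (mu j / S)) (lift ord0 j) ^+ 2)
    = (fun j => mu j / S) by apply: funext => j; rewrite cons_ord_lift sq.
split; first exact: fj_point_scale.
under eq_bigr => j _ do rewrite cons_ord_lift sq //.
by rewrite -mulr_suml -mulrDl divff // gt_eqF.
Qed.

Lemma opt_computes_KKT : KKT f g xstar ->
  opt_computes (inx m f) (fun j => inx m (g j)) (h_KKT f g) (opt_value f g).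
Proof.
move=> [lam [_ H1 H2]]; apply: opt_computes_multipliers; last first.
  by exists lam; apply/h_KKT_zeroP.
apply: sub_finite_set (finite_multiplier_values f g).
by move=> _ [x [gx [l /h_KKT_zeroP xl]] <-]; exists x => //; exists l.
Qed.

Lemma opt_computes_KKT_plus : KKT f g xstar ->
  opt_computes (inx m f) (fun j => inx m (g j)) (h_KKT_plus f g) (opt_value f g).
Proof.
move=> [lam [lam0 H1 H2]]; apply: opt_computes_multipliers; last first.
  (* The sign condition on the multipliers is what allows these square roots. *)
  exists (fun j => Num.sqrt (lam j)); apply/h_KKT_plus_zeroP.
  have -> : (fun j => Num.sqrt (lam j) ^+ 2) = lam by apply: funext => j; rewrite sqr_sqrtr.
  by [].
apply: sub_finite_set (finite_multiplier_values f g).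
by move=> _ [x [gx [l /h_KKT_plus_zeroP xl]] <-]; exists x => //; eexists; exact: xl.
Qed.

End Assembly.

Theorem theorem1 (R : realType) (n m : nat) (f : {mpoly R[n]})
    (g : 'I_m -> {mpoly R[n]}) (xstar : 'I_n -> R)
    (hopt : optimal_solution f g xstar) :
  [/\ finite_set [set f.@[x] | x in feasible g `&` crit g] ->
        opt_computes (inx m.+1 f) (fun j => inx m.+1 (g j)) (h_FJ f g)
          (opt_value f g),
      finite_set [set f.@[x] | x in feasible g `&` crit_plus g] ->
        opt_computes (inx m.+1 f) (fun j => inx m.+1 (g j)) (h_FJ_plus f g)
          (opt_value f g)
    & KKT f g xstar ->
        opt_computes (inx m f) (fun j => inx m (g j)) (h_KKT f g)
          (opt_value f g) /\
        opt_computes (inx m f) (fun j => inx m (g j)) (h_KKT_plus f g)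
          (opt_value f g)].
Proof.
split; [exact: opt_computes_FJ hopt|exact: opt_computes_FJ_plus hopt|].
by move=> kkt; split; [exact: opt_computes_KKT hopt kkt|exact: opt_computes_KKT_plus hopt kkt].
Qed.
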